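(* Let $$X_1=\left\{(z_1,z_2)\in\mathbb{C}^2 : |z_1|>e,\ |z_2|<\frac{1}{|z_1|\log|z_1|}\right\},$$ $$X_2=\left\{(z_1,z_2)\in\mathbb{C}^2 : |z_2|>e,\ |z_1|<\frac{1}{|z_2|\log|z_2|}\right\},$$ $$X_3=\left\{(z_1,z_2)\in\mathbb{C}^2 : |z_1|\le e,\ |z_2|\le e\right\},$$ and $\Omega_0=X_1\cup X_2\cup X_3$. Then the Hankel operator $H_{\overline{z_1z_2}}$ with anti-holomorphic symbol $\overline{z_1z_2}$ is a nonzero Hilbert--Schmidt operator on $A^2(\Omega_0)$.
   Context: $L^2(\Omega_0)$ is the space of square-integrable functions on $\Omega_0$ with respect to Lebesgue measure, and $A^2(\Omega_0)$ (the Bergman space) is the closed subspace of square-integrable holomorphic functions; here holomorphic means holomorphic on the interior of $\Omega_0$, which differs from $\Omega_0$ by a set of measure zero. $P:L^2(\Omega_0)\to A^2(\Omega_0)$ is the orthogonal (Bergman) projection. For $f\in A^2(\Omega_0)$, the Hankel operator with anti-holomorphic symbol $\overline{f}$ is the (possibly unbounded) densely defined operator on $A^2(\Omega_0)$, with values in $L^2(\Omega_0)$, given by $H_{\overline f}(g)=(I-P)(\overline{f}g)$ for those $g\in A^2(\Omega_0)$ with $\overline{f}g\in L^2(\Omega_0)$. Here $f(z_1,z_2)=z_1z_2$. A bounded linear operator $T$ on a Hilbert space $H$ is Hilbert--Schmidt if there is an orthonormal basis $\{\xi_j\}$ of $H$ with $\sum_j\|T(\xi_j)\|^2<\infty$ (the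 sum does not depend on the choice of orthonormal basis). ''$H_{\overline f}$ is Hilbert--Schmidt on $A^2(\Omega_0)$'' means that the densely defined operator $H_{\overline f}$ extends to a bounded operator $A^2(\Omega_0)\to L^2(\Omega_0)$ that is Hilbert--Schmidt. *)

(* Defs.v *)
From HB Require Import structures.
From mathcomp Require Import all_boot all_order all_algebra.
From mathcomp Require Import complex.
From mathcomp Require Import all_classical all_reals all_analysis.

Set Implicit Arguments.
Unset Strict Implicit.
Unset Printing Implicit Defensive.

Import Order.TTheory GRing.Theory Num.Theory.
Import numFieldNormedType.Exports.

Local Open Scope classical_set_scope.
Local Open Scope ring_scope.
Local Open Scope complex_scope.

(* The topology and the norm of the complex plane are found on the regular
   module [R[i]^o].  Since [C2 R] is then a normed module over the field [R[i]],
   [differentiable] on it means Frechet differentiable over the complex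
   numbers. *)
Notation C2 R := ((R[i])^o * (R[i])^o)%type.
Notation normc := (@ComplexField.Normc.normc _).

Section Lebesgue.
Variable R : realType.

(* Lebesgue measure on C^2 is carried by the real coordinates
   ((x1, y1), (x2, y2)), where z1 = x1 + i y1 and z2 = x2 + i y2; integrals
   over a subset of C^2 are pulled back along [toC2]. *)
Definition toC2 (x : (measurableTypeR R * measurableTypeR R) *
                     (measurableTypeR R * measurableTypeR R)) : C2 R :=
  (x.1.1 +i* x.1.2, x.2.1 +i* x.2.2).

Definition lebesgue2 := (@lebesgue_measure R \x @lebesgue_measure R)%E.

HB.instance Definition _ := Measure.on lebesgue2.

Let lebesgue2_sigma_finite : sigma_finite setT lebesgue2.
Proof.
have /sigma_finiteP[F [TF ndF Foo]] := sigma_finiteT (@lebesgue_measure R).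
exists (fun n => F n `*` F n).
  rewrite -setXTT TF predeqE => -[x y]; split.
    move=> [/= [n _ Fnx] [k _ Fky]]; exists (maxn n k) => //; split.
    - by move: x Fnx; exact/subsetPset/ndF/leq_maxl.
    - by move: y Fky; exact/subsetPset/ndF/leq_maxr.
  by move=> [n _ []/= ? ?]; split; exists n.
move=> k; have [? ?] := Foo k.
split; first exact: measurableX.
by rewrite /lebesgue2 product_measure1E// lte_mul_pinfty// ge0_fin_numE.
Qed.

(* The library's sigma-finiteness of [\x] is shadowed by its instance for
   products of subprobabilities, hence this one. *)
HB.instance Definition _ := Measure_isSigmaFinite.Build _ _ _ lebesgue2
  lebesgue2_sigma_finite.

Definition lebesgue4 := (lebesgue2 \x lebesgue2)%E.

HB.instance Definition _ := Measure.on lebesgue4.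

End Lebesgue.

(* The elements of L^2(D) and A^2(D) are represented by functions on C^2, of
   which only the values on D matter; equality in L^2(D) is [eqL2], equality
   almost everywhere on D. *)
Section HilbertSpaces.
Variable R : realType.
Local Notation C := (R[i])^o.
Variable D : set (C2 R).
Implicit Types f g h : C2 R -> C.

Definition eqL2 f g : Prop :=
  ae_eq (@lebesgue4 R) (@toC2 R @^-1` D) (f \o @toC2 R) (g \o @toC2 R).

Definition L2 : set (C2 R -> C) := [set f : C2 R -> C |
  [/\ measurable_fun (@toC2 R @^-1` D) (fun x => complex.Re (f (toC2 x))),
      measurable_fun (@toC2 R @^-1` D) (fun x => complex.Im (f (toC2 x))) &
      (\int[@lebesgue4 R]_(x in @toC2 R @^-1` D)
         ((normc (f (toC2 x)) ^+ 2)%:E) < +oo)%E]].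

Definition L2inner f g : R[i] :=
  (\int[@lebesgue4 R]_(x in @toC2 R @^-1` D)
     complex.Re (f (toC2 x) * (g (toC2 x))^*)) +i*
  (\int[@lebesgue4 R]_(x in @toC2 R @^-1` D)
     complex.Im (f (toC2 x) * (g (toC2 x))^*)).

Definition L2norm f : R :=
  Num.sqrt (\int[@lebesgue4 R]_(x in @toC2 R @^-1` D) normc (f (toC2 x)) ^+ 2).

Definition A2 : set (C2 R -> C) :=
  [set f : C2 R -> C | L2 f /\ forall z, D° z -> differentiable f z].

(* The projection exists for every h in L^2(D), and is then unique up to
   [eqL2]; the default value [cst 0] serves only for h outside L^2(D). *)
Definition bergman_proj h : C2 R -> C :=
  xget (cst 0) [set p | A2 p /\ forall g, A2 g -> L2inner (h \- p) g = 0].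

Definition dense_in_A2 (A : set (C2 R -> C)) : Prop :=
  forall g, A2 g -> forall e : R, 0 < e ->
    exists2 h, A h /\ A2 h & L2norm (g \- h) < e.

Definition orthonormal_basis_A2 (J : choiceType) (xi : J -> C2 R -> C) : Prop :=
  [/\ forall j, A2 (xi j),
      forall j k, L2inner (xi j) (xi k) = (j == k)%:R &
      dense_in_A2 [set h | exists (s : seq J) (c : J -> C),
                      h = fun z => \sum_(j <- s) c j * xi j z]].

(* Boundedness and linearity imply that T is compatible with [eqL2]. *)
Definition bounded_operator_A2_L2 (T : (C2 R -> C) -> (C2 R -> C)) : Prop :=
  [/\ forall g, A2 g -> L2 (T g),
      forall (a : C) g h, A2 g -> A2 h ->
        eqL2 (T (fun z => a * g z + h z)) (fun z => a * T g z + T h z) &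
      exists M : R, forall g, A2 g -> L2norm (T g) <= M * L2norm g].

Definition hilbert_schmidt (T : (C2 R -> C) -> (C2 R -> C)) : Prop :=
  exists (J : choiceType) (xi : J -> C2 R -> C),
    orthonormal_basis_A2 xi /\
    (\esum_(j in [set: J]) ((L2norm (T (xi j)) ^+ 2)%:E) < +oo)%E.

Definition densely_defined_hilbert_schmidt (dom : set (C2 R -> C))
    (H : (C2 R -> C) -> (C2 R -> C)) : Prop :=
  dense_in_A2 dom /\
  exists T : (C2 R -> C) -> (C2 R -> C),
    [/\ bounded_operator_A2_L2 T,
        forall g, dom g -> eqL2 (T g) (H g) &
        hilbert_schmidt T].

Definition nonzero_operator (dom : set (C2 R -> C))
    (H : (C2 R -> C) -> (C2 R -> C)) : Prop :=
  exists2 g, dom g & ~ eqL2 (H g) (cst 0).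

Definition conj_mul f g : C2 R -> C := fun z => (f z)^* * g z.

Definition hankel_dom f : set (C2 R -> C) :=
  [set g | A2 g /\ L2 (conj_mul f g)].

Definition hankel f g : C2 R -> C :=
  conj_mul f g \- bergman_proj (conj_mul f g).

End HilbertSpaces.

Section Domain.
Variable R : realType.

Definition X1 : set (C2 R) := [set z | expR 1 < normc z.1 /\
  normc z.2 < 1 / (normc z.1 * ln (normc z.1))].

Definition X2 : set (C2 R) := [set z | expR 1 < normc z.2 /\
  normc z.1 < 1 / (normc z.2 * ln (normc z.2))].

Definition X3 : set (C2 R) := [set z |
  normc z.1 <= expR 1 /\ normc z.2 <= expR 1].

Definition Omega0 : set (C2 R) := X1 `|` X2 `|` X3.

End Domain.

(* Main.v *)
Require Import Defs.
From HB Require Import structures.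
From mathcomp Require Import all_boot all_order all_algebra.
From mathcomp Require Import complex.
From mathcomp Require Import all_classical all_reals all_analysis.
From mathcomp Require Import measurable_realfun.
From mathcomp Require Import ring lra.

(** Put [f z = z.1 * z.2].  On [Omega0] the modulus of [f] is at most [e ^+ 2],
    so the Hankel operator is defined on the whole Bergman space and bounded.
    It is Hilbert-Schmidt because the Bergman space is small: its elements are
    power series in the single variable [f].

    Every [g] in the Bergman space is holomorphic on polydiscs centred at 0
    that cover [Omega0] up to a null set.  There it is the sum of a double power
    series [power_series2], obtained from Cauchy's formula in each variable, and
    the monomials are pairwise orthogonal because Lebesgue measure is invariant
    under rotations of each coordinate [rot4_preserving, monomial_orth].
    Bessel's inequality on the polydisc of radii [expR x] and [1 / (expR x * x)]
    bounds the coefficient of [z1 ^+ j * z2 ^+ k], for [j > k], by a multiple of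
    [x ^+ k.+1 / expR x]; with [x] tending to infinity it vanishes, and the case
    [j < k] is symmetric.  Hence [g] is a power series in [f] [A2_expansion].

    It follows that the powers of [f] are an orthogonal basis.  Let [c n] be
    the squared norm of [f ^+ n].  The projection of [f^* * \sum_n a n * f ^+ n]
    is [\sum_n (c n.+1 / c n) * a n.+1 * f ^+ n]; this is again a holomorphic
    square integrable function [shifted_projection, power_series_A2].  If [xi n]
    is the normalized power, then the image of [xi n] is orthogonal to the
    Bergman space, so its norm is at most the distance of [f^* * xi n] to the
    line of [f ^+ n.-1], the square of which is [c n.+1 / c n - c n / c n.-1],
    without the last term if [n = 0] [projection_defect_le].  These bounds
    telescope, and their sums are at most [c N.+1 / c N <= e ^+ 4]
    [moment_ratio_telescope].  Finally [f^*] is orthogonal to all powers of [f]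
    without being 0, so it is not in the Bergman space and the operator does not
    kill the constant 1 [conj_not_radial]. *)

Set Implicit Arguments.
Unset Strict Implicit.
Unset Printing Implicit Defensive.

Import Order.TTheory GRing.Theory Num.Theory.
Import numFieldNormedType.Exports.

Local Open Scope classical_set_scope.
Local Open Scope ring_scope.
Local Open Scope complex_scope.

(** * Modulus, real and imaginary parts *)

Section ComplexNorm.
Variable R : realType.
Implicit Types z w : R[i].
Local Notation Re := complex.Re.
Local Notation Im := complex.Im.

Lemma normc_sqr z : normc z ^+ 2 = Re z ^+ 2 + Im z ^+ 2.
Proof. by case: z => a b /=; rewrite sqr_sqrtr// addr_ge0// sqr_ge0. Qed.

Lemma normc_ge0 z : 0 <= normc z.
Proof. by case: z => a b /=; rewrite sqrtr_ge0. Qed.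

Lemma normcD z w : normc (z + w) <= normc z + normc w.
Proof. exact: le_normcD. Qed.

Lemma normc_mul z w : normc (z * w) = normc z * normc w.
Proof. exact: ComplexField.Normc.normcM. Qed.

Lemma normc_opp z : normc (- z) = normc z.
Proof. exact: normcN. Qed.

Lemma normcB z w : normc (z - w) <= normc z + normc w.
Proof. by rewrite -(normc_opp w) normcD. Qed.

Lemma normc_distC z w : normc (z - w) = normc (w - z).
Proof. by rewrite -normc_opp opprB. Qed.

Lemma normc_conj z : normc (conjc z) = normc z.
Proof. by case: z => a b /=; rewrite sqrrN. Qed.

Lemma normc_exp z n : normc (z ^+ n) = normc z ^+ n.
Proof.
elim: n => [|n IH]; first by rewrite !expr0 ComplexField.Normc.normc1.
by rewrite !exprS normc_mul IH.
Qed.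

Lemma normc_real (x : R) : normc x%:C = `|x|.
Proof. by rewrite /= expr0n /= addr0 sqrtr_sqr. Qed.

Lemma normc_eq0 z : (normc z == 0) = (z == 0).
Proof.
apply/eqP/eqP => [|->]; first exact: ComplexField.Normc.eq0_normc.
exact: ComplexField.Normc.normc0.
Qed.

Lemma normc_gt0 z : (0 < normc z) = (z != 0).
Proof. by rewrite lt_neqAle normc_ge0 andbT eq_sym normc_eq0. Qed.

Lemma normcE_norm z : `|z| = (normc z)%:C.
Proof. by []. Qed.

Lemma normc_Re z : `|Re z| <= normc z.
Proof.
rewrite -(ler_pXn2r (n:=2)) ?nnegrE ?normc_ge0//.
by rewrite normc_sqr real_normK ?num_real// lerDl sqr_ge0.
Qed.

Lemma normc_Im z : `|Im z| <= normc z.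
Proof.
rewrite -(ler_pXn2r (n:=2)) ?nnegrE ?normc_ge0//.
by rewrite normc_sqr real_normK ?num_real// lerDr sqr_ge0.
Qed.

Lemma normc_le_ReIm z : normc z <= `|Re z| + `|Im z|.
Proof.
rewrite -(ler_pXn2r (n:=2)) ?nnegrE ?normc_ge0 ?addr_ge0//.
rewrite normc_sqr sqrrD !real_normK ?num_real//.
by have := mulr_ge0 (normr_ge0 (Re z)) (normr_ge0 (Im z)); lra.
Qed.

Lemma normc_sum I (s : seq I) (F : I -> R[i]) :
  normc (\sum_(i <- s) F i) <= \sum_(i <- s) normc (F i).
Proof.
elim: s => [|i s IH]; first by rewrite !big_nil ComplexField.Normc.normc0.
by rewrite !big_cons (le_trans (normcD _ _))// lerD2l.
Qed.

Lemma cReD z w : Re (z + w) = Re z + Re w.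
Proof. by case: z; case: w. Qed.
Lemma cImD z w : Im (z + w) = Im z + Im w.
Proof. by case: z; case: w. Qed.
Lemma cReN z : Re (- z) = - Re z.
Proof. by case: z. Qed.
Lemma cImN z : Im (- z) = - Im z.
Proof. by case: z. Qed.
Lemma cReM z w : Re (z * w) = Re z * Re w - Im z * Im w.
Proof. by case: z; case: w. Qed.
Lemma cImM z w : Im (z * w) = Re z * Im w + Im z * Re w.
Proof. by case: z; case: w. Qed.
Lemma cRe_conj z : Re (conjc z) = Re z. Proof. by case: z. Qed.
Lemma cIm_conj z : Im (conjc z) = - Im z. Proof. by case: z. Qed.
Lemma complexP z w : Re z = Re w -> Im z = Im w -> z = w.
Proof. by case: z => a b; case: w => c d /= -> ->. Qed.

Lemma mul_conjc z : z * conjc z = (normc z ^+ 2)%:C.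
Proof.
rewrite normc_sqr; apply: complexP; rewrite ?cReM ?cImM ?cRe_conj ?cIm_conj /=; ring.
Qed.

Definition cE := (cReD, cImD, cReN, cImN, cReM, cImM, cRe_conj, cIm_conj).

End ComplexNorm.

(** * Measurability and integration of complex functions *)

Section ComplexMeasurable.
Context d (T : measurableType d) (R : realType).
Implicit Types (D : set T) (u v : T -> R[i]).
Local Notation Re := complex.Re.
Local Notation Im := complex.Im.

(** The split form in which membership in L^2 states measurability. *)
Definition mfunC D u :=
  measurable_fun D (fun x => Re (u x)) /\ measurable_fun D (fun x => Im (u x)).

Lemma mfunC_cst D c : mfunC D (fun=> c).
Proof. by split; exact: measurable_cst. Qed.

Lemma mfunCD D u v : mfunC D u -> mfunC D v -> mfunC D (fun x => u x + v x).
Proof.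
move=> [u1 u2] [v1 v2]; split.
- by under eq_fun do rewrite cReD; exact: measurable_funD.
- by under eq_fun do rewrite cImD; exact: measurable_funD.
Qed.

Lemma mfunCN D u : mfunC D u -> mfunC D (fun x => - u x).
Proof.
move=> [u1 u2]; split.
- by under eq_fun do rewrite cReN; exact: measurableT_comp.
- by under eq_fun do rewrite cImN; exact: measurableT_comp.
Qed.

Lemma mfunCB D u v : mfunC D u -> mfunC D v -> mfunC D (fun x => u x - v x).
Proof. by move=> mu mv; apply: mfunCD => //; exact: mfunCN. Qed.

Lemma mfunCM D u v : mfunC D u -> mfunC D v -> mfunC D (fun x => u x * v x).
Proof.
move=> [u1 u2] [v1 v2]; split.
- under eq_fun do rewrite cReM.
  by apply: measurable_funB; exact: measurable_funM.
- under eq_fun do rewrite cImM.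
  by apply: measurable_funD; exact: measurable_funM.
Qed.

Lemma mfunCJ D u : mfunC D u -> mfunC D (fun x => conjc (u x)).
Proof.
move=> [u1 u2]; split.
- by under eq_fun do rewrite cRe_conj.
- by under eq_fun do rewrite cIm_conj; exact: measurableT_comp.
Qed.

Lemma mfunC_exp D u n : mfunC D u -> mfunC D (fun x => u x ^+ n).
Proof.
move=> mu; elim: n => [|n IH]; first exact: mfunC_cst.
by under eq_fun do rewrite exprS; exact: mfunCM.
Qed.

Lemma mfunC_sum D I (s : seq I) (F : I -> T -> R[i]) :
  (forall i, mfunC D (F i)) -> mfunC D (fun x => \sum_(i <- s) F i x).
Proof.
move=> mF; elim: s => [|i s IH].
  by under eq_fun do rewrite big_nil; exact: mfunC_cst.
by under eq_fun do rewrite big_cons; exact: mfunCD.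
Qed.

Lemma mfunCS D E u : measurable E -> D `<=` E -> mfunC E u -> mfunC D u.
Proof. by move=> mE DE [u1 u2]; split; exact: (measurable_funS mE DE). Qed.

Lemma mfunC_normc2 D u : mfunC D u -> measurable_fun D (fun x => normc (u x) ^+ 2).
Proof.
move=> [u1 u2]; under eq_fun do rewrite normc_sqr.
by apply: measurable_funD; exact: measurable_funX.
Qed.

Lemma mfunC_normc D u : mfunC D u -> measurable_fun D (fun x => normc (u x)).
Proof.
move=> mu.
have := mfunC_normc2 mu.
rewrite (_ : (fun x => normc (u x)) = Num.sqrt \o (fun x => normc (u x) ^+ 2)).
  move=> m; apply: measurableT_comp => //.
  by apply: continuous_measurable_fun; exact: sqrt_continuous.
by apply/funext => x /=; rewrite sqrtr_sqr ger0_norm// normc_ge0.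
Qed.

End ComplexMeasurable.

Section ComplexIntegral.
Context d (T : measurableType d) (R : realType).
Variable mu : {measure set T -> \bar R}.
Variables (D : set T) (mD : measurable D).
Implicit Types (u v : T -> R[i]).
Local Notation Re := complex.Re.
Local Notation Im := complex.Im.

Definition cintegrable u :=
  mu.-integrable D (EFin \o (fun x => Re (u x))) /\
  mu.-integrable D (EFin \o (fun x => Im (u x))).

Definition cint u : R[i] :=
  (\int[mu]_(x in D) Re (u x)) +i* (\int[mu]_(x in D) Im (u x)).

Lemma eq_cint u v : {in D, u =1 v} -> cint u = cint v.
Proof.
by move=> uv; congr (_ +i* _); apply: eq_Rintegral => x xD; rewrite uv.
Qed.

Lemma integrable_bounded (f : T -> R) M : (mu D < +oo)%E ->
  measurable_fun D f -> (forall x, D x -> `|f x| <= M) ->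
  mu.-integrable D (EFin \o f).
Proof.
move=> fD mf fM.
apply: measurable_bounded_integrable => //.
exists M; split; first exact: num_real.
move=> y My x Dx /=; exact: (le_trans (fM _ Dx) (ltW My)).
Qed.

Lemma integrableZR k (f : T -> R) : mu.-integrable D (EFin \o f) ->
  mu.-integrable D (EFin \o (fun x => k * f x)).
Proof.
move=> i.
by rewrite (_ : _ \o _ = (fun x => k%:E * (EFin \o f) x)%E)//; exact: integrableZl.
Qed.

Lemma integrableDR (f g : T -> R) : mu.-integrable D (EFin \o f) ->
  mu.-integrable D (EFin \o g) -> mu.-integrable D (EFin \o (fun x => f x + g x)).
Proof.
move=> i j.
by rewrite (_ : _ \o _ = (EFin \o f) \+ (EFin \o g))//; exact: integrableD.
Qed.

Lemma integrableBR (f g : T -> R) : mu.-integrable D (EFin \o f) ->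
  mu.-integrable D (EFin \o g) -> mu.-integrable D (EFin \o (fun x => f x - g x)).
Proof.
move=> i j.
by rewrite (_ : _ \o _ = (EFin \o f) \- (EFin \o g))%E//; exact: integrableB.
Qed.

Lemma cintegrableZ c u : cintegrable u -> cintegrable (fun x => c * u x).
Proof.
move=> [u1 u2]; split.
- under eq_fun do rewrite cReM.
  by apply: integrableBR; exact: integrableZR.
- under eq_fun do rewrite cImM.
  by apply: integrableDR; exact: integrableZR.
Qed.

Lemma cintZ c u : cintegrable u -> cint (fun x => c * u x) = c * cint u.
Proof.
move=> [u1 u2]; rewrite /cint; apply: complexP.
- rewrite cReM /=; under eq_Rintegral do rewrite cReM.
  rewrite RintegralB ?RintegralZl//; exact: integrableZR.
- rewrite cImM /=; under eq_Rintegral do rewrite cImM.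
  rewrite RintegralD ?RintegralZl//; exact: integrableZR.
Qed.

Lemma cintD u v : cintegrable u -> cintegrable v ->
  cint (fun x => u x + v x) = cint u + cint v.
Proof.
move=> [u1 u2] [v1 v2]; rewrite /cint; apply: complexP.
- by rewrite cReD /= -RintegralD//; apply: eq_Rintegral => x _; rewrite cReD.
- by rewrite cImD /= -RintegralD//; apply: eq_Rintegral => x _; rewrite cImD.
Qed.

Lemma cintegrableN u : cintegrable u -> cintegrable (fun x => - u x).
Proof.
move=> iu; under eq_fun do rewrite -mulN1r; exact: cintegrableZ.
Qed.

Lemma cintN u : cintegrable u -> cint (fun x => - u x) = - cint u.
Proof.
by move=> iu; under eq_fun do rewrite -mulN1r; rewrite cintZ// mulN1r.
Qed.

Lemma cintB u v : cintegrable u -> cintegrable v ->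
  cint (fun x => u x - v x) = cint u - cint v.
Proof. by move=> iu iv; rewrite cintD ?cintN//; exact: cintegrableN. Qed.

Lemma cint0 : cint (fun=> 0) = 0.
Proof. by rewrite /cint /= Rintegral_cst// mul0r. Qed.

Lemma Rintegral_le_bound (f : T -> R) M : (mu D < +oo)%E ->
  mu.-integrable D (EFin \o f) ->
  (forall x, D x -> `|f x| <= M) ->
  `|\int[mu]_(x in D) f x| <= M * fine (mu D).
Proof.
move=> fD fi fM.
rewrite -Rintegral_cst// (le_trans (le_normr_Rintegral _ _))//.
apply: le_Rintegral => //.
- exact: integrable_norm.
- by apply: integrable_bounded => // x _; exact: lexx.
Qed.

Lemma cint_bound u M : (mu D < +oo)%E -> cintegrable u ->
  (forall x, D x -> normc (u x) <= M) ->
  normc (cint u) <= 2 * M * fine (mu D).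
Proof.
move=> fD [i1 i2] uM.
rewrite (le_trans (normc_le_ReIm _))//= mulrDl mul1r mulrDl lerD//.
- apply: Rintegral_le_bound => // x Dx.
  exact: le_trans (normc_Re _) (uM _ Dx).
- apply: Rintegral_le_bound => // x Dx.
  exact: le_trans (normc_Im _) (uM _ Dx).
Qed.

End ComplexIntegral.

(** * Goursat's bisection *)

Section Bisection.
Variable R : realType.
Variable e : R -> R -> R -> R -> R.
Variables a0 b0 c0 d0 : R.
Hypothesis ab0 : a0 <= b0.
Hypothesis cd0 : c0 <= d0.
Hypothesis e_splitl : forall a m b c d, a0 <= a -> a <= m -> m <= b -> b <= b0 ->
  c0 <= c -> c <= d -> d <= d0 -> e a b c d <= e a m c d + e m b c d.
Hypothesis e_splitr : forall a b c m d, a0 <= a -> a <= b -> b <= b0 ->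
  c0 <= c -> c <= m -> m <= d -> d <= d0 -> e a b c d <= e a b c m + e a b m d.
Hypothesis e_loc : forall x y, a0 <= x <= b0 -> c0 <= y <= d0 ->
  forall eps, 0 < eps -> exists2 del, 0 < del &
  forall a b c d, a0 <= a -> a <= x -> x <= b -> b <= b0 ->
    c0 <= c -> c <= y -> y <= d -> d <= d0 -> b - a < del -> d - c < del ->
    e a b c d <= eps * ((b - a) + (d - c)) ^+ 2.

Let rect := (R * R * R * R)%type.
Let bad eta (q : rect) := let: (a, b, c, d) := q in
  eta * ((b - a) + (d - c)) ^+ 2 < e a b c d.
Let next eta (q : rect) : rect := let: (a, b, c, d) := q in
  let m := (a + b) / 2 in let n := (c + d) / 2 in
  if bad eta (a, m, c, n) then (a, m, c, n) else
  if bad eta (a, m, n, d) then (a, m, n, d) else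
  if bad eta (m, b, c, n) then (m, b, c, n) else (m, b, n, d).
Let sub (p q : rect) := let: (a, b, c, d) := p in let: (a', b', c', d') := q in
  [/\ a' <= a, a <= b & b <= b'] /\ [/\ c' <= c, c <= d & d <= d'].
Let q0 : rect := (a0, b0, c0, d0).

Let next_sub eta q : sub q q0 -> sub (next eta q) q /\
   let: (a, b, c, d) := q in let: (a', b', c', d') := next eta q in
   b' - a' = (b - a) / 2 /\ d' - c' = (d - c) / 2.
Proof.
case: q => [[[a b] c] d] /= [[h1 h2 h3] [h4 h5 h6]].
have [l1 l2 l3 l4] : [/\ a <= (a + b) / 2, (a + b) / 2 <= b, c <= (c + d) / 2
  & (c + d) / 2 <= d] by split; lra.
by do 3?case: ifP => _ /=; split; split; (split => //) || lra.
Qed.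

Let next_bad eta q : sub q q0 -> bad eta q -> bad eta (next eta q).
Proof.
case: q => [[[a b] c] d] /= [[h1 h2 h3] [h4 h5 h6]] B.
have [l1 l2 l3 l4] : [/\ a <= (a + b) / 2, (a + b) / 2 <= b, c <= (c + d) / 2
  & (c + d) / 2 <= d] by split; lra.
case: ifPn => //; rewrite -leNgt => B1.
case: ifPn => //; rewrite -leNgt => B2.
case: ifPn => //; rewrite -leNgt => B3 /=.
rewrite ltNge; apply/negP => B4.
move: B; rewrite ltNge => /negP; apply.
have s1 := @e_splitl a ((a + b) / 2) b c d h1 l1 l2 h3 h4 h5 h6.
have s2 := @e_splitr a ((a + b) / 2) c ((c + d) / 2) d h1 l1 (le_trans l2 h3) h4 l3 l4 h6.
have s3 := @e_splitr ((a + b) / 2) b c ((c + d) / 2) d (le_trans h1 l1) l2 h3 h4 l3 l4 h6.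
apply: (le_trans s1); apply: (le_trans (lerD s2 s3)).
apply: (le_trans (lerD (lerD B1 B2) (lerD B3 B4))).
rewrite le_eqVlt; apply/orP; left; apply/eqP; by field.
Qed.

(** Goursat's argument for a subadditive function [e] of rectangles.  If [e] were
    positive on the whole rectangle, then one of the four quarters would carry at
    least its share of [e], relative to the square of the half-perimeter, and so
    on; at the point common to the nested quarters this contradicts [e_loc]. *)
Lemma bisection_le0 : e a0 b0 c0 d0 <= 0.
Proof.
rewrite leNgt; apply/negP => e0.
pose L := (b0 - a0) + (d0 - c0).
have L0 : 0 <= L by rewrite /L; move: ab0 cd0; lra.
(* Small enough for the whole rectangle to be bad. *)
pose eta := e a0 b0 c0 d0 / (2 * (L ^+ 2 + 1)).
have eta0 : 0 < eta by rewrite divr_gt0// mulr_gt0// ltr_pwDr// sqr_ge0.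
have B0 : bad eta q0.
  rewrite /bad /= -/L /eta mulrAC ltr_pdivrMr ?mulr_gt0 ?ltr_pwDr ?sqr_ge0//.
  rewrite ltr_pM2l//; have := sqr_ge0 L; lra.
pose Q n := iter n (next eta) q0.
have sub0 n : sub (Q n) q0 /\ bad eta (Q n).
  elim: n => [|n [IH1 IH2]]; first by split=> //=; rewrite !lexx /=.
  have [+ _] := next_sub eta IH1; move=> p; split; last exact: next_bad.
  move: p;  rewrite /Q iterS -/(Q n); move: IH1.
  case: (next eta (Q n)) => [[[a' b'] c'] d']; case: (Q n) => [[[a b] c] d] /=.
  move=> [[r1 r2 r3] [r4 r5 r6]] [[p1 p2 p3] [p4 p5 p6]].
  split; split => //; [exact: le_trans p1|exact: (le_trans p3)|
    exact: le_trans p4|exact: (le_trans p6)].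
pose A n := (Q n).1.1.1; pose B n := (Q n).1.1.2.
pose C n := (Q n).1.2; pose D n := (Q n).2.
have mono n : [/\ A n <= A n.+1, B n.+1 <= B n, C n <= C n.+1 & D n.+1 <= D n] /\
   (B n.+1 - A n.+1 = (B n - A n) / 2 /\ D n.+1 - C n.+1 = (D n - C n) / 2).
  have := next_sub eta (sub0 n).1; rewrite /A /B /C /D /Q iterS -/(Q n).
  case: (next eta (Q n)) => [[[a' b'] c'] d']; case: (Q n) => [[[a b] c] d] /=.
  by move=> [[[? ? ?] [? ? ?]]].
have bnd n : [/\ a0 <= A n, A n <= B n & B n <= b0] /\
             [/\ c0 <= C n, C n <= D n & D n <= d0].
  have := (sub0 n).1; rewrite /A /B /C /D.
  by case: (Q n) => [[[a b] c] d] /= [[? ? ?] [? ? ?]].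
have Amono m n : (m <= n)%N -> [/\ A m <= A n, B n <= B m, C m <= C n & D n <= D m].
  move=> /subnK <-; elim: (n - m)%N => [|k [i1 i2 i3 i4]]; first by rewrite !lexx.
  have [[j1 j2 j3 j4] _] := mono (k + m)%N.
  by rewrite addSn; split; [exact: le_trans j1|exact: le_trans i2|
     exact: le_trans j3|exact: le_trans i4].
have AB m n : A m <= B n /\ C m <= D n.
  have [h1 _ h3 _] := Amono m (maxn m n) (leq_maxl _ _).
  have [_ k2 _ k4] := Amono n (maxn m n) (leq_maxr _ _).
  have [[_ u _] [_ v _]] := bnd (maxn m n).
  by split; [exact: le_trans (le_trans h1 u) k2|exact: le_trans (le_trans h3 v) k4].
have supP (F G : nat -> R) : (forall m n, F m <= G n) ->
    exists x, forall n, F n <= x <= G n.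
  move=> FG; exists (sup (range F)) => n.
  have ne : range F !=set0 by exists (F 0%N), 0%N.
  apply/andP; split.
    by apply: ub_le_sup; [exists (G 0%N) => _ [m _ <-]|exists n].
  by apply: ge_sup => // _ [m _ <-].
have [x xP] := supP A B (fun m n => (AB m n).1).
have [y yP] := supP C D (fun m n => (AB m n).2).
have xab : a0 <= x <= b0 by exact: (xP 0%N).
have ycd : c0 <= y <= d0 by exact: (yP 0%N).
have [del del0 delP] := e_loc xab ycd eta0.
have width n : B n - A n <= L / 2 ^+ n /\ D n - C n <= L / 2 ^+ n.
  elim: n => [|n [i1 i2]].
    by rewrite expr0 divr1 /A /B /C /D /= /L; split; lra.
  have [_ [-> ->]] := mono n.
  rewrite exprSr invfM mulrA; split; lra.
have [n nP] : exists n, L / 2 ^+ n < del.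
  pose n := Num.bound (L / del); exists n.
  rewrite ltr_pdivrMr ?exprn_gt0// mulrC -ltr_pdivrMr//.
  apply: lt_le_trans (archi_boundP _) _; first by rewrite divr_ge0// ltW.
  by rewrite -natrX ler_nat ltnW// ltn_expl.
have [[h1 h2 h3] [h4 h5 h6]] := bnd n.
have /andP[x1 x2] := xP n; have /andP[y1 y2] := yP n.
have [w1 w2] := width n.
have := delP _ _ _ _ h1 x1 x2 h3 h4 y1 y2 h6 (le_lt_trans w1 nP) (le_lt_trans w2 nP).
have := (sub0 n).2; rewrite /bad /A /B /C /D.
by case: (Q n) => [[[a b] c] d] /= /lt_geF ->.
Qed.

End Bisection.

(** * Continuity and derivatives of complex functions *)

Section Bridge.
Variable R : realType.
Local Notation C := (R[i])^o.
Local Notation Re := complex.Re.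
Local Notation Im := complex.Im.

Lemma gt0_complexE (e : R[i]) : 0 < e -> 0 < Re e /\ e = (Re e)%:C.
Proof. by case: e => a b; rewrite ltcE /= => /andP[/eqP-> ->]. Qed.

Lemma nbhsCP (z : C) (P : set C) :
  nbhs z P <-> exists2 d : R, 0 < d & forall w : C, normc (w - z) < d -> P w.
Proof.
split.
  move=> /nbhs_ballP[e /= /gt0_complexE[e0 eE] H].
  exists (Re e) => // w wz; apply: H; rewrite eE -ball_normE /= -opprB normrN.
  by rewrite normcE_norm ltcR.
move=> [d d0 H]; apply/nbhs_ballP; exists (d%:C) => /=; first by rewrite ltcR.
move=> w; rewrite -ball_normE /= -opprB normrN normcE_norm ltcR; exact: H.
Qed.

(** The cast gives the codomain its topology, which [R[i]] alone does not carry. *)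
Definition ccont (u : R -> R[i]) (t : R) := {for t, continuous (u : R -> C)}.

Lemma ccontP (u : R -> R[i]) t : ccont u t <->
  forall e, 0 < e -> \forall s \near t, normc (u s - u t) < e.
Proof.
split.
  move=> /cvgrPdist_lt H e e0.
  have := H e%:C; rewrite ltcR => /(_ e0); apply: filterS => s.
  by rewrite -opprB normrN normcE_norm ltcR.
move=> H; apply/cvgrPdist_lt => e /gt0_complexE[e0 ->].
by apply: filterS (H _ e0) => s; rewrite distrC normcE_norm ltcR.
Qed.

Lemma ccont_Re u t : ccont u t -> {for t, continuous (fun s => Re (u s))}.
Proof.
move=> /ccontP H; apply/cvgrPdist_lt => e e0.
apply: filterS (H _ e0) => s; apply: le_lt_trans.
by rewrite distrC -cReN -cReD normc_Re.
Qed.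

Lemma ccont_Im u t : ccont u t -> {for t, continuous (fun s => Im (u s))}.
Proof.
move=> /ccontP H; apply/cvgrPdist_lt => e e0.
apply: filterS (H _ e0) => s; apply: le_lt_trans.
by rewrite distrC -cImN -cImD normc_Im.
Qed.

Lemma ccont_ReIm (u v : R -> R) t : {for t, continuous u} ->
  {for t, continuous v} -> ccont (fun s => u s +i* v s) t.
Proof.
move=> /cvgrPdist_lt cu /cvgrPdist_lt cv; apply/ccontP => e e0.
have e2 : 0 < e / 2 by rewrite divr_gt0.
apply: filterS2 (cu _ e2) (cv _ e2) => s h1 h2.
apply: (le_lt_trans (normc_le_ReIm _)) => /=.
by rewrite (splitr e) ltrD// distrC.
Qed.

Lemma ccont_cst c t : ccont (fun=> c) t.
Proof. exact: cvg_cst. Qed.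

Lemma ccontD u v t : ccont u t -> ccont v t -> ccont (fun s => u s + v s) t.
Proof. exact: cvgD. Qed.

Lemma ccontB u v t : ccont u t -> ccont v t -> ccont (fun s => u s - v s) t.
Proof. exact: cvgB. Qed.

Lemma ccontM u v t : ccont u t -> ccont v t -> ccont (fun s => u s * v s) t.
Proof. exact: cvgM. Qed.

Lemma ccontV u t : u t != 0 -> ccont u t -> ccont (fun s => (u s)^-1) t.
Proof. exact: cvgV. Qed.

Lemma ccont_exp u n t : ccont u t -> ccont (fun s => u s ^+ n) t.
Proof.
move=> cu; elim: n => [|n IH]; first exact: ccont_cst.
by under eq_fun do rewrite exprS; exact: ccontM.
Qed.

Lemma ccont_real t : ccont (fun s => s%:C) t.
Proof. by apply: ccont_ReIm; [exact: cvg_id|exact: cvg_cst]. Qed.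

Lemma ccont_comp (h : C -> C) u t : {for u t, continuous h} -> ccont u t ->
  ccont (fun s => h (u s)) t.
Proof. by move=> ch cu; apply: (@continuous_comp _ _ _ (u : R -> C) h). Qed.

(** The first-order expansion with explicit radii, as Goursat's argument consumes it. *)
Lemma differentiable_expand (h : C -> C) z : differentiable h z ->
  exists d : R[i], forall e : R, 0 < e -> exists2 del, 0 < del &
  forall w, normc (w - z) < del -> normc (h w - h z - d * (w - z)) <= e * normc (w - z).
Proof.
move=> /derivable1_diffP /cvg_ex[/= d /cvgrPdist_le H]; exists d => e e0.
have := H e%:C; rewrite ltcR => /(_ e0) /nbhsCP[del del0 {}H].
exists del => // w wd.
have [->|wz] := eqVneq w z.
  by rewrite !subrr mulr0 subr0 ComplexField.Normc.normc0 mulr0.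
have wz0 : w - z != 0 by rewrite subr_eq0.
have := H (w - z); rewrite subr0 => /(_ wd wz0).
rewrite /GRing.scale /= mulr1 subrK normcE_norm lecR => K.
rewrite -ler_pdivrMr ?normc_gt0//.
rewrite -ComplexField.Normc.normcV -normc_mul.
rewrite (_ : _ * _ = - (d - (w - z)^-1 * (h w - h z))) ?normc_opp//.
by field.
Qed.

End Bridge.

(** * Integrals over a real interval *)

Section PathIntegral.
Variable R : realType.
Local Notation C := (R[i])^o.
Local Notation Re := complex.Re.
Local Notation Im := complex.Im.
Local Notation mu := (@lebesgue_measure R).

Definition pint (a b : R) (u : R -> R[i]) : R[i] := cint mu `[a, b]%classic u.

Definition ccont_on (a b : R) u := forall t, a <= t <= b -> @ccont R u t.

Lemma pint_integrable a b u : ccont_on a b u -> cintegrable mu `[a, b]%classic u.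
Proof.
move=> cu; split.
- apply: continuous_compact_integrable; first exact: segment_compact.
  apply: continuous_in_subspaceT => t; rewrite inE /= in_itv /= => tab.
  exact/ccont_Re/cu.
- apply: continuous_compact_integrable; first exact: segment_compact.
  apply: continuous_in_subspaceT => t; rewrite inE /= in_itv /= => tab.
  exact/ccont_Im/cu.
Qed.

Lemma pint_split a m b u : a <= m -> m <= b -> ccont_on a b u ->
  pint a b u = pint a m u + pint m b u.
Proof.
move=> am mb cu.
have key (f : R -> R) : mu.-integrable `[a, b]%classic (EFin \o f) ->
  \int[mu]_(t in `[a, b]) f t = \int[mu]_(t in `[a, m]) f t + \int[mu]_(t in `[m, b]) f t.
  move=> fi; apply/eqP; rewrite addrC -subr_eq; apply/eqP.
  rewrite Rintegral_itvB// Rintegral_itv_obnd_cbnd//.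
  apply: integrableS fi => // t /=; rewrite !in_itv /= => /andP[h1 ->].
  by rewrite (le_trans am (ltW h1)).
have [i1 i2] := pint_integrable cu.
by rewrite /pint /cint; apply: complexP; rewrite !cE /= key.
Qed.

Lemma lebesgue_itvcc (a b : R) : a <= b -> mu `[a, b]%classic = (b - a)%:E.
Proof.
move=> ab; rewrite lebesgue_measure_itv /= lte_fin.
by case: ltgtP ab => // -> _; rewrite subrr.
Qed.

Lemma pint_bound a b u M : a <= b -> ccont_on a b u ->
  (forall t, a <= t <= b -> normc (u t) <= M) -> normc (pint a b u) <= 2 * M * (b - a).
Proof.
move=> ab cu uM.
rewrite -[b - a]/(fine (b - a)%:E) -(lebesgue_itvcc ab).
apply: cint_bound => //.
- by rewrite [X in (X < _)%E](lebesgue_itvcc ab) ltry.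
- exact: pint_integrable.
Qed.

Lemma eq_pint a b u v : (forall t, a <= t <= b -> u t = v t) -> pint a b u = pint a b v.
Proof. by move=> uv; apply: eq_cint => t; rewrite inE /= in_itv; exact: uv. Qed.

Lemma pintD a b u v : ccont_on a b u -> ccont_on a b v ->
  pint a b (fun t => u t + v t) = pint a b u + pint a b v.
Proof. by move=> cu cv; rewrite /pint cintD//; exact: pint_integrable. Qed.

Lemma pintB a b u v : ccont_on a b u -> ccont_on a b v ->
  pint a b (fun t => u t - v t) = pint a b u - pint a b v.
Proof. by move=> cu cv; rewrite /pint cintB//; exact: pint_integrable. Qed.

Lemma pintZ a b c u : ccont_on a b u ->
  pint a b (fun t => c * u t) = c * pint a b u.
Proof. by move=> cu; rewrite /pint cintZ//; exact: pint_integrable. Qed.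

Lemma pint_cst a b c : a <= b -> pint a b (fun=> c) = c * (b - a)%:C.
Proof.
move=> ab; rewrite /pint /cint !Rintegral_cst//.
rewrite -[b - a]/(fine (b - a)%:E) -(lebesgue_itvcc ab).
by apply: complexP; rewrite !cE /= ?mulr0 ?subr0 ?add0r.
Qed.

Definition cis (t : R) : R[i] := cos t +i* sin t.

Lemma ccont_cis t : ccont cis t.
Proof. by apply: ccont_ReIm; [exact: continuous_cos|exact: continuous_sin]. Qed.

Lemma normc_cis t : normc (cis t) = 1.
Proof. by rewrite /= cos2Dsin2 sqrtr1. Qed.

Lemma Rintegral_derive (f F : R -> R) a b : a <= b -> continuous f ->
  (forall x : R, is_derive x 1 F (f x)) ->
  \int[mu]_(t in `[a, b]) f t = F b - F a.
Proof.
rewrite le_eqVlt => /predU1P[<- _ _|ab cf dF].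
  by rewrite set_itv1 Rintegral_set1 subrr.
have cF x : {for x, continuous F}.
  by apply: differentiable_continuous; apply/derivable1_diffP; case: (dF x).
rewrite /Rintegral (@continuous_FTC2 _ f F)//.
- exact: continuous_subspaceT.
- split.
  + by move=> x _; case: (dF x).
  + exact/cvg_at_right_filter/cF.
  + exact/cvg_at_left_filter/cF.
- by move=> x _; rewrite derive1E; case: (dF x).
Qed.

Lemma pint_cis a b : a <= b -> pint a b (fun t => 'i * cis t) = cis b - cis a.
Proof.
move=> ab; rewrite /pint /cint; apply: complexP; rewrite cE /=.
- rewrite -(@Rintegral_derive (fun t => - sin t) (@cos R)) //; last first.
    by move=> x; apply: (@continuousN R R^o); exact: continuous_sin.
  by apply: eq_Rintegral => t _ /=; rewrite mul0r mul1r sub0r.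
- rewrite -(@Rintegral_derive (@cos R) (@sin R)) //; last exact: continuous_cos.
  by apply: eq_Rintegral => t _ /=; rewrite mul0r mul1r add0r.
Qed.

Lemma cis_lipschitz s t : normc (cis s - cis t) <= 2 * `|s - t|.
Proof.
wlog ts : s t / t <= s.
  move=> W; case: (leP t s) => [|/ltW] H; first exact: W.
  by rewrite normc_distC distrC W.
rewrite -pint_cis// ger0_norm ?subr_ge0//.
rewrite -[X in X * _](mulr1 2); apply: pint_bound => // x _.
- by apply: ccontM; [exact: ccont_cst|exact: ccont_cis].
- by rewrite normc_mul normc_cis mulr1 /= expr0n expr1n add0r sqrtr1.
Qed.

Lemma cis_2pi : cis (2 * pi) = cis 0.
Proof. by rewrite /cis mulrC mulr_natr cos2pi sin2pi cos0 sin0. Qed.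

End PathIntegral.

(** * Cauchy's formula on a circle *)

Section CauchyFormula.
Variable R : realType.
Local Notation C := (R[i])^o.
Variables (rho r : R) (a : R[i]).
Hypothesis r0 : 0 < r.
Hypothesis rrho : r < rho.
Hypothesis ar : normc a < r.

Let bdry (t : R) : R[i] := r%:C * cis t.
(** The circle of radius [r], for [s = 1], shrinks to the point [a], for [s = 0]. *)
Definition contraction (s t : R) : R[i] := a + s%:C * (bdry t - a).
Definition cauchy_kernel (t : R) : R[i] := bdry t / (bdry t - a).
Local Notation Phi := contraction.
Local Notation k := cauchy_kernel.

Let normc_bdry t : normc (bdry t) = r.
Proof. by rewrite normc_mul normc_cis mulr1 normc_real gtr0_norm. Qed.

Let bdry_gap t : r - normc a <= normc (bdry t - a).
Proof.
rewrite lerBlDr -(normc_bdry t) -{1}(subrK a (bdry t)).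
exact: normcD.
Qed.

Let bdry_neq t : bdry t - a != 0.
Proof. by rewrite -normc_gt0 (lt_le_trans _ (bdry_gap t))// subr_gt0. Qed.

Lemma normc_cauchy_kernel t : normc (k t) <= r / (r - normc a).
Proof.
rewrite normc_mul ComplexField.Normc.normcV normc_bdry ler_pM2l//.
by rewrite lef_pV2 ?bdry_gap ?posrE ?subr_gt0// (lt_le_trans _ (bdry_gap t))// subr_gt0.
Qed.

Lemma ccont_cauchy_kernel t : ccont k t.
Proof.
apply: ccontM.
  by apply: ccontM; [exact: ccont_cst|exact: ccont_cis].
apply: ccontV; first exact: bdry_neq.
apply: ccontB; last exact: ccont_cst.
by apply: ccontM; [exact: ccont_cst|exact: ccont_cis].
Qed.

Let ccont_Phi1 t s : ccont (fun s => Phi s t) s.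
Proof.
apply: ccontD; first exact: ccont_cst.
by apply: ccontM; [exact: ccont_real|exact: ccont_cst].
Qed.

Let ccont_Phi2 s t : ccont (Phi s) t.
Proof.
apply: ccontD; first exact: ccont_cst.
apply: ccontM; first exact: ccont_cst.
apply: ccontB; last exact: ccont_cst.
by apply: ccontM; [exact: ccont_cst|exact: ccont_cis].
Qed.

Let Phi_disc s t : 0 <= s <= 1 -> normc (Phi s t) <= r.
Proof.
move=> /andP[s0 s1].
rewrite (_ : Phi s t = (1 - s)%:C * a + s%:C * bdry t); last first.
  by rewrite /Phi rmorphB rmorph1; ring.
apply: (le_trans (normcD _ _)).
rewrite (normc_mul _ a) (normc_mul _ (bdry t)) normc_bdry.
rewrite !normc_real !ger0_norm ?subr_ge0//.
rewrite -[leRHS](_ : (1 - s) * r + s * r = r); last by ring.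
by rewrite lerD2r ler_wpM2l ?subr_ge0// ltW.
Qed.

Let Phi_lip s t s' t' : 0 <= s <= 1 -> 0 <= s' <= 1 ->
  normc (Phi s t - Phi s' t') <= 2 * r * (`|s - s'| + `|t - t'|).
Proof.
move=> /andP[s0 s1] /andP[s'0 s'1].
rewrite (_ : _ - _ = (s - s')%:C * (bdry t - a) + s'%:C * (r%:C * (cis t - cis t'))); last first.
  by rewrite /Phi /bdry rmorphB; ring.
apply: (le_trans (normcD _ _)); rewrite [leRHS]mulrDr; apply: lerD.
  rewrite normc_mul normc_real mulrC ler_wpM2r//.
  by apply: (le_trans (normcB _ _)); rewrite normc_bdry; move: ar; lra.
rewrite !normc_mul !normc_real (ger0_norm s'0) (gtr0_norm r0).
apply: (@le_trans _ _ (1 * (r * (2 * `|t - t'|)))).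
  apply: ler_pM => //; first by rewrite mulr_ge0 ?normc_ge0 ?ltW.
  by rewrite ler_pM2l//; exact: cis_lipschitz.
by rewrite mul1r mulrA (mulrC r).
Qed.

(** With [w = contraction s t] one has [dw / (w - a) = ds / s + 'i * k t * dt]: this is,
    up to sign, the integral of [h w / (w - a)] along the image of the boundary of the
    rectangle [s1, s2] x [t1, t2]. *)
Let circ (h : C -> C) (s1 s2 t1 t2 : R) : R[i] :=
  pint s1 s2 (fun s => (h (Phi s t2) - h (Phi s t1)) * (s^-1)%:C) -
  pint t1 t2 (fun t => (h (Phi s2 t) - h (Phi s1 t)) * ('i * k t)).

Let cont_disc (h : C -> C) := forall z : C, normc z <= r -> {for z, continuous h}.

Let ccont_inv s : 0 < s -> @ccont R (fun s => (s^-1)%:C) s.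
Proof.
move=> s0; apply: ccont_ReIm; last exact: cvg_cst.
by apply: (@cvgV R R); [exact: lt0r_neq0|exact: cvg_id].
Qed.

Let ccont_s h s1 s2 t1 t2 : cont_disc h -> 0 < s1 -> s2 <= 1 ->
  ccont_on s1 s2 (fun s => (h (Phi s t2) - h (Phi s t1)) * (s^-1)%:C).
Proof.
move=> ch s10 s21 s /andP[h1 h2].
have s0 : 0 < s by exact: lt_le_trans h1.
have s01 : 0 <= s <= 1 by rewrite ltW//= (le_trans h2).
apply: ccontM; last exact: ccont_inv.
by apply: ccontB; apply: ccont_comp => //; exact/ch/Phi_disc.
Qed.

Let ccont_t1 h s : cont_disc h -> 0 <= s <= 1 ->
  forall t, ccont (fun t => h (Phi s t)) t.
Proof. by move=> ch s01 t; apply: ccont_comp => //; exact/ch/Phi_disc. Qed.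

Let ccont_ik t : ccont (fun t => 'i * k t) t.
Proof. by apply: ccontM; [exact: ccont_cst|exact: ccont_cauchy_kernel]. Qed.

Let ccont_t h s1 s2 t1 t2 : cont_disc h -> 0 <= s1 <= 1 -> 0 <= s2 <= 1 ->
  ccont_on t1 t2 (fun t => (h (Phi s2 t) - h (Phi s1 t)) * ('i * k t)).
Proof.
move=> ch s1P s2P t _; apply: ccontM; last exact: ccont_ik.
by apply: ccontB; exact: ccont_t1.
Qed.

Let circ_splitl h s1 m s2 t1 t2 : cont_disc h -> 0 < s1 -> s1 <= m -> m <= s2 ->
  s2 <= 1 -> circ h s1 s2 t1 t2 = circ h s1 m t1 t2 + circ h m s2 t1 t2.
Proof.
move=> ch s10 s1m ms2 s21; rewrite /circ (@pint_split _ s1 m s2)//; last exact: ccont_s.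
have m0 : 0 < m by exact: lt_le_trans s1m.
rewrite (_ : pint t1 t2 _ = pint t1 t2 (fun t => (h (Phi m t) - h (Phi s1 t)) * ('i * k t)) +
   pint t1 t2 (fun t => (h (Phi s2 t) - h (Phi m t)) * ('i * k t))); first by ring.
rewrite -pintD.
- by apply: eq_pint => t _; ring.
- by apply: ccont_t => //; apply/andP; split; lra.
- by apply: ccont_t => //; apply/andP; split; lra.
Qed.

Let circ_splitr h s1 s2 t1 m t2 : cont_disc h -> 0 < s1 -> s1 <= s2 -> s2 <= 1 ->
  t1 <= m -> m <= t2 -> circ h s1 s2 t1 t2 = circ h s1 s2 t1 m + circ h s1 s2 m t2.
Proof.
move=> ch s10 s12 s21 t1m mt2; rewrite /circ (@pint_split _ t1 m t2)//; last first.
  by apply: ccont_t => //; apply/andP; split; lra.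
rewrite (_ : pint s1 s2 _ = pint s1 s2 (fun s => (h (Phi s m) - h (Phi s t1)) * (s^-1)%:C) +
   pint s1 s2 (fun s => (h (Phi s t2) - h (Phi s m)) * (s^-1)%:C)); first by ring.
rewrite -pintD; try exact: ccont_s.
by apply: eq_pint => t _; ring.
Qed.

Let circD h1 h2 s1 s2 t1 t2 : cont_disc h1 -> cont_disc h2 -> 0 < s1 -> s1 <= s2 ->
  s2 <= 1 -> circ (fun z => h1 z + h2 z) s1 s2 t1 t2 =
  circ h1 s1 s2 t1 t2 + circ h2 s1 s2 t1 t2.
Proof.
move=> ch1 ch2 s10 s12 s21.
have [p1 p2] : 0 <= s1 <= 1 /\ 0 <= s2 <= 1 by split; apply/andP; split; lra.
rewrite /circ.
rewrite (_ : pint s1 s2 _ = pint s1 s2 (fun s => (h1 (Phi s t2) - h1 (Phi s t1)) * (s^-1)%:C) +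
  pint s1 s2 (fun s => (h2 (Phi s t2) - h2 (Phi s t1)) * (s^-1)%:C)); last first.
  rewrite -pintD; try exact: ccont_s.
  by apply: eq_pint => t _; ring.
rewrite (_ : pint t1 t2 _ = pint t1 t2 (fun t => (h1 (Phi s2 t) - h1 (Phi s1 t)) * ('i * k t)) +
  pint t1 t2 (fun t => (h2 (Phi s2 t) - h2 (Phi s1 t)) * ('i * k t))); last first.
  rewrite -pintD; try exact: ccont_t.
  by apply: eq_pint => t _; ring.
by ring.
Qed.

(** Both integrands are explicit: the powers of [s] cancel, and [cis] has derivative ['i
    * cis]. *)
Let circ_affine (A d : R[i]) s1 s2 t1 t2 : 0 < s1 -> s1 <= s2 -> s2 <= 1 -> t1 <= t2 ->
  circ (fun z => A + d * z) s1 s2 t1 t2 = 0.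
Proof.
move=> s10 s12 s21 t12; rewrite /circ.
rewrite (@eq_pint _ s1 s2 _ (fun=> d * (bdry t2 - bdry t1))); last first.
  move=> s /andP[h1 _]; have s0 : s%:C != 0.
    by rewrite -normc_gt0 normc_real gtr0_norm; exact: lt_le_trans h1.
  by rewrite /Phi rmorphV ?unitfE ?gt_eqF ?(lt_le_trans s10)//=; field.
rewrite pint_cst//.
rewrite (@eq_pint _ t1 t2 _ (fun t => (d * (s2 - s1)%:C * r%:C) * ('i * cis t))); last first.
  by move=> t _; rewrite /Phi /k /bdry rmorphB /=; field; exact: bdry_neq.
rewrite pintZ; last first.
  by move=> t _; apply: ccontM; [exact: ccont_cst|exact: ccont_cis].
by rewrite pint_cis// /bdry; ring.
Qed.

Let circ_bound h eta s0 s1 s2 t1 t2 : cont_disc h -> 0 < s0 -> s0 <= s1 -> s1 <= s2 ->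
  s2 <= 1 -> t1 <= t2 -> 0 <= eta ->
  (forall s t, s1 <= s <= s2 -> t1 <= t <= t2 -> normc (h (Phi s t)) <= eta) ->
  normc (circ h s1 s2 t1 t2) <=
    eta * (4 * (s0^-1 + r / (r - normc a))) * ((s2 - s1) + (t2 - t1)).
Proof.
move=> ch s00 s01 s12 s21 t12 eta0 H.
have s10 : 0 < s1 by exact: lt_le_trans s01.
have [p1 p2] : 0 <= s1 <= 1 /\ 0 <= s2 <= 1 by split; apply/andP; split; lra.
have K0 : 0 <= r / (r - normc a) by rewrite divr_ge0 ?subr_ge0 // ltW.
have S0 : 0 <= s0^-1 by rewrite invr_ge0 ltW.
apply: (le_trans (normcB _ _)).
have B1 : normc (pint s1 s2 (fun s => (h (Phi s t2) - h (Phi s t1)) * (s^-1)%:C)) <=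
    2 * (2 * eta * s0^-1) * (s2 - s1).
  apply: pint_bound => //; first exact: ccont_s.
  move=> s sP; rewrite normc_mul normc_real ler_pM ?normc_ge0//.
    apply: (le_trans (normcB _ _)).
    have := H s t2 sP; have := H s t1 sP; rewrite !lexx t12 => /(_ isT) ? /(_ isT) ?.
    by lra.
  have /andP[h1 _] := sP; have s0' : 0 < s by exact: lt_le_trans h1.
  rewrite gtr0_norm ?invr_gt0// lef_pV2 ?posrE//; exact: le_trans h1.
have B2 : normc (pint t1 t2 (fun t => (h (Phi s2 t) - h (Phi s1 t)) * ('i * k t))) <=
    2 * (2 * eta * (r / (r - normc a))) * (t2 - t1).
  apply: pint_bound => //; first exact: ccont_t.
  move=> t tP; rewrite normc_mul ler_pM ?normc_ge0//.
    apply: (le_trans (normcB _ _)).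
    have := H s2 t; have := H s1 t; rewrite !lexx s12 => /(_ isT tP) ? /(_ isT tP) ?.
    by lra.
  rewrite normc_mul (_ : normc 'i = 1) ?mul1r ?normc_cauchy_kernel//.
  by rewrite /= expr0n expr1n add0r sqrtr1.
apply: (le_trans (lerD B1 B2)).
set K := r / _ in K0 *; set S := s0^-1 in S0 *.
have e1 : 0 <= eta * S * (t2 - t1) by apply: mulr_ge0; [exact: mulr_ge0|rewrite subr_ge0].
have e2 : 0 <= eta * K * (s2 - s1) by apply: mulr_ge0; [exact: mulr_ge0|rewrite subr_ge0].
by lra.
Qed.

Variable h : C -> C.
Hypothesis dh : forall z : C, normc z < rho -> differentiable h z.

Let ch : cont_disc h.
Proof. by move=> z zr; apply/differentiable_continuous/dh/(le_lt_trans zr). Qed.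

(** [bisection_le0] applies: near a point, [h] differs from its affine expansion by
    little compared to the size of the rectangle, and affine functions contribute
    nothing. *)
Let goursat s0 : 0 < s0 -> s0 <= 1 -> circ h s0 1 0 (2 * pi) = 0.
Proof.
move=> s00 s01; apply/eqP; rewrite -normc_eq0 eq_le normc_ge0 andbT.
have pi0 : 0 <= 2 * pi :> R by rewrite mulr_ge0// pi_ge0.
apply: (@bisection_le0 _ (fun s1 s2 t1 t2 => normc (circ h s1 s2 t1 t2))) => //.
- move=> s1 m s2 t1 t2 h1 h2 h3 h4 _ _ _.
  rewrite (@circ_splitl _ s1 m s2)// ?normcD//; exact: lt_le_trans h1.
- move=> s1 s2 t1 m t2 h1 h2 h3 h4 h5 h6 h7.
  rewrite (@circ_splitr _ _ _ t1 m t2)// ?normcD//; exact: lt_le_trans h1.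
move=> x y /andP[x1 x2] yP eps eps0.
have x01 : 0 <= x <= 1 by rewrite (le_trans (ltW s00)).
have zr : normc (Phi x y) < rho by exact: le_lt_trans (Phi_disc _ x01) rrho.
have [d dP] := differentiable_expand (dh zr).
pose K := 4 * (s0^-1 + r / (r - normc a)).
have K0 : 0 < K.
  by rewrite mulr_gt0// addr_gt0 ?invr_gt0// divr_gt0// subr_gt0.
(* By [Phi_lip] the rectangle has an image of size [2 * r] times its half-perimeter, and
   [circ_bound] multiplies the error by [K]. *)
pose e' := eps / (K * (2 * r)).
have e'0 : 0 < e' by apply: divr_gt0 => //; apply: mulr_gt0 => //; apply: mulr_gt0.
have [del del0 delP] := dP _ e'0.
exists (del / (4 * r)); first by rewrite divr_gt0// mulr_gt0.
move=> s1 s2 t1 t2 h1 h2 h3 h4 h5 h6 h7 h8 ws wt.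
pose A := h (Phi x y) - d * Phi x y.
pose g (z : C) : C := h z - (A + d * z).
have s12 : s1 <= s2 by exact: le_trans h3.
have t12 : t1 <= t2 by exact: le_trans h7.
have s10 : 0 < s1 by exact: lt_le_trans h1.
have caff : cont_disc (fun z => A + d * z).
  move=> z _; apply: (@differentiable_continuous _ C C).
  by apply: differentiableD => //; apply: differentiableM.
have cg : cont_disc g.
  move=> z zr'; apply: (@continuousB R[i] C C h (fun z => A + d * z) z).
    exact: ch.
  exact: caff.
have hE : h = (fun z => (A + d * z) + g z).
  by apply/funext => z; rewrite /g; ring.
rewrite hE circD// circ_affine// add0r.
pose w := (s2 - s1) + (t2 - t1).
have w0 : 0 <= w by rewrite /w; lra.
have := @circ_bound g (e' * (2 * r * w)) s0 s1 s2 t1 t2 cg s00 h1 s12 h4 t12.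
rewrite -/K -/w => B.
have -> : eps * w ^+ 2 = e' * (2 * r * w) * K * w.
  by rewrite /e'; field; rewrite !gt_eqF.
apply: B.
  by apply: mulr_ge0; [exact: ltW|apply: mulr_ge0 => //; apply: mulr_ge0 => //; exact: ltW].
move=> s t /andP[sa sb] /andP[ta tb].
have sP : 0 <= s <= 1 by rewrite (le_trans (ltW s10) sa) (le_trans sb h4).
have dist : normc (Phi s t - Phi x y) <= 2 * r * w.
  apply: (le_trans (Phi_lip _ _ sP x01)); rewrite ler_pM2l ?mulr_gt0//.
  by rewrite /w lerD// ler_norml; apply/andP; split; lra.
have distd : normc (Phi s t - Phi x y) < del.
  apply: (le_lt_trans dist).
  have : w < del / (4 * r) + del / (4 * r) by rewrite /w ltrD.
  rewrite -(ltr_pM2l (x := 2 * r)) ?mulr_gt0// => /lt_le_trans; apply.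
  by rewrite le_eqVlt; apply/orP; left; apply/eqP; field; rewrite gt_eqF.
rewrite /g (_ : _ - _ = h (Phi s t) - h (Phi x y) - d * (Phi s t - Phi x y)); last first.
  by rewrite /A; ring.
by apply: (le_trans (delP _ distd)); rewrite ler_pM2l.
Qed.

Let ccont_hk s : 0 <= s <= 1 -> ccont_on 0 (2 * pi) (fun t => h (Phi s t) * k t).
Proof.
move=> sP t _; apply: ccontM; last exact: ccont_cauchy_kernel.
exact: ccont_t1.
Qed.

(** On the rectangle [s, 1] x [0, 2 pi] the two sides [t = 0] and [t = 2 pi] cancel, so
    that the two remaining ones agree. *)
Let mean_const s : 0 < s <= 1 ->
  pint 0 (2 * pi) (fun t => h (Phi 1 t) * k t) =
  pint 0 (2 * pi) (fun t => h (Phi s t) * k t).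
Proof.
move=> /andP[s0 s1]; have := goursat s0 s1; rewrite /circ.
rewrite (@eq_pint _ s 1 _ (fun=> 0)); last first.
  by move=> t _; rewrite /Phi /bdry cis_2pi subrr mul0r.
rewrite pint_cst// mul0r sub0r => /eqP; rewrite oppr_eq0.
rewrite (@eq_pint _ _ _ _ (fun t => 'i * (h (Phi 1 t) * k t - h (Phi s t) * k t))); last first.
  by move=> t _; ring.
have [p1 p2] : 0 <= (1 : R) <= 1 /\ 0 <= s <= 1 by rewrite lexx ler01 (ltW s0) s1.
rewrite pintZ; last first.
  by move=> t tP; apply: ccontB; exact: ccont_hk.
rewrite mulf_eq0 => /orP[/eqP/(congr1 (@complex.Im R)) /=/eqP|].
  by rewrite oner_eq0.
rewrite pintB; try exact: ccont_hk.
by rewrite subr_eq0 => /eqP.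
Qed.

(** By [mean_const] the left side may be computed on the circle contracted by any
    [s > 0]; as [s] tends to 0, [h] tends to [h a] uniformly on it. *)
Lemma cauchy_formula :
  pint 0 (2 * pi) (fun t => h (r%:C * cis t) * k t) = h a * pint 0 (2 * pi) k.
Proof.
have -> : (fun t => h (r%:C * cis t) * k t) = (fun t => h (Phi 1 t) * k t).
  by apply/funext => t; rewrite /Phi mul1r addrC subrK.
have pi0 : 0 <= 2 * pi :> R by rewrite mulr_ge0// pi_ge0.
have ck : ccont_on 0 (2 * pi) k by move=> t _; exact: ccont_cauchy_kernel.
apply/eqP; rewrite -subr_eq0 -normc_eq0 eq_le normc_ge0 andbT.
apply/ler_addgt0Pr => e e0; rewrite add0r.
pose K := 2 * (r / (r - normc a)) * (2 * pi - 0).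
have K0 : 0 <= K.
  rewrite /K subr0; apply: mulr_ge0 => //; apply: mulr_ge0 => //.
  by rewrite divr_ge0 ?subr_ge0// ltW.
pose e' := e / (K + 1).
have K1 : 0 < K + 1 by rewrite ltr_pwDr.
have e'0 : 0 < e' by rewrite divr_gt0.
have /cvgrPdist_lt/(_ e'%:C) := @ch a (ltW ar).
rewrite ltcR => /(_ e'0) /nbhsCP[del del0 delP].
pose s := Num.min 1 (del / (4 * r)).
have s0 : 0 < s by rewrite lt_min ltr01 divr_gt0// mulr_gt0.
have s1 : s <= 1 by rewrite ge_min lexx.
have sd : s <= del / (4 * r) by rewrite ge_min lexx orbT.
have sP : 0 <= s <= 1 by rewrite ltW.
rewrite (@mean_const s) ?s0// -pintZ// -pintB; first last.
- by move=> t tP; apply: ccontM; [exact: ccont_cst|exact: ck].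
- exact: ccont_hk.
have -> : e = 2 * (e' * (r / (r - normc a))) * (2 * pi - 0) + e'.
  rewrite (_ : _ + _ = e' * (K + 1)); last by rewrite /K; ring.
  by rewrite /e' divfK// gt_eqF.
rewrite -[X in X <= _]addr0; apply: lerD; last exact: ltW.
apply: (@pint_bound R 0 (2 * pi) _ (e' * (r / (r - normc a))) pi0).
  move=> t tP; apply: ccontB; first exact: ccont_hk.
  by apply: ccontM; [exact: ccont_cst|exact: ck].
move=> t _; rewrite -mulrBl normc_mul ler_pM ?normc_ge0 ?normc_cauchy_kernel//.
have := delP (Phi s t).
rewrite /Phi addrAC subrr add0r normc_mul normc_real (gtr0_norm s0).
rewrite normcE_norm ltcR [normc (h a - _)]normc_distC => H; apply/ltW/H.
apply: (@le_lt_trans _ _ (del / (4 * r) * (2 * r))).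
  apply: ler_pM => //; [exact: ltW|exact: normc_ge0|].
  by apply: (le_trans (normcB _ _)); rewrite normc_bdry; move: ar; lra.
rewrite (_ : _ * _ = del / 2); last by field; rewrite gt_eqF.
by lra.
Qed.

End CauchyFormula.

(** * Means over a circle *)

Section CircleMeans.
Variable R : realType.
Local Notation C := (R[i])^o.

Lemma geometric_small (q K e : R) : 0 <= q -> q < 1 -> 0 < e ->
  exists N, forall n, (N <= n)%N -> K * q ^+ n < e.
Proof.
move=> q0 q1 e0.
have /cvgrPdist_lt/(_ e e0)[N _ H] : K * q ^+ n @[n --> \oo] --> (0 : R).
  rewrite -(mulr0 K); apply: cvgMr; apply: cvg_expr.
  by rewrite ger0_norm.
exists N => n Nn; have := H n Nn; rewrite /= sub0r normrN.
exact/le_lt_trans/ler_norm.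
Qed.

Lemma geom_sum_bound (q : R) N M : 0 <= q -> q < 1 ->
  \sum_(N <= j < M) q ^+ j <= q ^+ N / (1 - q).
Proof.
move=> q0 q1; have q10 : 0 < 1 - q by rewrite subr_gt0.
have [MN|NM] := leqP M N.
  by rewrite big_geq//; apply: divr_ge0; [exact: exprn_ge0|exact: ltW].
have -> : \sum_(N <= j < M) q ^+ j = q ^+ N * \sum_(j < M - N) q ^+ j.
  rewrite -{1}[N]add0n big_addn big_mkord mulr_sumr.
  by apply: eq_bigr => i _; rewrite exprD mulrC.
apply: ler_wpM2l; first by rewrite exprn_ge0.
rewrite -[leRHS]mul1r ler_pdivlMr//.
have -> : (\sum_(j < M - N) q ^+ j) * (1 - q) = 1 - q ^+ (M - N).
  by rewrite mulrC -[LHS]opprK -mulNr opprB -subrX1 opprB.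
by rewrite gerBl exprn_ge0.
Qed.

Lemma pi2_gt0 : 0 < 2 * pi :> R.
Proof. by rewrite mulr_gt0// pi_gt0. Qed.

Definition mean (u : R -> R[i]) : R[i] := ((2 * pi)^-1)%:C * pint 0 (2 * pi) u.
Definition ccircle (u : R -> R[i]) := ccont_on 0 (2 * pi) u.

Lemma ccircle_cst c : ccircle (fun=> c).
Proof. by move=> t _; exact: ccont_cst. Qed.
Lemma ccircleD u v : ccircle u -> ccircle v -> ccircle (fun t => u t + v t).
Proof. by move=> cu cv t tP; apply: ccontD; [exact: cu|exact: cv]. Qed.
Lemma ccircleB u v : ccircle u -> ccircle v -> ccircle (fun t => u t - v t).
Proof. by move=> cu cv t tP; apply: ccontB; [exact: cu|exact: cv]. Qed.
Lemma ccircleM u v : ccircle u -> ccircle v -> ccircle (fun t => u t * v t).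
Proof. by move=> cu cv t tP; apply: ccontM; [exact: cu|exact: cv]. Qed.
Lemma ccircle_sum N (F : nat -> R -> R[i]) : (forall n, ccircle (F n)) ->
  ccircle (fun t => \sum_(n < N) F n t).
Proof.
move=> cF; elim: N => [|N IH].
  by under eq_fun do rewrite big_ord0; exact: ccircle_cst.
under eq_fun do rewrite big_ord_recr; apply: ccircleD; [exact: IH|exact: cF].
Qed.

Lemma meanD u v : ccircle u -> ccircle v ->
  mean (fun t => u t + v t) = mean u + mean v.
Proof. by move=> cu cv; rewrite /mean (pintD cu cv) mulrDr. Qed.

Lemma meanB u v : ccircle u -> ccircle v ->
  mean (fun t => u t - v t) = mean u - mean v.
Proof. by move=> cu cv; rewrite /mean (pintB cu cv) mulrBr. Qed.

Lemma meanZ c u : ccircle u -> mean (fun t => c * u t) = c * mean u.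
Proof. by move=> cu; rewrite /mean (pintZ _ cu) mulrCA. Qed.

Lemma mean_cst c : mean (fun=> c) = c.
Proof.
rewrite /mean pint_cst ?ltW ?pi2_gt0// subr0 mulrCA -rmorphM mulVf ?mulr1//.
by rewrite gt_eqF// pi2_gt0.
Qed.

Lemma mean_sum N (F : nat -> R -> R[i]) : (forall n, ccircle (F n)) ->
  mean (fun t => \sum_(n < N) F n t) = \sum_(n < N) mean (F n).
Proof.
move=> cF; elim: N => [|N IH].
  by under eq_fun do rewrite big_ord0; rewrite big_ord0 mean_cst.
under eq_fun do rewrite big_ord_recr.
rewrite big_ord_recr /= -IH meanD; [by []|exact: ccircle_sum|exact: cF].
Qed.

Lemma eq_mean u v : u =1 v -> mean u = mean v.
Proof. by move=> uv; rewrite /mean; congr (_ * _); apply: eq_pint. Qed.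

Lemma mean_bound u M : ccircle u -> (forall t, 0 <= t <= 2 * pi -> normc (u t) <= M) ->
  normc (mean u) <= 2 * M.
Proof.
move=> cu uM; rewrite /mean normc_mul normc_real gtr0_norm ?invr_gt0 ?pi2_gt0//.
rewrite mulrC ler_pdivrMr ?pi2_gt0//.
by have := pint_bound (ltW pi2_gt0) cu uM; rewrite subr0.
Qed.

Lemma mean_conj u : ccircle u -> mean (fun t => conjc (u t)) = conjc (mean u).
Proof.
move=> cu; rewrite /mean rmorphM /= oppr0; congr (_ * _).
have [_ i2] := pint_integrable cu.
rewrite /pint /cint /=; apply: complexP => /=.
  by apply: eq_Rintegral => t _; rewrite cRe_conj.
rewrite -[RHS]mulN1r -RintegralZl//.
by apply: eq_Rintegral => t _; rewrite cIm_conj mulN1r.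
Qed.

Lemma ccont_conj u (t : R) : ccont u t -> ccont (fun s => conjc (u s)) t.
Proof.
move=> /ccontP H; apply/ccontP => e e0; apply: filterS (H _ e0) => s.
by rewrite -rmorphB normc_conj.
Qed.

Lemma ccircle_cisJ n : ccircle (fun t => conjc (cis t) ^+ n).
Proof. by move=> t _; apply/ccont_exp/ccont_conj/ccont_cis. Qed.

Lemma normc_cisJ (t : R) n : normc (conjc (cis t) ^+ n) = 1.
Proof. by rewrite normc_exp normc_conj normc_cis expr1n. Qed.

Lemma cisVJ (t : R) : (cis t)^-1 = conjc (cis t).
Proof.
have c0 : cis t != 0 by rewrite -normc_gt0 normc_cis.
apply: (mulfI c0); rewrite divff// mul_conjc normc_cis expr1n; by [].
Qed.

End CircleMeans.

Lemma differentiable_expC (R : realType) (V : normedModType R[i]) (f : V -> R[i]^o)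
  n z : differentiable f z -> differentiable (fun w => f w ^+ n : R[i]^o) z.
Proof.
move=> df; elim: n => [|n IH].
  by under eq_fun do rewrite expr0; exact: differentiable_cst.
by under eq_fun do rewrite exprS; apply: differentiableM.
Qed.

(** * Power series in one variable *)

Section PowerSeries1.
Variable R : realType.
Local Notation C := (R[i])^o.
Variables (rho r : R).
Hypothesis r0 : 0 < r.
Hypothesis rrho : r < rho.
Implicit Types (h : C -> C) (a : R[i]).

(** Cauchy's formula for the Taylor coefficient of order [n] at 0. *)
Definition ccoef (r : R) (h : C -> C) n : R[i] :=
  (r ^- n)%:C * mean (fun t => h (r%:C * cis t) * conjc (cis t) ^+ n).

Lemma cauchy_mean h a : normc a < r ->
  (forall z : C, normc z < rho -> differentiable h z) ->
  mean (fun t => h (r%:C * cis t) * cauchy_kernel r a t) = h a * mean (cauchy_kernel r a).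
Proof. by move=> ar dh; rewrite /mean (cauchy_formula r0 rrho ar dh) mulrCA. Qed.

Lemma ccircle_kernel a : normc a < r -> ccircle (cauchy_kernel r a).
Proof. by move=> ar t _; exact: ccont_cauchy_kernel. Qed.

(** [cauchy_mean] at 0 for the function [z ^+ n]. *)
Lemma mean_cis n : mean (fun t : R => cis t ^+ n) = (n == 0%N)%:R.
Proof.
case: n => [|n]; first by rewrite -[RHS](mean_cst 1); apply: eq_mean => t; rewrite expr0.
have n0 : normc (0 : R[i]) < r by rewrite ComplexField.Normc.normc0.
have := @cauchy_mean (fun z => z ^+ n.+1) 0 n0.
rewrite expr0n mul0r (@eq_mean _ _ (fun t => (r ^+ n.+1)%:C * cis t ^+ n.+1)); last first.
  move=> t; rewrite /cauchy_kernel subr0 divff ?mulr1 ?exprMn ?rmorphXn//.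
  by rewrite -normc_gt0 normc_mul normc_cis mulr1 normc_real gtr0_norm.
rewrite meanZ; last by move=> t _; apply/ccont_exp/ccont_cis.
move=> H; have /eqP : (r ^+ n.+1)%:C * mean (fun t => cis t ^+ n.+1) = 0.
  by apply: H => z _; apply: differentiable_expC.
rewrite mulf_eq0 => /orP[|/eqP//].
by rewrite -normc_eq0 normc_real normr_eq0 expf_eq0 (gt_eqF r0) andbF.
Qed.

(** The finite geometric series of ratio [a / w], with [w] on the circle. *)
Lemma kernel_expand a t N : normc a < r ->
  cauchy_kernel r a t = \sum_(n < N) (r ^- n)%:C * a ^+ n * conjc (cis t) ^+ n +
    ((r ^- N)%:C * a ^+ N * conjc (cis t) ^+ N) * cauchy_kernel r a t.
Proof.
move=> ar; rewrite /cauchy_kernel; set w := r%:C * cis t.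
have wN : normc w = r by rewrite normc_mul normc_cis mulr1 normc_real gtr0_norm.
have w0 : w != 0 by rewrite -normc_gt0 wN.
have wa : w - a != 0.
  by rewrite subr_eq0; apply: contraTneq ar => <-; rewrite wN ltxx.
pose q := a / w.
have E n : (r ^- n)%:C * a ^+ n * conjc (cis t) ^+ n = q ^+ n.
  rewrite /q /w -cisVJ exprMn -exprVn invfM rmorphXn rmorphV; last by rewrite unitfE gt_eqF.
  by rewrite !exprMn; ring.
rewrite E (eq_bigr (fun i : 'I_N => q ^+ i)); last by move=> n _; exact: E.
have kE : w / (w - a) = 1 + q * (w / (w - a)).
  by rewrite /q; field; rewrite w0 wa.
move: (w / (w - a)) kE => K kE.
elim: N {E} => [|N IH]; first by rewrite big_ord0 add0r expr0 mul1r.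
by rewrite big_ord_recr /= -addrA {1}IH {1}kE exprSr; ring.
Qed.

(** Integrates [kernel_expand] against an arbitrary continuous function [u] on the
    circle; the remainder is explicit, hence uniform in whatever [u] depends on. *)
Lemma mean_kernel_expand u M s a N : ccircle u -> 0 <= M ->
  (forall t, 0 <= t <= 2 * pi -> normc (u t) <= M) -> s < r -> normc a <= s ->
  normc (mean (fun t => u t * cauchy_kernel r a t) -
    \sum_(n < N) (r ^- n)%:C * mean (fun t => u t * conjc (cis t) ^+ n) * a ^+ n)
   <= 2 * M * (r / (r - s)) * (s / r) ^+ N.
Proof.
move=> cu M0 uM sr as_.
have ar : normc a < r by exact: le_lt_trans sr.
have cuJ n : ccircle (fun t => u t * conjc (cis t) ^+ n).
  by apply: ccircleM; [exact: cu|exact: ccircle_cisJ].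
have cF n : ccircle (fun t => (r ^- n)%:C * a ^+ n * (u t * conjc (cis t) ^+ n)).
  by apply: ccircleM; [exact: ccircle_cst|exact: cuJ].
rewrite (_ : \sum_(n < N) _ =
   mean (fun t => \sum_(n < N) ((r ^- n)%:C * a ^+ n * (u t * conjc (cis t) ^+ n)))); last first.
  rewrite (@mean_sum _ N (fun n t => (r ^- n)%:C * a ^+ n * (u t * conjc (cis t) ^+ n)) cF).
  apply: eq_bigr => n _; rewrite meanZ; [ring|exact: cuJ].
rewrite -meanB; first last.
- exact: (@ccircle_sum _ N (fun n t => (r ^- n)%:C * a ^+ n * (u t * conjc (cis t) ^+ n))).
- by apply: ccircleM; [exact: cu|exact: ccircle_kernel].
have s0 : 0 <= s by exact: le_trans (normc_ge0 a) as_.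
rewrite -!(mulrA 2); apply: mean_bound.
  apply: ccircleB; first by apply: ccircleM; [exact: cu|exact: ccircle_kernel].
  exact: (@ccircle_sum _ N (fun n t => (r ^- n)%:C * a ^+ n * (u t * conjc (cis t) ^+ n))).
move=> t tP.
rewrite (_ : _ - _ = u t * (((r ^- N)%:C * a ^+ N * conjc (cis t) ^+ N) * cauchy_kernel r a t)); last first.
  rewrite {1}(kernel_expand t N ar) mulrDr mulr_sumr addrAC.
  rewrite (_ : \sum_(i < N) u t * _ = \sum_(n < N) (r ^- n)%:C * a ^+ n * (u t * conjc (cis t) ^+ n)) ?subrr ?add0r//.
  by apply: eq_bigr => n _; ring.
rewrite normc_mul -[leRHS]mulrA; apply: ler_pM; [exact: normc_ge0|exact: normc_ge0|exact: uM|].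
rewrite normc_mul mulrC; apply: ler_pM; [exact: normc_ge0|exact: normc_ge0| |].
  apply: (le_trans (normc_cauchy_kernel _ ar _)) => //.
  by rewrite ler_pM2l// lef_pV2 ?posrE ?subr_gt0//; lra.
rewrite !normc_mul normc_cisJ mulr1 normc_real ger0_norm; last first.
  by rewrite invr_ge0 exprn_ge0// ltW.
rewrite mulrC normc_exp -exprVn -exprMn.
apply: lerXn2r; rewrite ?nnegrE.
- by apply: divr_ge0; [exact: normc_ge0|exact: ltW].
- by apply: divr_ge0; [exact: s0|exact: ltW].
- by rewrite ler_pM2r ?invr_gt0.
Qed.

(** In the expansion of the kernel only the constant term has a nonzero mean. *)
Lemma mean_kernel a : normc a < r -> mean (cauchy_kernel r a) = 1.
Proof.
move=> ar; apply/eqP; rewrite -subr_eq0 -normc_eq0 eq_le normc_ge0 andbT.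
apply/ler_addgt0Pr => e e0; rewrite add0r.
have q0 : 0 <= normc a / r by rewrite divr_ge0 ?normc_ge0 ?ltW.
have q1 : normc a / r < 1 by rewrite ltr_pdivrMr// mul1r.
have [N NP] := geometric_small (2 * 1 * (r / (r - normc a))) q0 q1 e0.
have := @mean_kernel_expand (fun=> 1) 1 (normc a) a N.+1 (@ccircle_cst _ 1) ler01 _ ar (lexx _).
rewrite (@eq_mean _ _ (cauchy_kernel r a)); last by move=> t; rewrite mul1r.
rewrite (_ : \sum_(n < _) _ = 1); last first.
  rewrite big_ord_recl /= big1 ?addr0.
    rewrite !expr0 invr1 mulr1 mul1r -[RHS](mean_cst 1).
    by apply: eq_mean => t; rewrite expr0 mulr1.
  move=> n _; rewrite (_ : mean _ = 0) ?mulr0 ?mul0r//.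
  rewrite -[RHS]conjc0 -[0 in RHS](mean_cis (lift ord0 n)) -mean_conj; last first.
    by move=> t _; apply/ccont_exp/ccont_cis.
  by apply: eq_mean => t; rewrite mul1r rmorphXn.
move=> H; apply: le_trans (H _) _; last by rewrite ltW// NP.
by move=> t _; rewrite ComplexField.Normc.normc1.
Qed.

Lemma ccircle_diff h : (forall z : C, normc z < rho -> differentiable h z) ->
  ccircle (fun t => h (r%:C * cis t)).
Proof.
move=> dh t _; apply: ccont_comp.
  apply: differentiable_continuous; apply: dh.
  by rewrite normc_mul normc_cis mulr1 normc_real gtr0_norm.
by apply: ccontM; [exact: ccont_cst|exact: ccont_cis].
Qed.

Lemma cauchy_mean1 h a : normc a < r ->
  (forall z : C, normc z < rho -> differentiable h z) ->
  mean (fun t => h (r%:C * cis t) * cauchy_kernel r a t) = h a.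
Proof. by move=> ar dh; rewrite (cauchy_mean ar dh) mean_kernel// mulr1. Qed.

Lemma power_series1 h M s N a : (forall z : C, normc z < rho -> differentiable h z) ->
  0 <= M -> (forall t, 0 <= t <= 2 * pi -> normc (h (r%:C * cis t)) <= M) ->
  s < r -> normc a <= s ->
  normc (h a - \sum_(n < N) ccoef r h n * a ^+ n) <= 2 * M * (r / (r - s)) * (s / r) ^+ N.
Proof.
move=> dh M0 hM sr as_.
rewrite -{1}(@cauchy_mean1 h a (le_lt_trans as_ sr) dh).
exact: (mean_kernel_expand N (ccircle_diff dh) M0 hM sr as_).
Qed.

End PowerSeries1.

Lemma normc_dist_dist (R : realType) (z w : R[i]) : `|normc z - normc w| <= normc (z - w).
Proof.
have h1 := normcD (z - w) w; have h2 := normcD (w - z) z.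
move: h1 h2; rewrite !subrK (normc_distC w z) ler_norml => h1 h2.
by apply/andP; split; lra.
Qed.

(** * Power series in two variables *)

Section PowerSeries2.
Variable R : realType.
Local Notation C := (R[i])^o.
Local Notation mu := (@lebesgue_measure R).

(** Continuity under the integral sign is used on the open interval from [-1] to
    [2 * pi + 1], which contains the closed interval of parameters. *)
Lemma ccircle_mean (G : R -> R -> R[i]) (M : R) :
  (forall t, -1 < t < 2 * pi + 1 -> ccircle (G t)) ->
  (forall t y, -1 < t < 2 * pi + 1 -> 0 <= y <= 2 * pi -> ccont (G ^~ y) t) ->
  (forall t y, -1 < t < 2 * pi + 1 -> 0 <= y <= 2 * pi -> normc (G t y) <= M) ->
  ccircle (fun t => mean (G t)).
Proof.
move=> G1 G2 GM t /andP[t0 t1].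
apply: ccontM; first exact: ccont_cst.
have tI : t \in `]-1, (2 * pi + 1)[%classic.
  by rewrite inE /= in_itv /=; apply/andP; split; lra.
have Mi : mu.-integrable `[0, 2 * pi]%classic (EFin \o (fun=> M)).
  apply: (@integrable_bounded _ _ _ mu _ _ (fun=> M) `|M|) => //.
  by rewrite [X in (X < _)%E](lebesgue_itvcc (ltW (pi2_gt0 R))) ltry.
apply: ccont_ReIm.
- apply: (@continuity_under_integral _ _ _ mu (fun x y => complex.Re (G x y))
    `[0, 2 * pi]%classic _ (-1) (2 * pi + 1) _ _ (fun=> M) Mi) => //.
  + by move=> x; rewrite /= in_itv /= => xI; exact: (pint_integrable (G1 _ xI)).1.
  + apply: aeW => y; rewrite /= in_itv /= => yI x.
    rewrite inE /= in_itv /= => xI; exact: (ccont_Re (G2 _ _ xI yI)).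
  + move=> x; rewrite /= in_itv /= => xI; apply: aeW => y; rewrite /= in_itv /= => yI.
    exact: le_trans (normc_Re _) (GM _ _ xI yI).
- apply: (@continuity_under_integral _ _ _ mu (fun x y => complex.Im (G x y))
    `[0, 2 * pi]%classic _ (-1) (2 * pi + 1) _ _ (fun=> M) Mi) => //.
  + by move=> x; rewrite /= in_itv /= => xI; exact: (pint_integrable (G1 _ xI)).2.
  + apply: aeW => y; rewrite /= in_itv /= => yI x.
    rewrite inE /= in_itv /= => xI; exact: (ccont_Im (G2 _ _ xI yI)).
  + move=> x; rewrite /= in_itv /= => xI; apply: aeW => y; rewrite /= in_itv /= => yI.
    exact: le_trans (normc_Im _) (GM _ _ xI yI).
Qed.

Variables (rho1 rho2 r1 r2 : R).
Hypotheses (r10 : 0 < r1) (r20 : 0 < r2) (r1rho : r1 < rho1) (r2rho : r2 < rho2).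
Variable g : C2 R -> C.
Hypothesis dg : forall z : C2 R, normc z.1 < rho1 -> normc z.2 < rho2 ->
  differentiable g z.

Let dg1 (z2 : C) : normc z2 < rho2 -> forall z : C, normc z < rho1 ->
  differentiable (fun w : C => g (w, z2)) z.
Proof.
move=> z2r z zr; apply: (@differentiable_comp _ _ _ _ (fun w : C => (w, z2) : C2 R) g).
  exact: differentiable_pair.
exact: dg.
Qed.

Let dg2 (z1 : C) : normc z1 < rho1 -> forall z : C, normc z < rho2 ->
  differentiable (fun w : C => g (z1, w)) z.
Proof.
move=> z1r z zr; apply: (@differentiable_comp _ _ _ _ (fun w : C => (z1, w) : C2 R) g).
  exact: differentiable_pair.
exact: dg.
Qed.

Let normc_circ (r t : R) : 0 < r -> normc (r%:C * cis t) = r.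
Proof. by move=> r0; rewrite normc_mul normc_cis mulr1 normc_real gtr0_norm. Qed.

Let torus (p : R * R) : C2 R := (r1%:C * cis p.1, r2%:C * cis p.2).

(** Compactness of the torus of radii [r1] and [r2]. *)
Let torus_bound : exists2 M, 0 <= M &
  forall t y, -1 < t < 2 * pi + 1 -> 0 <= y <= 2 * pi -> normc (g (torus (t, y))) <= M.
Proof.
have comp : compact (`[-1, 2 * pi + 1]%classic `*` `[0, 2 * pi]%classic : set (R * R)).
  by apply: compact_setX; exact: segment_compact.
have cont : continuous (fun p : R * R => normc (g (torus p)) : R).
  move=> p; apply/cvgrPdist_lt => e e0.
  have /differentiable_continuous/cvgrPdist_lt/(_ e%:C) : differentiable g (torus p).
    by apply: dg; rewrite normc_circ.
  rewrite ltcR => /(_ e0) H.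
  have ctor : torus x @[x --> p] --> torus p.
    have c1 : {for p, continuous (fun p : R * R => r1%:C * cis p.1 : C)}.
      apply: (@continuous_comp _ _ _ (@fst R R) (fun t : R => r1%:C * cis t : C)).
        exact: cvg_fst.
      exact: (ccontM (@ccont_cst _ r1%:C _) (@ccont_cis _ _)).
    have c2 : {for p, continuous (fun p : R * R => r2%:C * cis p.2 : C)}.
      apply: (@continuous_comp _ _ _ (@snd R R) (fun t : R => r2%:C * cis t : C)).
        exact: cvg_snd.
      exact: (ccontM (@ccont_cst _ r2%:C _) (@ccont_cis _ _)).
    exact: (cvg_pair c1 c2).
  have {}H := ctor _ H; near=> q.
  have : `|g (torus p) - g (torus q)| < e%:C by near: q; exact: H.
  rewrite normcE_norm ltcR; apply: le_lt_trans.
  exact: normc_dist_dist.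
have := continuous_compact (continuous_subspaceT cont) comp.
move=> /(@compact_bounded R R^o)[N [_ NP]].
exists (`|N| + 1); first by rewrite addr_ge0.
move=> t y /andP[t0 t1] yP; rewrite -[leLHS]ger0_norm ?normc_ge0//.
apply: NP; first by rewrite (le_lt_trans (ler_norm _))// ltrDl.
exists (t, y) => //; split; rewrite /= in_itv //=.
by rewrite !ltW.
Unshelve. all: by end_near. Qed.

Definition ccoef2 j k : R[i] :=
  ccoef r1 (fun w1 => ccoef r2 (fun w2 => g (w1, w2)) k) j.

(** Expand the slice [g (_, z2)] in powers of [z1]: its coefficients are circle means of
    the slices [g (w, _)], whose own expansions in powers of [z2] converge uniformly
    in [w]. *)
Lemma power_series2 s1 s2 : 0 <= s1 -> s1 < r1 -> 0 <= s2 -> s2 < r2 ->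
  forall e, 0 < e -> exists N0, forall N, (N0 <= N)%N ->
  forall z : C2 R, normc z.1 <= s1 -> normc z.2 <= s2 ->
  normc (g z - \sum_(j < N) \sum_(k < N) ccoef2 j k * z.1 ^+ j * z.2 ^+ k) <= e.
Proof.
move=> s10 s1r s20 s2r e e0.
have [M M0 MP] := torus_bound.
have q1P : 0 <= s1 / r1 < 1 by rewrite divr_ge0 ?(ltW r10)//= ltr_pdivrMr// mul1r.
have q2P : 0 <= s2 / r2 < 1 by rewrite divr_ge0 ?(ltW r20)//= ltr_pdivrMr// mul1r.
have /andP[q10 q11] := q1P; have /andP[q20 q21] := q2P.
pose K1 := r1 / (r1 - s1); pose K2 := r2 / (r2 - s2).
have K10 : 0 <= K1 by rewrite divr_ge0 ?subr_ge0 // ltW.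
have K20 : 0 <= K2 by rewrite divr_ge0 ?subr_ge0 // ltW.
have e2 : 0 < e / 2 by rewrite divr_gt0.
have [N1 N1P] := geometric_small (2 * (2 * M * K2) * K1) q10 q11 e2.
have [N2 N2P] := geometric_small (2 * (2 * M * K2) * (1 - s1 / r1)^-1) q20 q21 e2.
exists (maxn N1 N2) => N; rewrite geq_max => /andP[/N1P {N1P} A1 /N2P {N2P} A2].
case=> z1 z2 /= z1s z2s.
have z1r : normc z1 < r1 by exact: le_lt_trans s1r.
have z2r : normc z2 < r2 by exact: le_lt_trans s2r.
have z2rho : normc z2 < rho2 by exact: lt_trans r2rho.
have c2pi (t : R) : 0 <= t <= 2 * pi -> -1 < t < 2 * pi + 1.
  by move=> /andP[? ?]; apply/andP; split; lra.
have circ1 t : normc (r1%:C * cis t) < rho1 by rewrite normc_circ.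
have slice2 t n : 0 <= t <= 2 * pi ->
  normc (g (r1%:C * cis t, z2) -
    \sum_(k < n) ccoef r2 (fun w2 => g (r1%:C * cis t, w2)) k * z2 ^+ k) <=
    2 * M * K2 * (s2 / r2) ^+ n.
  move=> tP; apply: (@power_series1 _ rho2 r2 r20 r2rho (fun w2 => g (r1%:C * cis t, w2))) => //.
  - exact: (dg2 (circ1 t)).
  - by move=> y yP; apply: (MP t y) => //; exact: c2pi.
have bnd1 t : 0 <= t <= 2 * pi -> normc (g (r1%:C * cis t, z2)) <= 2 * M * K2.
  by move=> tP; have := slice2 t 0%N tP; rewrite big_ord0 subr0 expr0 mulr1.
have slice1 : normc (g (z1, z2) - \sum_(j < N) ccoef r1 (fun w1 => g (w1, z2)) j * z1 ^+ j) <=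
   2 * (2 * M * K2) * K1 * (s1 / r1) ^+ N.
  apply: (@power_series1 _ rho1 r1 r10 r1rho (fun w1 => g (w1, z2))) => //.
  - exact: dg1.
  - by apply: mulr_ge0 => //; exact: mulr_ge0.
have cB k : ccircle (fun t => ccoef r2 (fun w2 => g (r1%:C * cis t, w2)) k).
  apply: ccircleM; first exact: ccircle_cst.
  apply: (@ccircle_mean _ M).
  - move=> t tP; apply: ccircleM; last exact: ccircle_cisJ.
    exact: (ccircle_diff r20 r2rho (dg2 (circ1 t))).
  - move=> t y tP yP; apply: ccontM; last exact: ccont_cst.
    apply: (@ccont_comp _ (fun w => g (w, r2%:C * cis y)) (fun t => r1%:C * cis t)).
      apply: differentiable_continuous; apply: dg1 => //.
      by rewrite normc_circ.
    by apply: ccontM; [exact: ccont_cst|exact: ccont_cis].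
  - by move=> t y tP yP; rewrite normc_mul normc_cisJ mulr1; exact: (MP t y).
have csl : ccircle (fun t => g (r1%:C * cis t, z2)) by exact: (ccircle_diff r10 r1rho (dg1 z2rho)).
pose Bz (k : nat) t := ccoef r2 (fun w2 => g (r1%:C * cis t, w2)) k * z2 ^+ k.
have cBz k : ccircle (Bz k).
  by apply: ccircleM; [exact: cB|exact: ccircle_cst].
have coefs j : normc (ccoef r1 (fun w1 => g (w1, z2)) j - \sum_(k < N) ccoef2 j k * z2 ^+ k) <=
    r1 ^- j * (2 * (2 * M * K2 * (s2 / r2) ^+ N)).
  rewrite (_ : _ - _ = (r1 ^- j)%:C * mean (fun t => (g (r1%:C * cis t, z2) -
    \sum_(k < N) ccoef r2 (fun w2 => g (r1%:C * cis t, w2)) k * z2 ^+ k) * conjc (cis t) ^+ j)); last first.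
    rewrite (@eq_mean _ _ (fun t => g (r1%:C * cis t, z2) * conjc (cis t) ^+ j -
      \sum_(k < N) z2 ^+ k * (ccoef r2 (fun w2 => g (r1%:C * cis t, w2)) k * conjc (cis t) ^+ j))); last first.
      move=> t; rewrite mulrBl; congr (_ - _).
      by rewrite mulr_suml; apply: eq_bigr => k _; ring.
    pose F (k : nat) (t : R) := z2 ^+ k *
       (ccoef r2 (fun w2 => g (r1%:C * cis t, w2)) k * conjc (cis t) ^+ j).
    have cF k : ccircle (F k).
      apply: ccircleM; first exact: ccircle_cst.
      by apply: ccircleM; [exact: cB|exact: ccircle_cisJ].
    rewrite meanB; first last.
    - exact: (@ccircle_sum _ N F cF).
    - by apply: ccircleM; [exact: csl|exact: ccircle_cisJ].
    rewrite (@mean_sum _ N F cF) mulrBr; congr (_ - _).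
    rewrite mulr_sumr; apply: eq_bigr => k _.
    rewrite meanZ; last by apply: ccircleM; [exact: cB|exact: ccircle_cisJ].
    by rewrite /ccoef2 /ccoef; ring.
  rewrite normc_mul normc_real ger0_norm; last by rewrite invr_ge0 exprn_ge0// ltW.
  apply: ler_wpM2l; first by rewrite invr_ge0 exprn_ge0// ltW.
  apply: mean_bound.
    apply: ccircleM; last exact: ccircle_cisJ.
    by apply: ccircleB; [exact: csl|exact: (@ccircle_sum _ N Bz cBz)].
  by move=> t tP; rewrite normc_mul normc_cisJ mulr1; exact: slice2.
rewrite (_ : _ - _ = (g (z1, z2) - \sum_(j < N) ccoef r1 (fun w1 => g (w1, z2)) j * z1 ^+ j) +
  \sum_(j < N) (ccoef r1 (fun w1 => g (w1, z2)) j - \sum_(k < N) ccoef2 j k * z2 ^+ k) * z1 ^+ j); last first.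
  have -> : \sum_(j < N) (ccoef r1 (fun w1 => g (w1, z2)) j - \sum_(k < N) ccoef2 j k * z2 ^+ k) * z1 ^+ j
    = \sum_(j < N) ccoef r1 (fun w1 => g (w1, z2)) j * z1 ^+ j -
      \sum_(j < N) \sum_(k < N) ccoef2 j k * z1 ^+ j * z2 ^+ k.
    rewrite -sumrB; apply: eq_bigr => j _; rewrite mulrBl; congr (_ - _).
    by rewrite mulr_suml; apply: eq_bigr => k _; ring.
  by rewrite addrA subrK.
rewrite (splitr e); apply: (le_trans (normcD _ _)); apply: lerD.
  by apply: (le_trans slice1); exact: ltW.
apply: (le_trans (normc_sum _ _)).
apply: (@le_trans _ _ (\sum_(j < N) (2 * (2 * M * K2 * (s2 / r2) ^+ N)) * (s1 / r1) ^+ j)).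
  apply: ler_sum => j _; rewrite normc_mul normc_exp.
  rewrite [leRHS](_ : _ = r1 ^- j * (2 * (2 * M * K2 * (s2 / r2) ^+ N)) * s1 ^+ j); last first.
    rewrite (expr_div_n s1); move: (2 * (2 * M * K2 * _)) (s1 ^+ j) (r1 ^- j) => X Y Z.
    by ring.
  apply: ler_pM; [exact: normc_ge0|by rewrite exprn_ge0// normc_ge0|exact: coefs|].
  by apply: lerXn2r; rewrite ?nnegrE ?normc_ge0.
rewrite -mulr_sumr; apply: le_trans (ltW A2).
rewrite [leRHS](_ : _ = 2 * (2 * M * K2 * (s2 / r2) ^+ N) * (1 - s1 / r1)^-1); last by ring.
apply: ler_wpM2l; last first.
  by have := geom_sum_bound 0 N q10 q11; rewrite expr0 mul1r big_mkord.
by rewrite mulr_ge0// mulr_ge0 ?exprn_ge0// mulr_ge0// mulr_ge0.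
Qed.

End PowerSeries2.

(** * Measure preserving maps *)

Section InvariantMap.
Context d (T : measurableType d) (R : realType).
Variable mu : {measure set T -> \bar R}.

Definition measure_preserving (tau : T -> T) := measurable_fun [set: T] tau /\
  forall A, measurable A -> mu (tau @^-1` A) = mu A.

Lemma measure_preserving_comp s t : measure_preserving s -> measure_preserving t ->
  measure_preserving (s \o t).
Proof.
move=> [ms es] [mt et]; split; first exact: measurableT_comp.
move=> A mA; rewrite comp_preimage et ?es//.
by rewrite -[X in measurable X]setTI; exact: ms.
Qed.

Variable tau : T -> T.
Hypothesis ptau : measure_preserving tau.
Let mtau := ptau.1.
Let pushm : {measure set T -> \bar R} :=
  measure_function_pushforward__canonical__measure_function_Measure mu mtau.

Variable D : set T.
Hypotheses (mD : measurable D) (tauD : tau @^-1` D = D).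

Lemma ge0_integral_preserving (f : T -> \bar R) : measurable_fun D f ->
  {in D, forall x, 0 <= f x}%E ->
  (\int[mu]_(x in D) f (tau x) = \int[mu]_(x in D) f x)%E.
Proof.
move=> mf f0; rewrite -{1}tauD -(@ge0_integral_pushforward _ _ _ _ _ tau mtau)//.
by apply: (@eq_measure_integral _ _ _ D mu pushm) => A mA _; exact: ptau.2.
Qed.

Lemma measurable_fun_preserving d' (U : measurableType d') (f : T -> U) :
  measurable_fun D f -> measurable_fun D (f \o tau).
Proof.
move=> mf; rewrite -tauD; apply: (measurable_comp (F := D)) => //.
- by move=> _ [x Dx <-].
- exact: measurable_funTS.
Qed.

Lemma Rintegral_preserving (f : T -> R) : mu.-integrable D (EFin \o f) ->
  mu.-integrable D (EFin \o (f \o tau)) /\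
  \int[mu]_(x in D) f (tau x) = \int[mu]_(x in D) f x.
Proof.
move=> fi; have /integrableP[mf foo] := fi; split.
  apply/integrableP; split; first exact: (measurable_fun_preserving mf).
  rewrite (ge0_integral_preserving (f := fun x => `|(EFin \o f) x|%E))//.
  exact: measurableT_comp.
rewrite /Rintegral; congr fine.
rewrite [LHS]integralE [RHS]integralE.
congr (_ - _)%E.
- rewrite -(ge0_integral_preserving (f := (EFin \o f)^\+%E))//; last exact: measurable_funepos.
  by apply: eq_integral => x _; rewrite !funeposE.
- rewrite -(ge0_integral_preserving (f := (EFin \o f)^\-%E))//; last exact: measurable_funeneg.
  by apply: eq_integral => x _; rewrite !funenegE.
Qed.

Lemma cint_preserving u : cintegrable mu D u -> cintegrable mu D (u \o tau) /\
  cint mu D (u \o tau) = cint mu D u.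
Proof.
move=> [/Rintegral_preserving[i1 e1] /Rintegral_preserving[i2 e2]].
by split; [split|rewrite /cint e1 e2].
Qed.

End InvariantMap.

(** * Rotation invariance of Lebesgue measure *)

Section Rotation.
Variable R : realType.
Local Notation RR := (measurableTypeR R).
Local Notation leb := (@lebesgue_measure R).
Local Notation leb2 := (@lebesgue2 R).

Lemma translation_preserving (c : R) : measure_preserving leb (fun x : RR => x + c).
Proof.
have mt : measurable_fun [set: RR] (fun x : RR => x + c : RR).
  by apply: measurable_funD => //; exact: measurable_cst.
split => // A mA.
pose pm : {measure set RR -> \bar R} :=
  measure_function_pushforward__canonical__measure_function_Measure leb mt.
rewrite -[LHS]/(pm A); apply/esym/lebesgue_measure_unique => // _ [[a b] _ <-] /=.
rewrite /pm /pushforward /=.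
rewrite (_ : _ @^-1` _ = `]a - c, b - c]%classic); last first.
  by apply/seteqP; split => x /=; rewrite !in_itv /=; lra.
rewrite !lebesgue_measure_itv /= !lte_fin ltrD2r; case: ifPn => // _.
by rewrite -!EFinB; congr EFin; ring.
Qed.

Lemma shear2_preserving (c : R) :
  measure_preserving leb2 (fun p : RR * RR => (p.1, p.2 + c * p.1)).
Proof.
have ms : measurable_fun [set: RR * RR] (fun p : RR * RR => (p.1, p.2 + c * p.1) : RR * RR).
  apply: measurable_fun_pair => //; apply: measurable_funD => //.
  by apply: measurable_funM => //; exact: measurable_cst.
split => // A mA; rewrite /lebesgue2 /product_measure1.
apply: eq_integral => x _ /=.
rewrite -[RHS](translation_preserving (c * x)).2; last exact: measurable_xsection.
by congr leb; apply/seteqP; split => y; rewrite /xsection /= !inE.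
Qed.

Lemma lebesgue2_swapE A : measurable A -> leb2 A = (leb \x^ leb)%E A.
Proof.
move=> mA; apply: product_measure_unique => // B C mB mC.
exact: product_measure2E.
Qed.

Lemma shear1_preserving (c : R) :
  measure_preserving leb2 (fun p : RR * RR => (p.1 + c * p.2, p.2)).
Proof.
have ms : measurable_fun [set: RR * RR] (fun p : RR * RR => (p.1 + c * p.2, p.2) : RR * RR).
  apply: measurable_fun_pair => //; apply: measurable_funD => //.
  by apply: measurable_funM => //; exact: measurable_cst.
split => // A mA.
transitivity ((leb \x^ leb)%E ((fun p : RR * RR => (p.1 + c * p.2, p.2)) @^-1` A)).
  by apply: lebesgue2_swapE; rewrite -[X in measurable X]setTI; exact: ms.
transitivity ((leb \x^ leb)%E A); last exact/esym/lebesgue2_swapE.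
rewrite /product_measure2; apply: eq_integral => y _ /=.
rewrite -[RHS](translation_preserving (c * y)).2; last exact: measurable_ysection.
by congr leb; apply/seteqP; split => x; rewrite /ysection /= !inE.
Qed.

Definition rot (w : R[i]) (p : RR * RR) : RR * RR :=
  (complex.Re w * p.1 - complex.Im w * p.2, complex.Im w * p.1 + complex.Re w * p.2).

(** A rotation other than the half turn is a product of three shears, with slopes
    [- t], [b] and [- t], where [t] is the tangent of half the angle.  By Fubini's
    theorem shears preserve Lebesgue measure since translations do. *)
Lemma rot_preserving w : normc w = 1 -> w != -1 -> measure_preserving leb2 (rot w).
Proof.
case: w => a b w1 wN1.
have ab1 : a ^+ 2 + b ^+ 2 = 1 by rewrite -[RHS](expr1n _ 2) -w1 normc_sqr.
have a1 : 1 + a != 0.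
  apply: contra_neq wN1 => a0; have aN : a = -1 by lra.
  have b0 : b = 0 by apply/eqP; rewrite -sqrf_eq0; apply/eqP; nra.
  by rewrite aN b0; apply/eqP; rewrite eq_complex /= oppr0 !eqxx.
pose t := b / (1 + a).
have -> : rot (a +i* b) = (fun p : RR * RR => (p.1 + (- t) * p.2, p.2)) \o
   ((fun p : RR * RR => (p.1, p.2 + b * p.1)) \o (fun p : RR * RR => (p.1 + (- t) * p.2, p.2))).
  apply/funext => -[x y]; rewrite /rot /=.
  have tb : t * b = 1 - a by rewrite /t mulrAC -expr2 -(addKr (a ^+ 2) (b ^+ 2)) ab1; field.
  have ta : b = t * (1 + a) by rewrite /t divfK.
  congr pair.
    have -> : x + - t * y + - t * (y + b * (x + - t * y)) =
      x - t * y - t * y - (t * b) * (x - t * y) by ring.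
    by rewrite tb {1}ta; ring.
  have -> : y + b * (x + - t * y) = b * x + (1 - t * b) * y by ring.
  by rewrite tb; ring.
apply: measure_preserving_comp; first exact: shear1_preserving.
by apply: measure_preserving_comp; [exact: shear2_preserving|exact: shear1_preserving].
Qed.

Local Notation T4 := ((RR * RR) * (RR * RR))%type.
Local Notation leb4 := (@lebesgue4 R).

Lemma prod_preserving (s t : RR * RR -> RR * RR) : measure_preserving leb2 s ->
  measure_preserving leb2 t ->
  measure_preserving leb4 (fun p : T4 => (s p.1, t p.2)).
Proof.
move=> [ms es] [mt et].
have mst : measurable_fun [set: T4] (fun p : T4 => (s p.1, t p.2) : T4).
  by apply: measurable_fun_pair; exact: measurableT_comp.
split; first exact: mst.
move=> A mA.
pose pm : {measure set T4 -> \bar R} :=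
  measure_function_pushforward__canonical__measure_function_Measure leb4 mst.
rewrite -[LHS]/(pm A); apply/esym/product_measure_unique => // B C mB mC.
have -> : pm (B `*` C) = (leb2 \x leb2)%E ((s @^-1` B) `*` (t @^-1` C)) by [].
rewrite product_measure1E; first by rewrite es// et.
- by rewrite -[X in measurable X]setTI; exact: ms.
- by rewrite -[X in measurable X]setTI; exact: mt.
Qed.

Definition rot4 (w1 w2 : R[i]) (p : T4) : T4 := (rot w1 p.1, rot w2 p.2).

Lemma toC2_rot w1 w2 p : toC2 (rot4 w1 w2 p) = (w1 * (toC2 p).1, w2 * (toC2 p).2).
Proof.
case: w1 => a b; case: w2 => c d; case: p => [[x1 y1] [x2 y2]].
by rewrite /toC2 /rot4 /rot /=; congr pair; apply: complexP => /=; ring.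
Qed.

(** The number [-1] is left out because the factorization of [rot_preserving] fails
    there. *)
Definition good_unit (w : R[i]) := normc w = 1 /\ w != -1.

Lemma good_unit1 : good_unit 1.
Proof. by split; [exact: ComplexField.Normc.normc1|rewrite eq_sym eqNr oner_eq0]. Qed.

Lemma rot4_preserving w1 w2 : good_unit w1 -> good_unit w2 ->
  measure_preserving leb4 (rot4 w1 w2).
Proof. by move=> [n1 w1N] [n2 w2N]; apply: prod_preserving; exact: rot_preserving. Qed.

(** A root of order [2 * k] of [-1]: its power of order [k] squares to [-1]. *)
Lemma good_unit_exists (k : nat) : (0 < k)%N ->
  exists2 w : R[i], good_unit w & w ^+ k != 1.
Proof.
move=> k0; have [w wP] : exists w : R[i], w ^+ (2 * k) = -1.
  have k20 : (0 < 2 * k)%N by rewrite muln_gt0.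
  have [w H] := @solve_monicpoly R[i] (2 * k)%N (fun i => if i == 0%N then -1 else 0) k20.
  exists w; rewrite H; case: (2 * k)%N k20 => // n _.
  by rewrite big_ord_recl /= expr0 mulr1 big1 ?addr0// => i _; rewrite mul0r.
have N11 : (-1 : R[i]) != 1 by rewrite eqNr oner_eq0.
exists w; last by apply: contra_eq_neq wP => w1; rewrite mulnC exprM w1 expr1n eq_sym.
split.
  have : normc w ^+ (2 * k) = 1.
    by rewrite -normc_exp wP normc_opp ComplexField.Normc.normc1.
  by move=> /eqP; rewrite pexpr_eq1 ?normc_ge0 ?muln_gt0// => /eqP.
apply/eqP => w1; move: wP; rewrite w1 exprM sqrrN !expr1n => /eqP.
by rewrite eq_sym (negPf N11).
Qed.

End Rotation.

(** * Series of complex numbers *)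

Section ComplexSeries.
Variable R : realType.
Local Notation C := (R[i])^o.
Implicit Types (u a : nat -> R[i]).

(** The series of general term [u] converges to [l]; the inequality is large so that it
    passes to limits. *)
Definition csums u (l : R[i]) := forall e : R, 0 < e -> exists N0, forall N, (N0 <= N)%N ->
  normc (l - \sum_(n < N) u n) <= e.

Lemma eq_csums u v l : u =1 v -> csums u l -> csums v l.
Proof.
move=> uv H e e0; have [N0 NP] := H e e0; exists N0 => N /NP.
by rewrite (eq_bigr (fun n : 'I_N => v n)).
Qed.

Lemma csumsD u v l l' : csums u l -> csums v l' -> csums (fun n => u n + v n) (l + l').
Proof.
move=> h h' e e0; have e2 : 0 < e / 2 by rewrite divr_gt0.
have [N NP] := h _ e2; have [N' NP'] := h' _ e2.
exists (maxn N N') => n; rewrite geq_max => /andP[/NP H1 /NP' H2].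
rewrite big_split /= opprD addrACA; apply: (le_trans (normcD _ _)); lra.
Qed.

Lemma csumsZ c u l : csums u l -> csums (fun n => c * u n) (c * l).
Proof.
move=> h e e0; have c1 : 0 < normc c + 1 by rewrite ltr_pwDr// normc_ge0.
have e2 : 0 < e / (normc c + 1) by rewrite divr_gt0.
have [N NP] := h _ e2; exists N => n /NP H.
rewrite -mulr_sumr -mulrBr normc_mul.
apply: (@le_trans _ _ ((normc c + 1) * (e / (normc c + 1)))).
  by apply: ler_pM; rewrite ?normc_ge0// lerDl.
by rewrite mulrC divfK// gt_eqF.
Qed.

Lemma csums_norm_le u l b : csums u l ->
  (forall N, normc (\sum_(n < N) u n) <= b) -> normc l <= b.
Proof.
move=> h ub; apply/ler_addgt0Pr => e e0.
have [N NP] := h _ e0; have := NP N (leqnn _); have := ub N.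
set S := \sum_(n < _) _ => H1 H2; rewrite -(subrK S l).
by apply: (le_trans (normcD _ _)); lra.
Qed.

Lemma sum_diff_geom u K q N M : 0 <= q -> q < 1 -> (forall n, normc (u n) <= K * q ^+ n) ->
  (N <= M)%N -> normc (\sum_(n < M) u n - \sum_(n < N) u n) <= K * (q ^+ N / (1 - q)).
Proof.
move=> q0 q1 uK NM.
have -> : \sum_(n < M) u n = \sum_(n < N) u n + \sum_(N <= n < M) u n.
  by rewrite -!(big_mkord xpredT u) -big_cat_nat.
rewrite addrC addKr.
apply: (le_trans (normc_sum _ _)).
apply: (@le_trans _ _ (\sum_(N <= n < M) K * q ^+ n)); first exact: ler_sum.
rewrite -mulr_sumr; apply: ler_wpM2l; last exact: geom_sum_bound.
by have := uK 0%N; rewrite expr0 mulr1; apply: le_trans; exact: normc_ge0.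
Qed.

Lemma csums_tail u l K q N : 0 <= q -> q < 1 -> (forall n, normc (u n) <= K * q ^+ n) ->
  csums u l -> normc (l - \sum_(n < N) u n) <= K * (q ^+ N / (1 - q)).
Proof.
move=> q0 q1 uK h; apply/ler_addgt0Pr => e e0.
have [N1 NP] := h _ e0; have := NP (maxn N N1) (leq_maxr _ _).
have := sum_diff_geom q0 q1 uK (leq_maxl N N1).
set S := \sum_(n < maxn _ _) _ => H1 H2.
rewrite (_ : l - _ = (l - S) + (S - \sum_(n < N) u n)); last by ring.
by apply: (le_trans (normcD _ _)); lra.
Qed.

Lemma csums_exists u K q : 0 <= q -> q < 1 -> (forall n, normc (u n) <= K * q ^+ n) ->
  exists l, csums u l.
Proof.
move=> q0 q1 uK.
have K0 : 0 <= K by have := uK 0%N; rewrite expr0 mulr1; apply: le_trans; exact: normc_ge0.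
have real_lim (v : nat -> R) : (forall n, `|v n| <= K * q ^+ n) ->
    exists l, forall e, 0 < e -> exists N0, forall N, (N0 <= N)%N ->
    `|l - \sum_(n < N) v n| < e.
  move=> vK; have : cvgn (series v).
    apply: normed_cvg; apply: (@series_le_cvg _ _ (geometric K q)).
    - by move=> n; exact: normr_ge0.
    - by move=> n; rewrite /geometric /= mulr_ge0// exprn_ge0.
    - by move=> n; exact: vK.
    - by apply: is_cvg_geometric_series; rewrite ger0_norm.
  move=> /cvgrPdist_lt H; exists (limn (series v)) => e e0.
  have [N0 _ NP] := H e e0; exists N0 => N /NP.
  by rewrite /= seriesEord.
have [l1 h1] := real_lim (fun n => complex.Re (u n)) (fun n => le_trans (normc_Re _) (uK n)).
have [l2 h2] := real_lim (fun n => complex.Im (u n)) (fun n => le_trans (normc_Im _) (uK n)).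
exists (l1 +i* l2) => e e0; have e2 : 0 < e / 2 by rewrite divr_gt0.
have [N NP] := h1 _ e2; have [N' NP'] := h2 _ e2.
exists (maxn N N') => n; rewrite geq_max => /andP[/NP H1 /NP' H2].
apply: (le_trans (normc_le_ReIm _)).
have ReS m : complex.Re (\sum_(i < m) u i) = \sum_(i < m) complex.Re (u i).
  by elim: m => [|m IH]; rewrite ?big_ord0// !big_ord_recr cReD IH.
have ImS m : complex.Im (\sum_(i < m) u i) = \sum_(i < m) complex.Im (u i).
  by elim: m => [|m IH]; rewrite ?big_ord0// !big_ord_recr cImD IH.
rewrite cReD cImD cReN cImN ReS ImS /=; lra.
Qed.

End ComplexSeries.

(** * Sums of power series *)

Section PowerSeriesDisc.
Variable R : realType.
Local Notation C := (R[i])^o.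
Variable B : R.
Implicit Types (a : nat -> R[i]).

(** The power series of coefficients [a] has radius of convergence at least [B]. *)
Definition power_bounded a := forall s, 0 < s -> s < B ->
  exists K, forall n, normc (a n) * s ^+ n <= K.

Lemma power_bounded_geom a s : power_bounded a -> 0 <= s -> s < B ->
  exists K q, [/\ 0 <= q, q < 1 & forall n, normc (a n) * s ^+ n <= K * q ^+ n].
Proof.
move=> pb s0 sB; pose s' := (s + B) / 2.
have s'0 : 0 < s' by rewrite /s'; lra.
have s'B : s' < B by rewrite /s'; lra.
have ss' : s < s' by rewrite /s'; lra.
have [K KP] := pb s' s'0 s'B.
exists K, (s / s'); split.
- by rewrite divr_ge0// ltW.
- by rewrite ltr_pdivrMr// mul1r.
- move=> n; rewrite expr_div_n mulrA ler_pdivlMr ?exprn_gt0// mulrAC.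
  by rewrite ler_wpM2r// exprn_ge0.
Qed.

Lemma power_series_exists a : power_bounded a ->
  exists phi : C -> C, forall t, normc t < B -> csums (fun n => a n * t ^+ n) (phi t).
Proof.
move=> pb.
have H (t : C) : exists l, normc t < B -> csums (fun n => a n * t ^+ n) l.
  have [tB|] := boolP (normc t < B); last by exists 0.
  have [K [q [q0 q1 KP]]] := power_bounded_geom pb (normc_ge0 t) tB.
  have [l lP] : exists l, csums (fun n => a n * t ^+ n) l.
    by apply: (csums_exists q0 q1) => n; rewrite normc_mul normc_exp; exact: KP.
  by exists l.
by have [phi phiP] := choice H; exists phi.
Qed.

(** The remainder of order 2 of [t ^+ n] at [t0]. *)
Let E (t t0 : R[i]) n := t ^+ n - t0 ^+ n - n%:R * t0 ^+ n.-1 * (t - t0).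

Let ES t t0 n : E t t0 n.+1 = t * E t t0 n + n%:R * t0 ^+ n.-1 * (t - t0) ^+ 2.
Proof.
case: n => [|n]; first by rewrite /E /= !expr0 !expr1 !mul0r; ring.
by rewrite /E /= !exprS; ring.
Qed.

(** The same remainder between the real numbers [r] and [r + d]; it bounds [E]. *)
Let M (r d : R) n := (r + d) ^+ n - r ^+ n - n%:R * r ^+ n.-1 * d.

Let MS r d n : M r d n.+1 = (r + d) * M r d n + n%:R * r ^+ n.-1 * d ^+ 2.
Proof.
case: n => [|n]; first by rewrite /M /= !expr0 !expr1 !mul0r; ring.
by rewrite /M /= !exprS; ring.
Qed.

Let M_ge0 r d n : 0 <= r -> 0 <= d -> 0 <= M r d n.
Proof.
move=> r0 d0; elim: n => [|n IH]; first by rewrite /M !expr0 !mul0r subrr subr0.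
rewrite MS; apply: addr_ge0; first by apply: mulr_ge0 => //; exact: addr_ge0.
by apply: mulr_ge0; [apply: mulr_ge0 => //; exact: exprn_ge0|exact: sqr_ge0].
Qed.

(** [E] and [M] satisfy the same recurrence, so [E] is bounded by [M] with the quadratic
    factor [(normc (t - t0) / d) ^+ 2]. *)
Let E_le t t0 d n : 0 < d -> normc (t - t0) <= d ->
  normc (E t t0 n) <= (normc (t - t0) / d) ^+ 2 * (normc t0 + d) ^+ n.
Proof.
move=> d0 td; set D := normc (t - t0).
have D0 : 0 <= D by exact: normc_ge0.
have t00 := normc_ge0 t0.
suff H : normc (E t t0 n) <= (D / d) ^+ 2 * M (normc t0) d n.
  apply: (le_trans H); apply: ler_wpM2l; first exact: sqr_ge0.
  have h1 := exprn_ge0 n t00.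
  have h2 : 0 <= n%:R * normc t0 ^+ n.-1 * d.
    by apply: mulr_ge0; [apply: mulr_ge0 => //; exact: exprn_ge0|exact: ltW].
  by rewrite /M; lra.
elim: n => [|n IH].
  by rewrite /E /M !expr0 !mul0r !subrr ?subr0 ComplexField.Normc.normc0 mulr0.
rewrite ES MS [leRHS]mulrDr; apply: (le_trans (normcD _ _)); apply: lerD.
  rewrite normc_mul [leRHS]mulrCA; apply: ler_pM; rewrite ?normc_ge0//.
  by rewrite -(subrK t0 t) addrC; apply: (le_trans (normcD _ _)); rewrite lerD2l.
rewrite !normc_mul !normc_exp -/D.
have -> : normc (n%:R : R[i]) = n%:R.
  by rewrite -(rmorph_nat (real_complex R)) normc_real ger0_norm.
rewrite expr_div_n [leRHS](_ : _ = n%:R * normc t0 ^+ n.-1 * D ^+ 2)//.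
by field; rewrite gt_eqF.
Qed.

(** Termwise differentiation: by [E_le] the remainders of order 2 of all terms are
    bounded by one multiple of [normc (t - t0) ^+ 2], summably since there is room
    between [normc t0 + d] and [B]. *)
Lemma power_series_differentiable a (phi : C -> C) (t0 : C) : power_bounded a ->
  (forall t, normc t < B -> csums (fun n => a n * t ^+ n) (phi t)) ->
  normc t0 < B -> differentiable phi t0.
Proof.
move=> pb phiP t0B; pose d := (B - normc t0) / 2.
have d0 : 0 < d by rewrite /d; lra.
have t00 := normc_ge0 t0.
have sB : normc t0 + d < B by rewrite /d; lra.
have [K [q [q0 q1 KP]]] := power_bounded_geom pb (addr_ge0 t00 (ltW d0)) sB.
have K0 : 0 <= K.
  by have := KP 0%N; rewrite !expr0 !mulr1; apply: le_trans; exact: normc_ge0.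
pose u n := a n * (n%:R * t0 ^+ n.-1).
have uK n : normc (u n) <= (K / d) * q ^+ n.
  rewrite /u !normc_mul normc_exp.
  have -> : normc (n%:R : R[i]) = n%:R.
    by rewrite -(rmorph_nat (real_complex R)) normc_real ger0_norm.
  rewrite mulrAC ler_pdivlMr// -mulrA; apply: le_trans (KP n).
  apply: ler_wpM2l; first exact: normc_ge0.
  have := M_ge0 n t00 (ltW d0); rewrite /M; have := exprn_ge0 n t00; lra.
have [psi psiP] := csums_exists q0 q1 uK.
have key (t : C) : normc (t - t0) <= d ->
    normc (phi t - phi t0 - psi * (t - t0)) <= (normc (t - t0) / d) ^+ 2 * (K / (1 - q)).
  move=> td; have tB : normc t < B.
    by rewrite -(subrK t0 t); apply: (le_lt_trans (normcD _ _)); lra.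
  have cs : csums (fun n => a n * E t t0 n) (phi t - phi t0 - psi * (t - t0)).
    have h1 := phiP _ tB.
    have h2 := csumsZ (-1) (phiP _ t0B).
    have h3 := csumsZ (- (t - t0)) psiP.
    have := csumsD (csumsD h1 h2) h3; rewrite mulN1r mulNr (mulrC (t - t0)).
    by apply: eq_csums => n; rewrite /E /u; ring.
  apply: (csums_norm_le cs) => N; apply: (le_trans (normc_sum _ _)).
  apply: (@le_trans _ _ (\sum_(n < N) (normc (t - t0) / d) ^+ 2 * (K * q ^+ n))).
    apply: ler_sum => n _; rewrite normc_mul.
    apply: (@le_trans _ _ (normc (a n) * ((normc (t - t0) / d) ^+ 2 * (normc t0 + d) ^+ n))).
      by apply: ler_wpM2l; [exact: normc_ge0|exact: E_le].
    by rewrite mulrCA; apply: ler_wpM2l; [exact: sqr_ge0|exact: KP].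
  rewrite -!mulr_sumr; apply: ler_wpM2l; first exact: sqr_ge0.
  apply: ler_wpM2l => //.
  by have := geom_sum_bound 0 N q0 q1; rewrite expr0 mul1r big_mkord.
apply/derivable1_diffP/cvg_ex; exists psi; apply/cvgrPdist_le => e /gt0_complexE[e0 ->].
pose K' := K / (1 - q) / d ^+ 2.
have K'0 : 0 <= K'.
  apply: divr_ge0; last exact: sqr_ge0.
  by apply: divr_ge0 => //; rewrite subr_ge0 ltW.
have K'1 : 0 < K' + 1 by rewrite ltr_pwDr.
apply/nbhsCP; exists (Num.min d (complex.Re e / (K' + 1))).
  by rewrite lt_min d0 divr_gt0.
move=> w; rewrite subr0 lt_min => /andP[wd we] w0.
rewrite /GRing.scale /= mulr1 normcE_norm lecR.
have := key (w + t0); rewrite addrK => /(_ (ltW wd)) H.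
rewrite (_ : psi - _ = - (w^-1 * (phi (w + t0) - phi t0 - psi * w))); last by field.
rewrite normc_opp normc_mul ComplexField.Normc.normcV mulrC ler_pdivrMr ?normc_gt0//.
apply: (le_trans H); rewrite [leLHS](_ : _ = (normc w * K') * normc w); last first.
  by rewrite /K'; field; rewrite gt_eqF//= subr_eq0 gt_eqF.
apply: ler_wpM2r; first exact: normc_ge0.
apply: (@le_trans _ _ (complex.Re e / (K' + 1) * (K' + 1))).
  by apply: ler_pM; rewrite ?normc_ge0// ?ltW// ltrDl.
by rewrite divfK// gt_eqF.
Qed.

End PowerSeriesDisc.

(** * Square integrable functions *)

Section SquareIntegrable.
Context d (T : measurableType d) (R : realType).
Variable mu : {measure set T -> \bar R}.
Implicit Types (D : set T) (u v w : T -> R[i]).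
Local Notation Re := complex.Re.
Local Notation Im := complex.Im.

Definition sqint D u := mfunC D u /\
  (\int[mu]_(x in D) (normc (u x) ^+ 2)%:E < +oo)%E.
Definition nrm2 D u : R := \int[mu]_(x in D) normc (u x) ^+ 2.
Definition ip D u v : R[i] := cint mu D (fun x => u x * conjc (v x)).

Lemma sqint_integrable D u : measurable D -> sqint D u ->
  mu.-integrable D (EFin \o (fun x => normc (u x) ^+ 2)).
Proof.
move=> mD [mu_ ui]; apply/integrableP; split.
  by apply/measurable_EFinP; exact: mfunC_normc2.
under eq_integral => x _ do rewrite /= ger0_norm ?sqr_ge0//.
exact: ui.
Qed.

Lemma nrm2_ge0 D u : 0 <= nrm2 D u.
Proof. by apply: Rintegral_ge0 => x _; exact: sqr_ge0. Qed.

Lemma nrm2E D u : measurable D -> sqint D u ->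
  (nrm2 D u)%:E = (\int[mu]_(x in D) (normc (u x) ^+ 2)%:E)%E.
Proof.
move=> mD su; rewrite /nrm2 /Rintegral fineK//.
by have := integrable_fin_num mD (sqint_integrable mD su).
Qed.

Lemma sqintS D E u : measurable D -> measurable E -> D `<=` E -> sqint E u -> sqint D u.
Proof.
move=> mD mE DE [mu_ ui]; split; first exact: mfunCS mu_.
apply: le_lt_trans ui; apply: ge0_subset_integral => //.
- by apply/measurable_EFinP; exact: mfunC_normc2.
- by move=> x _; rewrite lee_fin sqr_ge0.
Qed.

Lemma nrm2S D E u : measurable D -> measurable E -> D `<=` E -> sqint E u ->
  nrm2 D u <= nrm2 E u.
Proof.
move=> mD mE DE su; rewrite -lee_fin !nrm2E//; last exact: sqintS su.
apply: ge0_subset_integral => //.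
- by apply/measurable_EFinP; apply: mfunC_normc2; exact: su.1.
- by move=> x _; rewrite lee_fin sqr_ge0.
Qed.

Lemma le_sqint D u (f : T -> R) : measurable D -> mfunC D u ->
  mu.-integrable D (EFin \o f) -> (forall x, D x -> normc (u x) ^+ 2 <= f x) ->
  sqint D u.
Proof.
move=> mD mu_ fi uf; split => //.
have : mu.-integrable D (EFin \o (fun x => normc (u x) ^+ 2)).
  apply: le_integrable fi => //.
    by apply/measurable_EFinP; exact: mfunC_normc2.
  move=> x Dx /=; rewrite lee_fin ger0_norm ?sqr_ge0//.
  exact: le_trans (uf _ Dx) (ler_norm _).
move=> /integrableP[_]; under eq_integral => x _ do rewrite /= ger0_norm ?sqr_ge0//.
by [].
Qed.

Lemma sqint_bounded D u M : measurable D -> (mu D < +oo)%E -> mfunC D u ->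
  (forall x, D x -> normc (u x) <= M) -> sqint D u.
Proof.
move=> mD fD mu_ uM; apply: (@le_sqint _ _ (fun=> M ^+ 2)) => //.
  by apply: integrable_bounded => // x _; exact: lexx.
move=> x Dx; apply: lerXn2r; rewrite ?nnegrE ?normc_ge0 ?uM//.
exact: le_trans (normc_ge0 _) (uM _ Dx).
Qed.

Lemma normc2D (z w : R[i]) : normc (z + w) ^+ 2 <= 2 * normc z ^+ 2 + 2 * normc w ^+ 2.
Proof.
rewrite !normc_sqr cReD cImD.
have := sqr_ge0 (Re z - Re w); have := sqr_ge0 (Im z - Im w); rewrite !sqrrB !sqrrD; lra.
Qed.

Lemma sqintD D u v : measurable D -> sqint D u -> sqint D v ->
  sqint D (fun x => u x + v x).
Proof.
move=> mD su sv.
apply: (@le_sqint _ _ (fun x => 2 * normc (u x) ^+ 2 + 2 * normc (v x) ^+ 2)) => //.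
- by apply: mfunCD; [exact: su.1|exact: sv.1].
- by apply: integrableDR => //; apply: integrableZR => //; exact: sqint_integrable.
- by move=> x _; exact: normc2D.
Qed.

Lemma sqintZ D c u : measurable D -> sqint D u -> sqint D (fun x => c * u x).
Proof.
move=> mD su.
apply: (@le_sqint _ _ (fun x => normc c ^+ 2 * normc (u x) ^+ 2)) => //.
- by apply: mfunCM; [exact: mfunC_cst|exact: su.1].
- by apply: integrableZR => //; exact: sqint_integrable.
- by move=> x _; rewrite normc_mul exprMn.
Qed.

Lemma sqintN D u : measurable D -> sqint D u -> sqint D (fun x => - u x).
Proof. by move=> mD su; under eq_fun do rewrite -mulN1r; exact: sqintZ. Qed.

Lemma sqintB D u v : measurable D -> sqint D u -> sqint D v ->
  sqint D (fun x => u x - v x).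
Proof. by move=> mD su sv; apply: sqintD => //; exact: sqintN. Qed.

Lemma sqint_sum D I (s : seq I) (F : I -> T -> R[i]) : measurable D ->
  (forall i, sqint D (F i)) -> sqint D (fun x => \sum_(i <- s) F i x).
Proof.
move=> mD sF; elim: s => [|i s IH].
  under eq_fun do rewrite big_nil; split; first exact: mfunC_cst.
  under eq_integral => x _ do rewrite ComplexField.Normc.normc0 expr0n.
  by rewrite integral0 ltry.
by under eq_fun do rewrite big_cons; exact: sqintD.
Qed.

Lemma eq_sqint D u v : {in D, u =1 v} -> sqint D u -> sqint D v.
Proof.
move=> uv [[m1 m2] ui]; split.
  split.
  - by apply: eq_measurable_fun m1 => x xD; rewrite uv.
  - by apply: eq_measurable_fun m2 => x xD; rewrite uv.
by rewrite (eq_integral (fun x => (normc (u x) ^+ 2)%:E))// => x xD; rewrite uv.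
Qed.

Lemma eq_nrm2 D u v : {in D, u =1 v} -> nrm2 D u = nrm2 D v.
Proof. by move=> uv; apply: eq_Rintegral => x xD; rewrite uv. Qed.

Lemma normc_mul_le (z w : R[i]) t : 0 < t ->
  normc z * normc w <= (t * normc z ^+ 2 + t^-1 * normc w ^+ 2) / 2.
Proof.
move=> t0; have t10 : t != 0 by rewrite gt_eqF.
have ti : 0 <= t^-1 by rewrite invr_ge0 ltW.
have := mulr_ge0 ti (sqr_ge0 (t * normc z - normc w)).
rewrite (_ : t^-1 * (t * normc z - normc w) ^+ 2 = t * normc z ^+ 2 + t^-1 * normc w ^+ 2 - 2 * (normc z * normc w)).
  lra.
by field.
Qed.

Lemma ip_integrable D u v : measurable D -> sqint D u -> sqint D v ->
  cintegrable mu D (fun x => u x * conjc (v x)).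
Proof.
move=> mD su sv.
have mf : mfunC D (fun x => u x * conjc (v x)).
  by apply: mfunCM; [exact: su.1|apply: mfunCJ; exact: sv.1].
have fi : mu.-integrable D (EFin \o (fun x => normc (u x) ^+ 2 + normc (v x) ^+ 2)).
  by apply: integrableDR => //; exact: sqint_integrable.
have le1 x : normc (u x * conjc (v x)) <= normc (u x) ^+ 2 + normc (v x) ^+ 2.
  rewrite normc_mul normc_conj; apply: (le_trans (normc_mul_le _ _ ltr01)).
  rewrite invr1 !mul1r; have := sqr_ge0 (normc (u x)); have := sqr_ge0 (normc (v x)); lra.
split.
- apply: le_integrable fi => //; first by apply/measurable_EFinP; exact: mf.1.
  move=> x _ /=; rewrite lee_fin (le_trans (normc_Re _))// (le_trans (le1 x))//.
  exact: ler_norm.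
- apply: le_integrable fi => //; first by apply/measurable_EFinP; exact: mf.2.
  move=> x _ /=; rewrite lee_fin (le_trans (normc_Im _))// (le_trans (le1 x))//.
  exact: ler_norm.
Qed.

Lemma ipDl D u v w : measurable D -> sqint D u -> sqint D v -> sqint D w ->
  ip D (fun x => u x + v x) w = ip D u w + ip D v w.
Proof.
move=> mD su sv sw; rewrite /ip -cintD//; try exact: ip_integrable.
by apply: eq_cint => x _; rewrite mulrDl.
Qed.

Lemma ipZl D c u w : measurable D -> sqint D u -> sqint D w ->
  ip D (fun x => c * u x) w = c * ip D u w.
Proof.
move=> mD su sw; rewrite /ip -cintZ//; last exact: ip_integrable.
by apply: eq_cint => x _; rewrite mulrA.
Qed.

Lemma ipBl D u v w : measurable D -> sqint D u -> sqint D v -> sqint D w ->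
  ip D (fun x => u x - v x) w = ip D u w - ip D v w.
Proof.
move=> mD su sv sw; rewrite ipDl//; last exact: sqintN.
congr (_ + _); under eq_fun do rewrite -mulN1r; by rewrite ipZl// mulN1r.
Qed.

Lemma ipC D u v : measurable D -> sqint D u -> sqint D v -> ip D v u = conjc (ip D u v).
Proof.
move=> mD su sv; have [i1 i2] := ip_integrable mD su sv.
rewrite /ip /cint; apply: complexP => /=.
  by apply: eq_Rintegral => x _; rewrite !cReM !cRe_conj !cIm_conj; ring.
rewrite -[RHS]mulN1r -RintegralZl//.
by apply: eq_Rintegral => x _; rewrite !cImM !cRe_conj !cIm_conj; ring.
Qed.

Lemma ipBr D u v w : measurable D -> sqint D u -> sqint D v -> sqint D w ->
  ip D w (fun x => u x - v x) = ip D w u - ip D w v.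
Proof.
move=> mD su sv sw; rewrite ipC//; last exact: sqintB.
by rewrite ipBl// (ipC mD su sw) (ipC mD sv sw) rmorphB.
Qed.

Lemma ipZr D c u w : measurable D -> sqint D u -> sqint D w ->
  ip D w (fun x => c * u x) = conjc c * ip D w u.
Proof.
move=> mD su sw; rewrite ipC//; last exact: sqintZ.
by rewrite ipZl// (ipC mD su sw) rmorphM.
Qed.

Lemma ip_self D u : measurable D -> sqint D u -> ip D u u = (nrm2 D u)%:C.
Proof.
move=> mD su; rewrite /ip /cint; apply: complexP => /=.
  by apply: eq_Rintegral => x _; rewrite mul_conjc.
rewrite (@eq_Rintegral _ _ _ mu D (fun=> 0)); first by rewrite Rintegral_cst// mul0r.
by move=> x _; rewrite mul_conjc.
Qed.

Lemma ip_suml D I (s : seq I) (F : I -> T -> R[i]) w : measurable D ->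
  (forall i, sqint D (F i)) -> sqint D w ->
  ip D (fun x => \sum_(i <- s) F i x) w = \sum_(i <- s) ip D (F i) w.
Proof.
move=> mD sF sw; elim: s => [|i s IH].
  rewrite big_nil /ip -[RHS](cint0 mu mD).
  by apply: eq_cint => x _; rewrite big_nil mul0r.
rewrite big_cons -IH -ipDl//; last exact: sqint_sum.
by apply: eq_cint => x _; rewrite big_cons.
Qed.

Lemma nrm2D D u v : measurable D -> sqint D u -> sqint D v ->
  nrm2 D (fun x => u x + v x) = nrm2 D u + 2 * Re (ip D u v) + nrm2 D v.
Proof.
move=> mD su sv; have [i1 i2] := ip_integrable mD su sv.
have iu := sqint_integrable mD su; have iv := sqint_integrable mD sv.
rewrite /nrm2 /ip /cint /= -RintegralZl// -!RintegralD//.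
- by apply: eq_Rintegral => x _; rewrite !normc_sqr !cReD !cImD !cReM !cRe_conj !cIm_conj; ring.
- by apply: integrableDR => //; exact: integrableZR.
- exact: integrableZR.
Qed.

Lemma nrm2D_le D u v : measurable D -> sqint D u -> sqint D v ->
  nrm2 D (fun x => u x + v x) <= 2 * nrm2 D u + 2 * nrm2 D v.
Proof.
move=> mD su sv; have iu := sqint_integrable mD su; have iv := sqint_integrable mD sv.
rewrite /nrm2 -!RintegralZl// -RintegralD//; try exact: integrableZR.
apply: le_Rintegral => //.
- by apply: sqint_integrable => //; exact: sqintD.
- by apply: integrableDR => //; exact: integrableZR.
- by move=> x _; exact: normc2D.
Qed.

Lemma nrm2Z D c u : measurable D -> sqint D u ->
  nrm2 D (fun x => c * u x) = normc c ^+ 2 * nrm2 D u.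
Proof.
move=> mD su; rewrite /nrm2 -RintegralZl//; last exact: sqint_integrable.
by apply: eq_Rintegral => x _; rewrite normc_mul exprMn.
Qed.

(** A weighted form of the Cauchy-Schwarz inequality; the free weight makes up for
    square roots. *)
Lemma ip_le D u v t : measurable D -> sqint D u -> sqint D v -> 0 < t ->
  normc (ip D u v) <= t * nrm2 D u + t^-1 * nrm2 D v.
Proof.
move=> mD su sv t0.
have iu := sqint_integrable mD su; have iv := sqint_integrable mD sv.
have [i1 i2] := ip_integrable mD su sv.
pose f x := (t * normc (u x) ^+ 2 + t^-1 * normc (v x) ^+ 2) / 2.
have fi : mu.-integrable D (EFin \o f).
  rewrite (_ : f = fun x => 2^-1 * (t * normc (u x) ^+ 2 + t^-1 * normc (v x) ^+ 2)); last first.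
    by apply/funext => x; rewrite /f mulrC.
  by apply: integrableZR => //; apply: integrableDR => //; exact: integrableZR.
have fE : \int[mu]_(x in D) f x = (t * nrm2 D u + t^-1 * nrm2 D v) / 2.
  rewrite (@eq_Rintegral _ _ _ mu D (fun x => 2^-1 * (t * normc (u x) ^+ 2 + t^-1 * normc (v x) ^+ 2))); last first.
    by move=> x _; rewrite /f mulrC.
  rewrite RintegralZl// ?RintegralD// ?RintegralZl//; try exact: integrableZR.
    by rewrite mulrC.
  by apply: integrableDR => //; exact: integrableZR.
have B (g : T -> R) : mu.-integrable D (EFin \o g) -> (forall x, D x -> `|g x| <= f x) ->
    `|\int[mu]_(x in D) g x| <= (t * nrm2 D u + t^-1 * nrm2 D v) / 2.
  move=> gi gf; rewrite -fE; apply: (le_trans (le_normr_Rintegral mD gi)).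
  by apply: le_Rintegral => //; exact: integrable_norm.
have le1 x : normc (u x * conjc (v x)) <= f x.
  by rewrite normc_mul normc_conj; exact: normc_mul_le.
apply: (le_trans (normc_le_ReIm _)); rewrite /ip /cint /=.
rewrite [leRHS](splitr _); apply: lerD; apply: B => // x _.
- exact: le_trans (normc_Re _) (le1 x).
- exact: le_trans (normc_Im _) (le1 x).
Qed.

Lemma nrm2_unif D u eps : measurable D -> (mu D < +oo)%E -> mfunC D u ->
  (forall x, D x -> normc (u x) <= eps) -> nrm2 D u <= eps ^+ 2 * fine (mu D).
Proof.
move=> mD fD mu_ ue; rewrite -Rintegral_cst//; apply: le_Rintegral => //.
- by apply: sqint_integrable => //; exact: sqint_bounded ue.
- by apply: integrable_bounded => // x _; exact: lexx.
- move=> x Dx; apply: lerXn2r; rewrite ?nnegrE ?normc_ge0 ?ue//.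
  exact: le_trans (normc_ge0 _) (ue _ Dx).
Qed.

Section Orthogonal.
Variables (D : set T) (I : eqType) (m : I -> T -> R[i]).
Hypothesis mD : measurable D.
Hypothesis sm : forall i, sqint D (m i).
Hypothesis orth : forall i j, i != j -> ip D (m i) (m j) = 0.

Lemma nrm2_orth_sum (s : seq I) (a : I -> R[i]) : uniq s ->
  nrm2 D (fun x => \sum_(i <- s) a i * m i x) =
  \sum_(i <- s) normc (a i) ^+ 2 * nrm2 D (m i).
Proof.
have sam i : sqint D (fun x => a i * m i x) by exact: sqintZ.
elim: s => [_|i s IH /= /andP[iNs us]].
  rewrite big_nil /nrm2 (@eq_Rintegral _ _ _ mu D (fun=> 0)) ?Rintegral_cst ?mul0r//.
  by move=> x _; rewrite big_nil ComplexField.Normc.normc0 expr0n.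
rewrite big_cons -IH// (@eq_nrm2 _ _ (fun x => a i * m i x + \sum_(j <- s) a j * m j x)); last first.
  by move=> x _; rewrite big_cons.
have ss : sqint D (fun x => \sum_(j <- s) a j * m j x).
  exact: (@sqint_sum D I s (fun j x => a j * m j x)).
rewrite nrm2D// nrm2Z// ipC// (@ip_suml D I s (fun j x => a j * m j x))//.
rewrite big1_seq ?conjc0 ?mulr0 ?addr0// => j /= js.
rewrite ipZl// ipZr// orth ?mulr0//.
by apply: contraNneq iNs => <-.
Qed.

(** Bessel's inequality up to a factor 2, for a uniform limit [G] of orthogonal sums.
    The factor comes from the crude bound [nrm2D_le], and the error is absorbed by
    letting the uniform distance tend to 0. *)
Lemma bessel2 (G : T -> R[i]) (a : I -> R[i]) (S : nat -> seq I) (s : seq I) :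
  (mu D < +oo)%E -> sqint D G -> (forall n, uniq (S n)) -> uniq s ->
  (exists N0, forall N, (N0 <= N)%N -> {subset s <= S N}) ->
  (forall e, 0 < e -> exists N0, forall N, (N0 <= N)%N -> forall x, D x ->
    normc (G x - \sum_(i <- S N) a i * m i x) <= e) ->
  \sum_(i <- s) normc (a i) ^+ 2 * nrm2 D (m i) <= 2 * nrm2 D G.
Proof.
move=> fD sG uS us [N1 N1P] H.
have K0 : 0 <= fine (mu D) by exact: fine_ge0.
apply/ler_addgt0Pr => e e0.
(* The square of [e'] times [2 * mu D] is at most [e]; adding 1 covers the case of a null [D]. *)
pose e' := Num.sqrt (e / (2 * (fine (mu D) + 1))).
have K1 : 0 < 2 * (fine (mu D) + 1) by rewrite mulr_gt0// ltr_pwDr.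
have e'0 : 0 < e' by rewrite sqrtr_gt0 divr_gt0.
have [N0 N0P] := H _ e'0.
pose N := maxn N0 N1.
have sub := N1P N (leq_maxr _ _); have close := N0P N (leq_maxl _ _).
pose P x := \sum_(i <- S N) a i * m i x.
have sP : sqint D P.
  by apply: (@sqint_sum D I (S N) (fun i x => a i * m i x)) => // i; exact: sqintZ.
have le1 : \sum_(i <- s) normc (a i) ^+ 2 * nrm2 D (m i) <= nrm2 D P.
  rewrite nrm2_orth_sum//.
  have perm : perm_eq ([seq i <- S N | i \in s]) s.
    apply: uniq_perm => //; first exact: filter_uniq.
    by move=> i; rewrite mem_filter andb_idr//; exact: sub.
  rewrite -(perm_big _ perm) /= big_filter [leRHS](bigID (fun i => i \in s)) /= lerDl.
  by apply: sumr_ge0 => i _; rewrite mulr_ge0 ?sqr_ge0 ?nrm2_ge0.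
apply: (le_trans le1).
pose E x := P x - G x.
have sE : sqint D E by exact: sqintB.
rewrite (@eq_nrm2 _ _ (fun x => G x + E x)); last by move=> x _; rewrite /E addrC subrK.
apply: (le_trans (nrm2D_le mD sG sE)); rewrite lerD2l.
apply: (@le_trans _ _ (2 * (e' ^+ 2 * fine (mu D)))).
  rewrite ler_pM2l//; apply: nrm2_unif => //; first exact: sE.1.
  by move=> x Dx; rewrite /E normc_distC; exact: close.
rewrite sqr_sqrtr; last by apply: divr_ge0; exact: ltW.
rewrite [leLHS](_ : _ = e * (fine (mu D) / (fine (mu D) + 1))); last by field; rewrite gt_eqF// ltr_pwDr.
by rewrite ger_pMr// ler_pdivrMr ?ltr_pwDr// mul1r lerDl.
Qed.

End Orthogonal.

Lemma fatou_nrm2 D (u : nat -> T -> R[i]) (v : T -> R[i]) (K : R) : measurable D ->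
  (forall n, sqint D (u n)) -> mfunC D v ->
  (forall x, D x -> forall e, 0 < e -> exists N0, forall N, (N0 <= N)%N -> normc (v x - u N x) <= e) ->
  (exists N0, forall N, (N0 <= N)%N -> nrm2 D (u N) <= K) ->
  sqint D v /\ nrm2 D v <= K.
Proof.
move=> mD su mv uv [N1 N1P].
pose f n x := ((normc (u (n + N1)%N x) ^+ 2)%:E).
have key : (\int[mu]_(x in D) (normc (v x) ^+ 2)%:E <= K%:E)%E.
  have mf n : measurable_fun D (f n).
    by apply/measurable_EFinP; apply: mfunC_normc2; exact: (su _).1.
  have f0 n x : D x -> (0 <= f n x)%E by move=> _; rewrite lee_fin sqr_ge0.
  have := fatou mu mD mf f0.
  rewrite (eq_integral (fun x => (normc (v x) ^+ 2)%:E)); last first.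
    move=> x; rewrite inE => Dx.
    have cn : normc (u (n + N1)%N x) @[n --> \oo] --> normc (v x).
      rewrite (cvg_shiftn N1 (fun n => normc (u n x))).
      apply/cvgrPdist_le => e e0; have [N0 NP] := uv x Dx e e0.
      exists N0 => // n /NP; apply: le_trans; exact: normc_dist_dist.
    have /cvg_limn_einf_sup[-> _] // : f n x @[n --> \oo] --> (normc (v x) ^+ 2)%:E.
    apply: cvg_EFin; first exact: nearW.
    have -> : fine \o f^~ x = (fun n => normc (u (n + N1)%N x) * normc (u (n + N1)%N x)).
      by apply/funext => n /=; rewrite expr2.
    by rewrite expr2; exact: (cvgM cn cn).
  move=> F; apply: (le_trans F); rewrite limn_einf_lim; apply: lime_le.
    exact: is_cvg_einfs.
  apply: nearW => n; apply: le_trans (_ : _ <= \int[mu]_(x in D) f n x)%E _.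
    by apply: ereal_inf_lbound; exists n => /=.
  by rewrite -nrm2E// lee_fin; apply: N1P; exact: leq_addl.
have sv : sqint D v by split => //; exact: le_lt_trans key (ltry _).
by split => //; rewrite -lee_fin nrm2E.
Qed.

End SquareIntegrable.

(** * Power series in one square integrable function *)

Section RadialModel.
Context d (T : measurableType d) (R : realType).
Variable mu : {measure set T -> \bar R}.
Variables (D : set T) (F : T -> R[i]) (B : R).
Hypotheses (mD : measurable D) (fD : (mu D < +oo)%E) (mF : mfunC D F).
Hypothesis F_lt : forall x, D x -> normc (F x) < B.
Let Ds s := D `&` [set x | normc (F x) < s].
Hypothesis orth : forall s m n, m != n ->
  ip mu (Ds s) (fun x => F x ^+ m) (fun x => F x ^+ n) = 0.
Implicit Types (a : nat -> R[i]) (G : T -> R[i]).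

Let mDs s : measurable (Ds s).
Proof.
have H := measurable_fun_ltr (mfunC_normc mF) (@measurable_cst _ _ _ _ D s).
rewrite (_ : Ds s = D `&` (fun x => normc (F x) < s) @^-1` [set true]); first exact: H.
by apply/seteqP; split => x.
Qed.

Let DsB : Ds B = D.
Proof. by apply/seteqP; split => [x []//|x Dx]; split => //=; exact: F_lt. Qed.

Let DsD s : Ds s `<=` D. Proof. by move=> x []. Qed.

Let fDs s : (mu (Ds s) < +oo)%E.
Proof.
apply: le_lt_trans fD; apply: le_measure; rewrite ?inE; [exact: mDs|exact: mD|].
exact: DsD.
Qed.

Local Notation c := (fun n => nrm2 mu D (fun x => F x ^+ n)).

Let sF n : sqint mu D (fun x => F x ^+ n).
Proof.
apply: (@sqint_bounded _ _ _ _ _ _ (B ^+ n)) => //; first exact: mfunC_exp.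
move=> x Dx; rewrite normc_exp; apply: lerXn2r; rewrite ?nnegrE ?normc_ge0//.
  by apply: le_trans (normc_ge0 (F x)) _; exact/ltW/F_lt.
exact/ltW/F_lt.
Qed.

Let sFs s n : sqint mu (Ds s) (fun x => F x ^+ n).
Proof. exact: (sqintS (mDs s) mD (@DsD s)). Qed.

Let psum a N x := \sum_(n <- iota 0 N) a n * F x ^+ n.

Let psumE a N x : psum a N x = \sum_(n < N) a n * F x ^+ n.
Proof. by rewrite /psum -(subn0 N) -/(index_iota 0 N) big_mkord subn0. Qed.

Let spsum a N : sqint mu D (psum a N).
Proof.
by apply: (@sqint_sum _ _ _ _ D nat (iota 0 N) (fun n x => a n * F x ^+ n)) => // n; exact: sqintZ.
Qed.

Let orthD m n : m != n -> ip mu D (fun x => F x ^+ m) (fun x => F x ^+ n) = 0.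
Proof. by move=> mn; rewrite -DsB orth. Qed.

Let psum_nrm s a N : nrm2 mu (Ds s) (psum a N) =
  \sum_(n <- iota 0 N) normc (a n) ^+ 2 * nrm2 mu (Ds s) (fun x => F x ^+ n).
Proof. exact: (nrm2_orth_sum (mDs s) (sFs s) (@orth s) a (iota_uniq 0 N)). Qed.

(** The series converges uniformly only on the sublevel sets of the modulus of [F]
    below [B]: the inequality holds on each, and passes to their union [D] by
    monotone convergence. *)
Lemma radial_bessel G a N : power_bounded B a ->
  (forall x, D x -> csums (fun n => a n * F x ^+ n) (G x)) -> sqint mu D G ->
  \sum_(n < N) normc (a n) ^+ 2 * c n <= 2 * nrm2 mu D G.
Proof.
move=> pb aG sG.
have step s : s < B -> nrm2 mu (Ds s) (psum a N) <= 2 * nrm2 mu D G.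
  move=> sB; have [s0|s0] := leP s 0.
    rewrite /nrm2 (_ : Ds s = set0) ?Rintegral_set0 ?mulr_ge0 ?nrm2_ge0//.
    apply/seteqP; split => // x [_ /=]; rewrite ltNge => /negP; apply.
    exact: le_trans s0 (normc_ge0 _).
  apply: (@le_trans _ _ (2 * nrm2 mu (Ds s) G)); last first.
    by rewrite ler_pM2l//; exact: (nrm2S (mDs s) mD (@DsD s) sG).
  rewrite psum_nrm.
  apply: (@bessel2 _ _ _ mu (Ds s) _ _ (mDs s) (sFs s) (@orth s) _ _ (iota 0)) => //.
  - exact: sqintS sG.
  - by move=> n; exact: iota_uniq.
  - exact: iota_uniq.
  - by exists N => M NM n; rewrite !mem_iota /= !add0n => /leq_trans; apply.
  have [K [q [q0 q1 KP]]] := power_bounded_geom pb (ltW s0) sB.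
  move=> e e0; have [N0 NP] := geometric_small (K / (1 - q)) q0 q1 e0.
  exists N0 => M NM x [Dx /= Fs]; rewrite -/(psum a M x) psumE.
  apply: le_trans (ltW (NP M NM)).
  have -> : K / (1 - q) * q ^+ M = K * (q ^+ M / (1 - q)) by rewrite mulrAC mulrA.
  apply: (@csums_tail _ (fun n => a n * F x ^+ n) (G x) K q M q0 q1 _ (aG x Dx)).
  move=> n; rewrite normc_mul normc_exp; apply: le_trans (KP n).
  apply: ler_wpM2l; first exact: normc_ge0.
  by apply: lerXn2r; rewrite ?nnegrE ?normc_ge0// ltW.
have -> : \sum_(n < N) normc (a n) ^+ 2 * c n = nrm2 mu D (psum a N).
  rewrite -[in RHS]DsB psum_nrm DsB.
  by rewrite -[N in iota 0 N]subn0 -/(index_iota 0 N) big_mkord.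
pose E k := Ds (B - k.+1%:R^-1).
have EU : \bigcup_k E k = D.
  apply/seteqP; split => [x [k _ []]//|x Dx].
  have [k kP] := ltr_add_invr (F_lt Dx).
  by exists k => //; split => //=; rewrite ltrBrDr.
have mp : measurable_fun D (fun x => (normc (psum a N x) ^+ 2)%:E).
  by apply/measurable_EFinP; apply: mfunC_normc2; exact: (spsum a N).1.
have := @ge0_nondecreasing_set_cvg_integral _ _ _ E (fun x => (normc (psum a N x) ^+ 2)%:E) mu.
rewrite EU => H.
have {}H : (\int[mu]_(x in E i) (normc (psum a N x) ^+ 2)%:E @[i --> \oo] -->
    \int[mu]_(x in D) (normc (psum a N x) ^+ 2)%:E)%E.
  apply: H.
  - move=> n m nm; apply/subsetPset => x [Dx /= xn]; split => //=.
    by apply: (lt_le_trans xn); rewrite lerD2l lerN2 lef_pV2 ?posrE// ler_nat.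
  - by move=> i; exact: mDs.
  - by move=> i; apply: measurable_funS mp => //; exact: DsD.
  - by move=> i x _; rewrite lee_fin sqr_ge0.
rewrite -lee_fin (nrm2E mD (spsum a N)) -(cvg_lim _ H)//; apply: lime_le.
  by apply/cvg_ex; eexists; exact: H.
apply: nearW => n; rewrite -(nrm2E (mDs _)).
  by rewrite lee_fin step// gtrBl invr_gt0.
exact: (sqintS (mDs _) mD (@DsD _)).
Qed.

(** The partial sums are a Cauchy sequence in norm that converges pointwise to [G];
    Fatou's lemma bounds the distance of [G] to them. *)
Lemma radial_converse G a K : mfunC D G ->
  (forall x, D x -> csums (fun n => a n * F x ^+ n) (G x)) ->
  (forall N, \sum_(n < N) normc (a n) ^+ 2 * c n <= K) ->
  sqint mu D G /\ forall e, 0 < e -> exists N0, forall N, (N0 <= N)%N ->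
    nrm2 mu D (fun x => G x - \sum_(n < N) a n * F x ^+ n) <= e.
Proof.
move=> mG aG aK.
pose t n := normc (a n) ^+ 2 * c n.
have t0 n : 0 <= t n by rewrite mulr_ge0 ?sqr_ge0 ?nrm2_ge0.
have tail e : 0 < e -> exists N0, forall N M, (N0 <= N)%N -> (N <= M)%N ->
    \sum_(N <= n < M) t n <= e.
  move=> e0.
  have : cvgn (series t).
    apply: nondecreasing_is_cvgn.
      by apply/nondecreasing_seqP => n; rewrite /series /= big_nat_recr//= lerDl.
    by exists K => _ [n _ <-]; rewrite /series /= big_mkord; exact: aK.
  move=> /cvg_cauchy/cauchy_seriesP/(_ e e0)[[A1 A2] /= [[N1 _ h1] [N2 _ h2]] H].
  exists (maxn N1 N2) => N M; rewrite geq_max => /andP[n1 n2] NM.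
  have := H (N, M); rewrite /= => /(_ _)/ltW; rewrite ger0_norm ?sumr_ge0//; apply.
  by split; [exact: h1|apply: h2; exact: leq_trans NM].
have diffE N M x : (N <= M)%N -> psum a M x - psum a N x = \sum_(n <- index_iota N M) a n * F x ^+ n.
  move=> NM; rewrite !psumE.
  have -> : \sum_(n < M) a n * F x ^+ n = \sum_(n < N) a n * F x ^+ n + \sum_(N <= n < M) a n * F x ^+ n.
    by rewrite -!(big_mkord xpredT (fun n => a n * F x ^+ n)) -big_cat_nat.
  by rewrite addrC addKr.
have diff_nrm N M : (N <= M)%N ->
    nrm2 mu D (fun x => psum a M x - psum a N x) = \sum_(N <= n < M) t n.
  move=> NM; rewrite (@eq_nrm2 _ _ _ _ _ _ (fun x => \sum_(n <- index_iota N M) a n * F x ^+ n)).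
    exact: (nrm2_orth_sum mD sF orthD a (iota_uniq N (M - N))).
  by move=> x _; exact: diffE.
have close e : 0 < e -> exists N0, forall N, (N0 <= N)%N ->
    sqint mu D (fun x => G x - psum a N x) /\ nrm2 mu D (fun x => G x - psum a N x) <= e.
  move=> e0; have [N0 N0P] := tail e e0; exists N0 => N NN.
  apply: (@fatou_nrm2 _ _ _ _ _ (fun M x => psum a M x - psum a N x)) => //.
  - by move=> M; exact: sqintB.
  - by apply: mfunCB => //; exact: (spsum a N).1.
  - move=> x Dx e' e'0; have [N1 N1P] := aG x Dx e' e'0; exists N1 => M /N1P.
    by rewrite -psumE opprB addrA subrK.
  - by exists N => M NM; rewrite diff_nrm//; exact: N0P.
split; last first.
  move=> e e0; have [N0 N0P] := close e e0; exists N0 => N /N0P[_].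
  by under eq_fun do rewrite psumE.
have [N0 /(_ N0 (leqnn _))[s1 _]] := close 1 ltr01.
rewrite (_ : G = fun x => (G x - psum a N0 x) + psum a N0 x); first exact: sqintD.
by apply/funext => x; rewrite subrK.
Qed.

(** Convergence to 0 in norm implies weak convergence, tested on a number that the inner
    products dominate. *)
Lemma ip_vanish (u : nat -> T -> R[i]) w (z : R[i]) : (forall n, sqint mu D (u n)) ->
  sqint mu D w ->
  (forall e, 0 < e -> exists N0, forall N, (N0 <= N)%N -> nrm2 mu D (u N) <= e) ->
  (exists N0, forall N, (N0 <= N)%N -> normc z <= normc (ip mu D (u N) w)) -> z = 0.
Proof.
move=> su sw u0 [N1 N1P]; apply/eqP; rewrite -normc_eq0 eq_le normc_ge0 andbT.
apply/ler_addgt0Pr => e e0; rewrite add0r.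
(* With this weight the second term of [ip_le] is at most [e / 2]. *)
pose t := (nrm2 mu D w + 1) / (e / 2).
have w0 : 0 < nrm2 mu D w + 1 by rewrite ltr_pwDr// nrm2_ge0.
have t0 : 0 < t by rewrite divr_gt0// divr_gt0.
have e2 : 0 < e / 2 / t by rewrite !divr_gt0.
have [N0 N0P] := u0 _ e2.
apply: (le_trans (N1P _ (leq_maxr N0 N1))).
apply: (le_trans (ip_le mD (su _) sw t0)); rewrite (splitr e) lerD//.
  by rewrite mulrC -ler_pdivlMr//; apply: N0P; exact: leq_maxl.
rewrite /t invfM invrK mulrAC ger_pMl ?divr_gt0//.
by rewrite mulrC ler_pdivrMr// mul1r lerDl.
Qed.

Lemma radial_coef G a n : sqint mu D G ->
  (forall e, 0 < e -> exists N0, forall N, (N0 <= N)%N ->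
    nrm2 mu D (fun x => G x - \sum_(n < N) a n * F x ^+ n) <= e) ->
  ip mu D G (fun x => F x ^+ n) = a n * (c n)%:C.
Proof.
move=> sG H; apply/eqP; rewrite -subr_eq0; apply/eqP.
apply: (@ip_vanish (fun N x => G x - psum a N x) (fun x => F x ^+ n)) => //.
- by move=> N; exact: sqintB.
- move=> e e0; have [N0 N0P] := H e e0; exists N0 => N /N0P.
  by under eq_fun do rewrite -psumE.
exists n.+1 => N nN; rewrite le_eqVlt; apply/orP; left; apply/eqP; congr normc.
rewrite ipBl//; congr (_ - _).
rewrite (@ip_suml _ _ _ _ D nat (iota 0 N) (fun n x => a n * F x ^+ n))//; last first.
  by move=> i; exact: sqintZ.
rewrite (bigD1_seq n) ?iota_uniq ?mem_iota//= big1_seq ?addr0.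
  by rewrite ipZl// ip_self.
by move=> i /andP[i_n _]; rewrite ipZl// orthD ?mulr0.
Qed.

Lemma radial_total H G a : sqint mu D H -> sqint mu D G ->
  (forall e, 0 < e -> exists N0, forall N, (N0 <= N)%N ->
    nrm2 mu D (fun x => G x - \sum_(n < N) a n * F x ^+ n) <= e) ->
  (forall n, ip mu D H (fun x => F x ^+ n) = 0) -> ip mu D H G = 0.
Proof.
move=> sH sG cl H0; rewrite ipC// (_ : ip mu D G H = 0) ?conjc0//.
apply: (@ip_vanish (fun N x => G x - psum a N x) H) => //.
- by move=> N; exact: sqintB.
- move=> e e0; have [N0 N0P] := cl e e0; exists N0 => N /N0P.
  by under eq_fun do rewrite -psumE.
exists 0%N => N _; rewrite ipBl// (_ : ip mu D (psum a N) H = 0) ?subr0//.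
rewrite (@ip_suml _ _ _ _ D nat (iota 0 N) (fun n x => a n * F x ^+ n))//; last first.
  by move=> i; exact: sqintZ.
rewrite big1_seq// => i _; rewrite ipZl// ipC// H0 conjc0 mulr0 //.
Qed.

(** * The Hankel operator on power series in one function *)

Hypothesis c_gt0 : forall n, 0 < c n.
Hypothesis B_gt0 : 0 < B.
Definition radial_expansion a G := [/\ power_bounded B a, sqint mu D G &
  forall x, D x -> csums (fun n => a n * F x ^+ n) (G x)].

(** Abstract counterpart of the Bergman space: square integrable sums of power series in
    [F]. *)
Definition radial G := exists a, radial_expansion a G.

Definition converges_mean a G := forall e, 0 < e -> exists N0, forall N, (N0 <= N)%N ->
  nrm2 mu D (fun x => G x - \sum_(n < N) a n * F x ^+ n) <= e.

Lemma radial_converges_mean a G : radial_expansion a G -> converges_mean a G.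
Proof.
move=> [pb sG aG].
have H N := @radial_bessel G a N pb aG sG.
by have [] := @radial_converse G a _ sG.1 aG H.
Qed.

Lemma radial_ip_powers H : sqint mu D H -> (forall n, ip mu D H (fun x => F x ^+ n) = 0) ->
  forall G, radial G -> ip mu D H G = 0.
Proof.
move=> sH H0 G [a aG]; have [_ sG _] := aG.
exact: (@radial_total H G a sH sG (radial_converges_mean aG) H0).
Qed.

Lemma sqint_conj_mul G : sqint mu D G -> sqint mu D (fun x => conjc (F x) * G x) /\
  nrm2 mu D (fun x => conjc (F x) * G x) <= B ^+ 2 * nrm2 mu D G.
Proof.
move=> sG; have iG := sqint_integrable mD sG.
have le1 x : D x -> normc (conjc (F x) * G x) ^+ 2 <= B ^+ 2 * normc (G x) ^+ 2.
  move=> Dx; rewrite normc_mul normc_conj exprMn ler_wpM2r ?sqr_ge0//.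
  by apply: lerXn2r; rewrite ?nnegrE ?normc_ge0// ltW// F_lt.
have si : sqint mu D (fun x => conjc (F x) * G x).
  apply: (@le_sqint _ _ _ mu D _ (fun x => B ^+ 2 * normc (G x) ^+ 2)) => //.
  - by apply: mfunCM; [exact: mfunCJ|exact: sG.1].
  - exact: integrableZR.
split => //; rewrite /nrm2 -RintegralZl//; apply: le_Rintegral => //.
- exact: (sqint_integrable mD si).
- exact: integrableZR.
Qed.

Lemma ip_conj_mul G n : ip mu D (fun x => conjc (F x) * G x) (fun x => F x ^+ n) =
  ip mu D G (fun x => F x ^+ n.+1).
Proof.
apply: eq_cint => x _; rewrite exprS.
have -> : conjc (F x * F x ^+ n) = conjc (F x) * conjc (F x ^+ n) by rewrite rmorphM.
by rewrite mulrCA mulrA.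
Qed.

Lemma nrm2_conj_mul_pow n :
  nrm2 mu D (fun x => conjc (F x) * F x ^+ n) = c n.+1.
Proof. by apply: eq_Rintegral => x _; rewrite [F x ^+ n.+1]exprS !normc_mul normc_conj. Qed.

Lemma moment_ratio_le n : c n.+1 / c n <= B ^+ 2.
Proof. by rewrite ler_pdivrMr// -nrm2_conj_mul_pow; exact: (sqint_conj_mul (sF n)).2. Qed.

(** Coefficients of the projection of [F^* * \sum_n a n * F ^+ n]. *)
Definition shifted_coef a n : R[i] := (c n.+1 / c n)%:C * a n.+1.

Lemma shifted_coef_bounded a : power_bounded B a -> power_bounded B (shifted_coef a).
Proof.
move=> pb s s0 sB; have [K KP] := pb s s0 sB.
exists (B ^+ 2 / s * K) => n; rewrite normc_mul normc_real ger0_norm; last first.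
  by apply: divr_ge0; exact: nrm2_ge0.
rewrite -[_ * _ * s ^+ n]mulrA.
have -> : normc (a n.+1) * s ^+ n = s^-1 * (normc (a n.+1) * s ^+ n.+1).
  by rewrite exprS; field; rewrite gt_eqF.
rewrite -[B ^+ 2 / s * K]mulrA; apply: ler_pM.
- by apply: divr_ge0; exact: nrm2_ge0.
- apply: mulr_ge0; first by rewrite invr_ge0 ltW.
  by apply: mulr_ge0; [exact: normc_ge0|apply: exprn_ge0; exact: ltW].
- exact: moment_ratio_le.
- by apply: ler_wpM2l; [rewrite invr_ge0 ltW|exact: KP].
Qed.

Lemma shifted_coef_sum a G N : radial_expansion a G ->
  \sum_(n < N) normc (shifted_coef a n) ^+ 2 * c n <= B ^+ 2 * (2 * nrm2 mu D G).
Proof.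
move=> [pb sG aG].
have H := @radial_bessel G a N.+1 pb aG sG.
have B2 : 0 <= B ^+ 2 by exact: sqr_ge0.
apply: le_trans (ler_wpM2l B2 H); rewrite big_ord_recl /= mulrDr.
apply: (@le_trans _ _ (B ^+ 2 * \sum_(i < N) normc (a i.+1) ^+ 2 * c i.+1)); last first.
  by rewrite lerDr; apply: mulr_ge0 => //; apply: mulr_ge0; [exact: sqr_ge0|exact: nrm2_ge0].
rewrite mulr_sumr; apply: ler_sum => i _.
rewrite normc_mul normc_real ger0_norm; last by apply: divr_ge0; exact: nrm2_ge0.
have -> : (c i.+1 / c i * normc (a i.+1)) ^+ 2 * c i =
    c i.+1 / c i * (normc (a i.+1) ^+ 2 * c i.+1).
  by field; rewrite gt_eqF.
apply: ler_wpM2r; last exact: moment_ratio_le.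
by apply: mulr_ge0; [exact: sqr_ge0|exact: nrm2_ge0].
Qed.

(** Multiplication by [F^*] is adjoint to multiplication by [F], which turns [F ^+ n]
    into [F ^+ n.+1]: both functions have the same inner product with each [F ^+ n]. *)
Lemma shifted_projection a G P : radial_expansion a G -> mfunC D P ->
  (forall x, D x -> csums (fun n => shifted_coef a n * F x ^+ n) (P x)) ->
  radial P /\ forall G1, radial G1 -> ip mu D (fun x => conjc (F x) * G x - P x) G1 = 0.
Proof.
move=> aG mP cP; have [pb sG cG] := aG.
have [sP clP] := @radial_converse P (shifted_coef a) _ mP cP
  (fun N => shifted_coef_sum N aG).
split; first by exists (shifted_coef a); split => //; exact: shifted_coef_bounded.
have [sh _] := sqint_conj_mul sG.
apply: radial_ip_powers; first exact: sqintB.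
move=> n; rewrite (ipBl mD sh sP (sF n)) ip_conj_mul.
rewrite (@radial_coef G a n.+1 sG (radial_converges_mean aG)).
rewrite (@radial_coef P _ n sP clP) /shifted_coef.
apply/eqP; rewrite subr_eq0 mulrAC -rmorphM /= divfK; first by rewrite mulrC.
exact: lt0r_neq0.
Qed.

Lemma best_approximation h P Q : sqint mu D h -> sqint mu D P -> sqint mu D Q ->
  ip mu D (fun x => h x - P x) P = 0 -> ip mu D (fun x => h x - P x) Q = 0 ->
  nrm2 mu D (fun x => h x - P x) <= nrm2 mu D (fun x => h x - Q x).
Proof.
move=> sh sP sQ eP eQ.
have shP : sqint mu D (fun x => h x - P x) by exact: sqintB.
have sPQ : sqint mu D (fun x => P x - Q x) by exact: sqintB.
rewrite (@eq_nrm2 _ _ _ mu D (fun x => h x - Q x) (fun x => (h x - P x) + (P x - Q x))); last first.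
  by move=> x _; rewrite addrA subrK.
rewrite (nrm2D mD shP sPQ) (ipBr mD sP sQ shP) eP eQ subrr /= mulr0 addr0 lerDl.
exact: nrm2_ge0.
Qed.

Lemma zero_expansion : radial_expansion (fun=> 0) (fun=> 0).
Proof.
split.
- by move=> s s0 sB; exists 0 => n; rewrite ComplexField.Normc.normc0 mul0r.
- apply: (@sqint_bounded _ _ _ mu D _ 0 mD fD); first exact: mfunC_cst.
  by move=> x _; rewrite ComplexField.Normc.normc0.
- move=> x _ e e0; exists 0%N => N _.
  rewrite big1; first by rewrite subrr ComplexField.Normc.normc0 ltW.
  by move=> i _; rewrite mul0r.
Qed.

Lemma radial_pow (b : R[i]) m : radial (fun x => b * F x ^+ m).
Proof.
exists (fun n => if n == m then b else 0); split.
- move=> s s0 sB; exists (normc b * s ^+ m) => n; case: eqP => [->//|_].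
  rewrite ComplexField.Normc.normc0 mul0r; apply: mulr_ge0; first exact: normc_ge0.
  by apply: exprn_ge0; exact: ltW.
- exact: sqintZ.
- move=> x _ e e0; exists m.+1 => N mN.
  rewrite (bigD1 (Ordinal mN)) //= eqxx big1; first by rewrite addr0 subrr ComplexField.Normc.normc0 ltW.
  by move=> i; rewrite -val_eqE /= => /negPf ->; rewrite mul0r.
Qed.

(** The ratio of the moments of order [n] and [n.-1], with the convention 0 for [n = 0].
    *)
Definition moment_ratio n : R := if n is m.+1 then c m.+1 / c m else 0.

(** [best_approximation] compares the projection with the multiple of [F ^+ n.-1] that is
    closest to the function, or with 0 if [n = 0]. *)
Lemma projection_defect_le n (r : R) P : r ^+ 2 * c n = 1 ->
  sqint mu D P ->
  (forall G1, radial G1 ->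
    ip mu D (fun x => conjc (F x) * (r%:C * F x ^+ n) - P x) G1 = 0) ->
  radial P ->
  nrm2 mu D (fun x => conjc (F x) * (r%:C * F x ^+ n) - P x) <=
  moment_ratio n.+1 - moment_ratio n.
Proof.
move=> rc sP oP radP.
have cn := c_gt0 n.
have r2 : r ^+ 2 = (c n)^-1 by apply: (mulIf (lt0r_neq0 cn)); rewrite rc mulVf// lt0r_neq0.
have su : sqint mu D (fun x => conjc (F x) * F x ^+ n) := (sqint_conj_mul (sF n)).1.
have sh : sqint mu D (fun x => conjc (F x) * (r%:C * F x ^+ n)).
  by apply: (sqint_conj_mul _).1; exact: sqintZ.
have best b m := best_approximation sh sP (sqintZ b mD (sF m)) (oP _ radP) (oP _ (radial_pow b m)).
have nr : normc r%:C ^+ 2 = (c n)^-1 by rewrite normc_real real_normK ?num_real// r2.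
case: n rc cn r2 su sh best nr {oP} => [|n] rc cn r2 su sh best nr.
  apply: (le_trans (best 0 0%N)); rewrite /moment_ratio subr0.
  rewrite (@eq_nrm2 _ _ _ mu D _ (fun x => r%:C * (conjc (F x) * F x ^+ 0))); last first.
    by move=> x _; rewrite mul0r subr0 mulrCA.
  by rewrite (nrm2Z _ mD su) nrm2_conj_mul_pow nr mulrC.
have cm := c_gt0 n.
pose be := c n.+1 / c n.
apply: (le_trans (best (r%:C * be%:C) n)).
rewrite (@eq_nrm2 _ _ _ mu D _ (fun x => r%:C *
    (conjc (F x) * F x ^+ n.+1 + (- be%:C) * F x ^+ n))); last first.
  by move=> x _; rewrite mulNr mulrBr mulrCA (mulrA r%:C be%:C).
have sb : sqint mu D (fun x => (- be%:C) * F x ^+ n) by exact: sqintZ.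
rewrite (nrm2Z _ mD (sqintD mD su sb : sqint mu D (fun x => _ + _))) (nrm2D mD su sb) (ipZr _ mD (sF n) su) ip_conj_mul.
rewrite (ip_self mD (sF n.+1)) nrm2_conj_mul_pow (nrm2Z _ mD (sF n)) nr normc_opp normc_real.
rewrite real_normK ?num_real//.
have -> : complex.Re (conjc (- be%:C) * (c n.+1)%:C) = - be * c n.+1.
  by rewrite cReM /= oppr0 mulr0 subr0.
rewrite /moment_ratio le_eqVlt; apply/orP; left; apply/eqP; rewrite /be.
by field; rewrite !gt_eqF.
Qed.

Lemma moment_ratio_telescope N : \sum_(n < N) (moment_ratio n.+1 - moment_ratio n) <= B ^+ 2.
Proof.
rewrite -(big_mkord xpredT (fun n => moment_ratio n.+1 - moment_ratio n)) telescope_sumr//.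
case: N => [|N]; rewrite /moment_ratio subr0; first exact: sqr_ge0.
exact: moment_ratio_le.
Qed.

(** [F^*] is orthogonal to every [F ^+ n], as [F ^+ 0] is orthogonal to [F ^+ n.+1]. *)
Lemma conj_not_radial P : radial P -> 0 < nrm2 mu D (fun x => conjc (F x) - P x).
Proof.
move=> radP; have [a [_ sP _]] := radP.
have [s1 _] := sqint_conj_mul (sF 0).
have sJ : sqint mu D (fun x => conjc (F x)).
  by apply: (eq_sqint _ s1) => x _; rewrite mulr1.
have jE : {in D, (fun x => conjc (F x)) =1 (fun x => conjc (F x) * F x ^+ 0)}.
  by move=> x _; rewrite mulr1.
have o : ip mu D (fun x => conjc (F x)) P = 0.
  apply: radial_ip_powers radP => // n.
  have -> : ip mu D (fun x => conjc (F x)) (fun x => F x ^+ n) =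
      ip mu D (fun x => conjc (F x) * F x ^+ 0) (fun x => F x ^+ n).
    by apply: eq_cint => x xD; rewrite -jE.
  by rewrite ip_conj_mul orthD.
rewrite (@eq_nrm2 _ _ _ mu D _ (fun x => conjc (F x) + (-1) * P x)); last first.
  by move=> x _; rewrite mulN1r.
rewrite (nrm2D mD sJ (sqintZ _ mD sP)) (ipZr _ mD sP sJ) o mulr0 /= mulr0 addr0.
rewrite (eq_nrm2 _ jE) nrm2_conj_mul_pow; apply: ltr_pwDl => //.
exact: nrm2_ge0.
Qed.

End RadialModel.

(** * Geometry of the domain *)

Section Geometry.
Variable R : realType.
Local Notation RR := (measurableTypeR R).
Local Notation T4 := ((RR * RR) * (RR * RR))%type.
Local Notation leb := (@lebesgue_measure R).
Local Notation leb2 := (@lebesgue2 R).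
Local Notation leb4 := (@lebesgue4 R).
Local Notation e := (expR 1 : R).
Local Notation Om := (@Omega0 R).

Lemma e_gt1 : 1 < e.
Proof. by rewrite expR_gt1. Qed.

Lemma e_gt0 : 0 < e.
Proof. exact: expR_gt0. Qed.

Lemma xlnx_gt (x : R) : e < x -> e < x * ln x.
Proof.
move=> ex; have x0 : 0 < x by exact: lt_trans e_gt0 ex.
have lx : 1 < ln x by rewrite -[1](@expRK R) ltr_ln ?posrE// e_gt0.
by apply: (lt_trans ex); rewrite ltr_pMr.
Qed.

Lemma xlnx_le (x y : R) : e < x -> x <= y -> x * ln x <= y * ln y.
Proof.
move=> ex xy; have x0 : 0 < x by exact: lt_trans e_gt0 ex.
have y0 : 0 < y by exact: lt_le_trans xy.
have lx : 1 < ln x by rewrite -[1](@expRK R) ltr_ln ?posrE// e_gt0.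
apply: ler_pM => //; try exact: ltW.
- by apply/ltW/(lt_trans _ lx).
- by rewrite ler_ln ?posrE.
Qed.

Definition polydisc (r1 r2 : R) : set (C2 R) :=
  [set z | normc z.1 < r1 /\ normc z.2 < r2].

(** Radii of polydiscs contained in the domain, on which Bergman functions are expanded.
    *)
Definition admissible (r1 r2 : R) := polydisc r1 r2 `<=` Om.

Lemma nbhs_polydisc r1 r2 w : polydisc r1 r2 w -> nbhs w (polydisc r1 r2).
Proof.
move=> [h1 h2]; exists ([set z | normc z < r1], [set z | normc z < r2]) => //=; split.
- apply/nbhsCP; exists (r1 - normc w.1); rewrite ?subr_gt0// => z zw /=.
  by rewrite -(subrK w.1 z); apply: (le_lt_trans (normcD _ _)); rewrite -ltrBrDr.
- apply/nbhsCP; exists (r2 - normc w.2); rewrite ?subr_gt0// => z zw /=.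
  by rewrite -(subrK w.2 z); apply: (le_lt_trans (normcD _ _)); rewrite -ltrBrDr.
Qed.

Lemma admissible_interior r1 r2 w : admissible r1 r2 -> polydisc r1 r2 w -> (Om)° w.
Proof. by move=> ad pw; apply: filterS ad _; exact: nbhs_polydisc. Qed.

Lemma admissible_bidisc : admissible e e.
Proof. by move=> z [h1 h2]; right; split; exact: ltW. Qed.

(** The profile [1 / (r * ln r)] decreases, so the polydisc lies below it. *)
Lemma admissible_X1 r : e < r -> admissible r (1 / (r * ln r)).
Proof.
move=> er z [h1 h2]; have [ze|ez] := leP (normc z.1) e.
  right; split => //; apply/ltW/(lt_trans h2).
  have := xlnx_gt er => xl; rewrite div1r -[e]invrK ltf_pV2 ?posrE ?invr_gt0 ?e_gt0//.
    apply: lt_trans xl; apply: lt_trans e_gt1; rewrite invf_lt1 ?e_gt0//; exact: e_gt1.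
  exact: lt_trans e_gt0 xl.
left; left; split => //; apply: (lt_le_trans h2).
rewrite !div1r lef_pV2 ?posrE.
- by apply: xlnx_le => //; exact: ltW.
- by apply: lt_trans (xlnx_gt er); exact: e_gt0.
- by apply: lt_trans (xlnx_gt ez); exact: e_gt0.
Qed.

Lemma Omega0_swap (z : C2 R) : Om z -> Om (z.2, z.1).
Proof. by move=> [[|]|] [h1 h2]; [left; right|left; left|right]. Qed.

Lemma admissible_swap r1 r2 : admissible r1 r2 -> admissible r2 r1.
Proof.
move=> ad z [h1 h2]; rewrite (surjective_pairing z).
by apply: (@Omega0_swap (z.2, z.1)); exact: ad.
Qed.

(** The domain without the points of [X3] on the circles of radius [e]: it is a union of
    polydiscs [OmI_admissible], and what has been removed is a null set
    [boundary_null]. *)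
Definition OmI : set (C2 R) := @X1 R `|` @X2 R `|` polydisc e e.

Lemma OmI_sub : OmI `<=` Om.
Proof. by move=> z [|[h1 h2]]; [left|right; split; exact: ltW]. Qed.

(** The inequality defining [X1] is strict, hence still true for a slightly larger first
    radius. *)
Lemma X1_admissible (z : C2 R) : X1 z -> exists r1 r2, admissible r1 r2 /\ polydisc r1 r2 z.
Proof.
move=> [h1 h2]; set x := normc z.1 in h1 h2; set y := normc z.2 in h2.
have x0 : 0 < x by exact: lt_trans e_gt0 h1.
have xl0 : 0 < x * ln x by exact: lt_trans e_gt0 (xlnx_gt h1).
have cont : {for x, continuous (fun t : R => y * (t * ln t))}.
  by apply: cvgMr; apply: cvgM; [exact: cvg_id|exact: continuous_ln].
have yx : y * (x * ln x) < 1 by move: h2; rewrite ltr_pdivlMr.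
have /nbhs_ballP[d /= d0 dP] : \forall t \near x, y * (t * ln t) < 1.
  exact: (@cvgr_lt _ _ _ _ _ (y * (x * ln x)) cont 1 yx).
pose r := x + d / 2.
have rx : x < r by rewrite ltrDl divr_gt0.
have er : e < r by exact: lt_trans rx.
have rl0 : 0 < r * ln r by exact: lt_trans e_gt0 (xlnx_gt er).
exists r, (1 / (r * ln r)); split; first exact: admissible_X1.
split => //=; rewrite -/y ltr_pdivlMr//.
have : ball x d r.
  rewrite /ball /= /r opprD addrA subrr add0r normrN gtr0_norm ?divr_gt0//.
  by rewrite ltr_pdivrMr// mulr_natr mulr2n ltrDl.
exact: dP.
Qed.

Lemma OmI_admissible (z : C2 R) : OmI z -> exists r1 r2, admissible r1 r2 /\ polydisc r1 r2 z.
Proof.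
move=> [[zX|zX]|zX]; first exact: X1_admissible.
- have [r1 [r2 [h1 [h2 h3]]]] := @X1_admissible (z.2, z.1) zX.
  by exists r2, r1; split; [exact: admissible_swap|split].
- by exists e, e; split; [exact: admissible_bidisc|].
Qed.

Lemma Omega0_f_le (z : C2 R) : Om z -> normc (z.1 * z.2) <= e ^+ 2.
Proof.
have H (x y : R) : 0 <= y -> e < x -> y < 1 / (x * ln x) -> x * y <= e ^+ 2.
  move=> y0 ex; have x0 : 0 < x by exact: lt_trans e_gt0 ex.
  have lx : 1 < ln x by rewrite -[1](@expRK R) ltr_ln ?posrE// e_gt0.
  have l0 : 0 < ln x by exact: lt_trans lx.
  rewrite ltr_pdivlMr ?mulr_gt0// mulrA => h.
  apply: (@le_trans _ _ 1); last by rewrite expr_ge1// ltW// ?e_gt1 ?e_gt0.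
  rewrite mulrC; apply: (@le_trans _ _ (y * x * ln x)); last exact: ltW.
  by rewrite ler_peMr ?mulr_ge0// ltW.
rewrite normc_mul => -[[[h1 h2]|[h1 h2]]|[h1 h2]].
- exact: H (normc_ge0 _) h1 h2.
- by rewrite mulrC; exact: H (normc_ge0 _) h1 h2.
- by rewrite expr2 ler_pM ?normc_ge0.
Qed.

(** Scaling an interior point by [1 + d] stays in the domain and increases the modulus
    of the product. *)
Lemma interior_f_lt (z : C2 R) : (Om)° z -> normc (z.1 * z.2) < e ^+ 2.
Proof.
move=> [[P Q] [/= /nbhsCP[d1 d10 d1P] /nbhsCP[d2 d20 d2P]] PQ].
have e20 : 0 < e ^+ 2 by rewrite exprn_gt0// e_gt0.
have [->|f0] := eqVneq (z.1 * z.2) 0; first by rewrite ComplexField.Normc.normc0.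
pose N := normc z.1 + normc z.2 + 1.
have n1 := normc_ge0 z.1; have n2 := normc_ge0 z.2.
have N0 : 0 < N by rewrite /N; lra.
pose d := Num.min d1 d2 / N.
have d0 : 0 < d by rewrite divr_gt0// lt_min d10.
have H (w : R[i]) : normc w < N -> normc ((1 + d)%:C * w - w) < Num.min d1 d2.
  move=> wN; rewrite -[X in _ - X]mul1r -mulrBl normc_mul.
  rewrite (_ : (1 + d)%:C - 1 = d%:C); last by rewrite rmorphD rmorph1 addrC addKr.
  by rewrite normc_real gtr0_norm// /d mulrAC ltr_pdivrMr// ltr_pM2l// lt_min d10.
have in1 : Om ((1 + d)%:C * z.1, (1 + d)%:C * z.2).
  apply: PQ; split => /=.
  - by apply: d1P; have := H z.1; rewrite lt_min => /(_ _)/andP[]//; rewrite /N; lra.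
  - by apply: d2P; have := H z.2; rewrite lt_min => /(_ _)/andP[]//; rewrite /N; lra.
apply: lt_le_trans (Omega0_f_le in1); rewrite /= mulrACA [ltRHS]normc_mul -rmorphM normc_real.
rewrite gtr0_norm ?mulr_gt0 ?addr_gt0// ltr_pMl ?normc_gt0//.
by move: d0; move: (d) => D D0; nra.
Qed.

Lemma OmI_f_lt (z : C2 R) : OmI z -> normc (z.1 * z.2) < e ^+ 2.
Proof.
move=> /OmI_admissible[r1 [r2 [ad pz]]]; apply: interior_f_lt.
exact: admissible_interior ad pz.
Qed.

Lemma mfunC_z1 D : mfunC D (fun p : T4 => (toC2 p).1).
Proof.
split; apply: measurable_funTS => /=.
- by apply: measurableT_comp.
- by apply: measurableT_comp.
Qed.

Lemma mfunC_z2 D : mfunC D (fun p : T4 => (toC2 p).2).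
Proof.
split; apply: measurable_funTS => /=.
- by apply: measurableT_comp.
- by apply: measurableT_comp.
Qed.

Lemma measurable_lt_set (f g : T4 -> R) : measurable_fun setT f -> measurable_fun setT g ->
  measurable [set p | f p < g p].
Proof.
move=> mf mg; have H := measurable_fun_ltr mf mg.
rewrite (_ : [set _ | _] = setT `&` (fun p => f p < g p) @^-1` [set true]); first exact: H.
by apply/seteqP; split => x //= [].
Qed.

Lemma measurable_le_set (f g : T4 -> R) : measurable_fun setT f -> measurable_fun setT g ->
  measurable [set p | f p <= g p].
Proof.
move=> mf mg; have H := measurable_fun_ler mf mg.
rewrite (_ : [set _ | _] = setT `&` (fun p => f p <= g p) @^-1` [set true]); first exact: H.
by apply/seteqP; split => x //= [].
Qed.

Let n1 (p : T4) : R := normc (toC2 p).1.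
Let n2 (p : T4) : R := normc (toC2 p).2.
Let mn1 : measurable_fun setT n1. Proof. exact/mfunC_normc/mfunC_z1. Qed.
Let mn2 : measurable_fun setT n2. Proof. exact/mfunC_normc/mfunC_z2. Qed.

Lemma measurable_polydisc r1 r2 : measurable (@toC2 R @^-1` polydisc r1 r2).
Proof. by apply: measurableI; apply: measurable_lt_set. Qed.

Let measurable_wing (n m : T4 -> R) : measurable_fun setT n -> measurable_fun setT m ->
  measurable [set p | e < n p /\ m p < 1 / (n p * ln (n p))].
Proof.
move=> mn mm.
rewrite (_ : [set _ | _] = [set p | e < n p] `&` [set p | m p * (n p * ln (n p)) < 1]).
  apply: measurableI; apply: measurable_lt_set => //.
  apply: measurable_funM => //; apply: measurable_funM => //.
  exact: measurableT_comp (@measurable_ln R) mn.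
apply/seteqP; split => p /= [h1]; have x0 := lt_trans e_gt0 (xlnx_gt h1).
  by rewrite ltr_pdivlMr.
by move=> h2; split => //; rewrite ltr_pdivlMr.
Qed.

Lemma measurable_OmI : measurable (@toC2 R @^-1` OmI).
Proof.
apply: measurableU; last exact: measurable_polydisc.
by apply: measurableU; [exact: (measurable_wing mn1 mn2)|exact: (measurable_wing mn2 mn1)].
Qed.

Lemma measurable_Om : measurable (@toC2 R @^-1` Om).
Proof.
apply: measurableU.
  by apply: measurableU; [exact: (measurable_wing mn1 mn2)|exact: (measurable_wing mn2 mn1)].
by apply: measurableI; apply: measurable_le_set.
Qed.

Let measurable_circle (r : R) : measurable [set p : RR * RR | normc (p.1 +i* p.2) = r].
Proof.
have mf : measurable_fun setT (fun p : RR * RR => normc (p.1 +i* p.2)).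
  by apply: mfunC_normc; split => /=; [exact: measurable_fst|exact: measurable_snd].
have := mf measurableT [set r] (measurable_set1 r); rewrite setTI.
by congr measurable.
Qed.

(** Each vertical line meets the circle in at most two points. *)
Let circle_null (r : R) : leb2 [set p : RR * RR | normc (p.1 +i* p.2) = r] = 0%E.
Proof.
rewrite /lebesgue2 /product_measure1 (eq_integral (fun=> 0%E)) ?integral0// => x _.
apply: countable_lebesgue_measure0.
apply: (@sub_countable _ _ _ [set Num.sqrt (r ^+ 2 - x ^+ 2); - Num.sqrt (r ^+ 2 - x ^+ 2)]); last first.
  by apply: finite_set_countable; exact: finite_set2.
apply: subset_card_le => y; rewrite /xsection /= inE /= => H.
have yy : r ^+ 2 - x ^+ 2 = y ^+ 2.
  by rewrite -H sqr_sqrtr ?addr_ge0 ?sqr_ge0// addrC addKr.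
rewrite yy sqrtr_sqr; case: (ger0P y) => _; first by left.
by right; rewrite opprK.
Qed.

Lemma boundary_null : leb4 (@toC2 R @^-1` Om `\` @toC2 R @^-1` OmI) = 0%E.
Proof.
pose c := [set p : RR * RR | normc (p.1 +i* p.2) = e].
have mc : measurable c by exact: measurable_circle.
have mN : measurable ((c `*` setT) `|` (setT `*` c) : set T4).
  by apply: measurableU; exact: measurableX.
apply: (@subset_measure0 _ _ _ leb4 _ ((c `*` setT) `|` (setT `*` c))) => //.
- by apply: measurableD; [exact: measurable_Om|exact: measurable_OmI].
- move=> p [[X|[h1 h2]] nI]; first by exfalso; apply: nI; left.
  have [n1e|] := eqVneq (n1 p) e; first by left; split.
  have [n2e _|k2 k1] := eqVneq (n2 p) e; first by right; split.
  exfalso; apply: nI; right; split.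
    by rewrite lt_neqAle k1.
  by rewrite lt_neqAle k2.
- apply/eqP; rewrite -measure_le0; apply: (le_trans (measureU2 _ _ _)); try exact: measurableX.
  rewrite [X in (X + _)%E](_ : _ = 0%E).
    rewrite add0e [leLHS](_ : _ = 0%E)//.
    rewrite [LHS](product_measure1E leb2 leb2)//.
    by rewrite [X in (_ * X)%E]circle_null mule0.
  rewrite [LHS](product_measure1E leb2 leb2)//.
  by rewrite [X in (X * _)%E]circle_null mul0e.
Qed.

End Geometry.

(** * Finite volume and orthogonality of monomials *)

Section Volume.
Variable R : realType.
Local Notation RR := (measurableTypeR R).
Local Notation T4 := ((RR * RR) * (RR * RR))%type.
Local Notation leb := (@lebesgue_measure R).
Local Notation leb2 := (@lebesgue2 R).
Local Notation leb4 := (@lebesgue4 R).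
Local Notation e := (expR 1 : R).
Local Notation Om := (@Omega0 R).

Definition box (a b c d : R) : set (RR * RR) := `[a, b]%classic `*` `[c, d]%classic.

Lemma measurable_box a b c d : measurable (box a b c d).
Proof. by apply: measurableX. Qed.

Lemma lebesgue2_box a b c d : a <= b -> c <= d ->
  leb2 (box a b c d) = ((b - a) * (d - c))%:E.
Proof.
move=> ab cd; rewrite [LHS](product_measure1E leb leb)//.
by rewrite [X in (X * _)%E](lebesgue_itvcc ab) [X in (_ * X)%E](lebesgue_itvcc cd).
Qed.

Definition dbox r1 r2 : set T4 := box (- r1) r1 (- r1) r1 `*` box (- r2) r2 (- r2) r2.

Lemma measurable_dbox r1 r2 : measurable (dbox r1 r2).
Proof. by apply: measurableX; exact: measurable_box. Qed.

Lemma lebesgue4_dbox r1 r2 : 0 <= r1 -> 0 <= r2 ->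
  leb4 (dbox r1 r2) = (16 * (r1 * r2) ^+ 2)%:E.
Proof.
move=> r10 r20; have r1' : - r1 <= r1 by lra.
have r2' : - r2 <= r2 by lra.
rewrite [LHS](product_measure1E leb2 leb2); try exact: measurable_box.
rewrite [X in (X * _)%E](lebesgue2_box r1' r1') [X in (_ * X)%E](lebesgue2_box r2' r2').
by rewrite -EFinM; congr EFin; ring.
Qed.

Lemma dbox_in (p : T4) r1 r2 : normc (toC2 p).1 <= r1 -> normc (toC2 p).2 <= r2 ->
  dbox r1 r2 p.
Proof.
move=> h1 h2.
have a1 := le_trans (normc_Re _) h1; have a2 := le_trans (normc_Im _) h1.
have b1 := le_trans (normc_Re _) h2; have b2 := le_trans (normc_Im _) h2.
by split; split; rewrite /= in_itv /= -ler_norml.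
Qed.

(** The part of [X1] where the integer part of [ln (normc z.1)] is [n.+1] lies in the product of
    these two squares, of volume [16 * e ^+ 2 / n.+1 ^+ 2]. *)
Let wing n : set T4 := dbox (expR n.+2%:R) (expR (- n.+1%:R) / n.+1%:R).
Let wing' n : set T4 := dbox (expR (- n.+1%:R) / n.+1%:R) (expR n.+2%:R).

(** By induction, the partial sum of order [N] is at most [2 * K * (1 - N.+1^-1)]. *)
Let series_inv_sq (K : R) : 0 <= K -> (\sum_(0 <= n <oo) (K / n.+1%:R ^+ 2)%:E < +oo)%E.
Proof.
move=> K0; apply: (@le_lt_trans _ _ (2 * K)%:E); last exact: ltry.
apply: lime_le.
  by apply: is_cvg_ereal_nneg_natsum => n _; rewrite lee_fin divr_ge0// exprn_ge0.
apply: nearW => N; rewrite /= sumEFin lee_fin big_mkord.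
suff : \sum_(n < N) K / n.+1%:R ^+ 2 <= 2 * K * (1 - N.+1%:R^-1).
  move=> /le_trans; apply; apply: ler_piMr; first exact: mulr_ge0.
  by rewrite lerBlDr lerDl invr_ge0.
elim: N => [|N IH]; first by rewrite big_ord0 invr1 subrr mulr0.
rewrite big_ord_recr /=; apply: (le_trans (lerD IH (lexx _))).
set x : R := N.+1%:R; have x1 : 1 <= x by rewrite ler1n.
have -> : N.+2%:R = x + 1 by rewrite /x -natr1.
rewrite -subr_ge0 (_ : _ - _ = K * (x - 1) / (x ^+ 2 * (x + 1))); last first.
  by field; apply/andP; split; apply/eqP; lra.
by apply: divr_ge0; [apply: mulr_ge0 => //; lra|apply: mulr_ge0; [exact: sqr_ge0|lra]].
Qed.

Let wing_measure n : leb4 (wing n) = (16 * e ^+ 2 / n.+1%:R ^+ 2)%:E /\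
  leb4 (wing' n) = (16 * e ^+ 2 / n.+1%:R ^+ 2)%:E.
Proof.
have E : expR n.+2%:R * (expR (- n.+1%:R) / n.+1%:R) = e / n.+1%:R :> R.
  by rewrite mulrA -expRD; congr (expR _ / _); rewrite -[n.+2%:R]natr1; ring.
have h : 0 <= expR (- n.+1%:R) / n.+1%:R :> R by rewrite divr_ge0// ltW// expR_gt0.
have h' : 0 <= expR n.+2%:R :> R by rewrite ltW// expR_gt0.
split; rewrite lebesgue4_dbox//; first by rewrite E expr_div_n mulrA.
by rewrite mulrC [X in X ^+ 2]mulrC E expr_div_n mulrC mulrA.
Qed.

Let wing_in (x y : R) : 0 <= y -> e < x -> y < 1 / (x * ln x) ->
  exists n, x <= expR n.+2%:R /\ y <= expR (- n.+1%:R) / n.+1%:R.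
Proof.
move=> y0 ex h; have x0 : 0 < x by exact: lt_trans (e_gt0 R) ex.
have lx : 1 < ln x by rewrite -[1](@expRK R) ltr_ln ?posrE// e_gt0.
have l0 : 0 <= ln x by lra.
have /andP[t1 t2] := truncn_itv l0.
have tp : (0 < Num.truncn (ln x))%N by rewrite truncn_gt0 ltW.
move: (Num.truncn (ln x)) tp t1 t2 => [//|n] _ t1 t2.
exists n; split.
  by rewrite -[x]lnK ?posrE// ler_expR ltW.
apply: ltW; apply: (lt_le_trans h); rewrite expRN -invfM div1r lef_pV2 ?posrE ?mulr_gt0 ?expR_gt0//.
  apply: ler_pM; [exact/ltW/expR_gt0|exact: ler0n| |exact: t1].
  by rewrite -[leRHS]lnK ?posrE// ler_expR.
by lra.
Qed.

Lemma Omega0_finite : (leb4 (@toC2 R @^-1` Om) < +oo)%E.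
Proof.
have mU (F : nat -> set T4) : (forall n, measurable (F n)) -> measurable (\bigcup_n F n).
  by move=> mF; exact: bigcup_measurable.
have mw n : measurable (wing n) by exact: measurable_dbox.
have mw' n : measurable (wing' n) by exact: measurable_dbox.
have cover : @toC2 R @^-1` Om `<=` (\bigcup_n wing n `|` \bigcup_n wing' n) `|` dbox e e.
  move=> p [[[h1 h2]|[h1 h2]]|[h1 h2]].
  - have [n [k1 k2]] := wing_in (normc_ge0 _) h1 h2.
    by left; left; exists n => //; exact: dbox_in.
  - have [n [k1 k2]] := wing_in (normc_ge0 _) h1 h2.
    by left; right; exists n => //; exact: dbox_in.
  - by right; exact: dbox_in.
have fin1 : (leb4 (\bigcup_n wing n) < +oo)%E.
  apply: (le_lt_trans (measure_sigma_subadditive leb4 mw (mU _ mw) (fun _ h => h))).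
  rewrite (eq_eseriesr (g := fun n => (16 * e ^+ 2 / n.+1%:R ^+ 2)%:E)).
    by apply: series_inv_sq; rewrite mulr_ge0// sqr_ge0.
  by move=> n _; exact: (wing_measure n).1.
have fin2 : (leb4 (\bigcup_n wing' n) < +oo)%E.
  apply: (le_lt_trans (measure_sigma_subadditive leb4 mw' (mU _ mw') (fun _ h => h))).
  rewrite (eq_eseriesr (g := fun n => (16 * e ^+ 2 / n.+1%:R ^+ 2)%:E)).
    by apply: series_inv_sq; rewrite mulr_ge0// sqr_ge0.
  by move=> n _; exact: (wing_measure n).2.
have fin3 : (leb4 (dbox e e) < +oo)%E.
  have e0 := ltW (e_gt0 R); rewrite (lebesgue4_dbox e0 e0).
  by move: (16 * _) => v; rewrite ltry.
have m12 : measurable (\bigcup_n wing n `|` \bigcup_n wing' n) by apply: measurableU; exact: mU.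
apply: (@le_lt_trans _ _ (leb4 ((\bigcup_n wing n `|` \bigcup_n wing' n) `|` dbox e e))).
  apply: le_measure => //; rewrite inE; first exact: measurable_Om.
  by apply: measurableU => //; exact: measurable_dbox.
apply: (le_lt_trans (measureU2 leb4 m12 (measurable_dbox _ _))).
apply: lte_add_pinfty; last exact: fin3.
apply: (le_lt_trans (measureU2 leb4 (mU _ mw) (mU _ mw'))).
exact: (lte_add_pinfty fin1 fin2).
Qed.

Let qbox r : set (RR * RR) := box (r / 2) (r / 2 + r / 4) 0 (r / 4).

Let qbox_norm r (p : RR * RR) : 0 < r -> qbox r p -> r / 2 <= normc (p.1 +i* p.2) < r.
Proof.
move=> r0 bp.
have /andP[a1 a2] : r / 2 <= p.1 <= r / 2 + r / 4 by case: bp => + _; rewrite /= in_itv.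
have /andP[b1 b2] : 0 <= p.2 <= r / 4 by case: bp => _; rewrite /= in_itv.
apply/andP; split.
  by apply: le_trans (normc_Re _); exact: le_trans (ler_norm _).
rewrite -(ltr_pXn2r (n := 2)) ?nnegrE ?normc_ge0 ?(ltW r0)// normc_sqr /=.
by nra.
Qed.

(** A box in the polydisc on which both coordinates keep away from 0, for a lower bound
    of the norm of monomials. *)
Definition corner_box r1 r2 : set T4 := qbox r1 `*` qbox r2.

Lemma corner_boxP r1 r2 (p : T4) : 0 < r1 -> 0 < r2 -> corner_box r1 r2 p ->
  polydisc r1 r2 (toC2 p) /\ (r1 / 2 <= normc (toC2 p).1 /\ r2 / 2 <= normc (toC2 p).2).
Proof.
move=> r10 r20 [/(qbox_norm r10)/andP[a1 a2] /(qbox_norm r20)/andP[b1 b2]].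
by split; split.
Qed.

Lemma measurable_corner_box r1 r2 : measurable (corner_box r1 r2).
Proof. by apply: measurableX; exact: measurable_box. Qed.

Lemma lebesgue4_corner_box r1 r2 : 0 < r1 -> 0 < r2 ->
  leb4 (corner_box r1 r2) = ((r1 / 4) ^+ 2 * (r2 / 4) ^+ 2)%:E.
Proof.
move=> r10 r20.
have a1 : r1 / 2 <= r1 / 2 + r1 / 4 by lra.
have a2 : r2 / 2 <= r2 / 2 + r2 / 4 by lra.
have b1 : 0 <= r1 / 4 by lra.
have b2 : 0 <= r2 / 4 by lra.
rewrite [LHS](product_measure1E leb2 leb2); try exact: measurable_box.
rewrite [X in (X * _)%E](lebesgue2_box a1 b1) [X in (_ * X)%E](lebesgue2_box a2 b2).
by rewrite -EFinM; congr EFin; ring.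
Qed.

Definition monomial (jk : nat * nat) (p : T4) : R[i] :=
  (toC2 p).1 ^+ jk.1 * (toC2 p).2 ^+ jk.2.

Lemma mfunC_monomial D jk : mfunC D (monomial jk).
Proof. by apply: mfunCM; apply: mfunC_exp; [exact: mfunC_z1|exact: mfunC_z2]. Qed.

Lemma normc_monomial jk p :
  normc (monomial jk p) = normc (toC2 p).1 ^+ jk.1 * normc (toC2 p).2 ^+ jk.2.
Proof. by rewrite normc_mul !normc_exp. Qed.

Local Notation PD r1 r2 := (@toC2 R @^-1` polydisc r1 r2).

Lemma finite_polydisc r1 r2 : (leb4 (PD r1 r2) < +oo)%E.
Proof.
have [r10|r10] := leP 0 r1; last first.
  rewrite (_ : PD r1 r2 = set0) ?measure0 ?ltry//; apply/seteqP; split => // p [h1 _].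
  by have := le_lt_trans (normc_ge0 _) (lt_trans h1 r10); rewrite ltxx.
have [r20|r20] := leP 0 r2; last first.
  rewrite (_ : PD r1 r2 = set0) ?measure0 ?ltry//; apply/seteqP; split => // p [_ h1].
  by have := le_lt_trans (normc_ge0 _) (lt_trans h1 r20); rewrite ltxx.
apply: (@le_lt_trans _ _ (leb4 (dbox r1 r2))); last first.
  by rewrite (lebesgue4_dbox r10 r20); move: (16 * _) => v; rewrite ltry.
apply: le_measure; rewrite ?inE; [exact: measurable_polydisc|exact: measurable_dbox|].
by move=> p [h1 h2]; apply: dbox_in; exact: ltW.
Qed.

Lemma sqint_monomial r1 r2 jk : sqint leb4 (PD r1 r2) (monomial jk).
Proof.
apply: (@sqint_bounded _ _ _ _ _ _ (r1 ^+ jk.1 * r2 ^+ jk.2)).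
- exact: measurable_polydisc.
- exact: finite_polydisc.
- exact: mfunC_monomial.
move=> p [h1 h2]; rewrite normc_monomial.
have k1 : 0 <= r1 by exact: le_trans (normc_ge0 _) (ltW h1).
have k2 : 0 <= r2 by exact: le_trans (normc_ge0 _) (ltW h2).
by apply: ler_pM; rewrite ?exprn_ge0 ?normc_ge0//; apply: lerXn2r; rewrite ?nnegrE ?normc_ge0// ltW.
Qed.

Lemma nrm2_monomial_ge r1 r2 j k : 0 < r1 -> 0 < r2 ->
  ((r1 / 2) ^+ j * (r2 / 2) ^+ k) ^+ 2 * ((r1 / 4) ^+ 2 * (r2 / 4) ^+ 2) <=
  nrm2 leb4 (PD r1 r2) (monomial (j, k)).
Proof.
move=> r10 r20.
have sub : corner_box r1 r2 `<=` PD r1 r2 by move=> p /(corner_boxP r10 r20)[].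
have mc := measurable_corner_box r1 r2; have mP := measurable_polydisc r1 r2.
apply: le_trans (nrm2S mc mP sub (sqint_monomial _ _ _)).
have vol := lebesgue4_corner_box r10 r20.
have fc : (leb4 (corner_box r1 r2) < +oo)%E by rewrite vol; move: (_ * _) => v; rewrite ltry.
rewrite -[X in _ * X]/(fine (((r1 / 4) ^+ 2 * (r2 / 4) ^+ 2)%:E)) -vol -Rintegral_cst//.
apply: le_Rintegral => //.
- by apply: integrable_bounded => // p _; exact: lexx.
- by apply: sqint_integrable => //; exact: (sqintS mc mP sub (sqint_monomial _ _ _)).
move=> p /(corner_boxP r10 r20)[_ [h1 h2]]; rewrite normc_monomial /=.
have q1 : 0 <= r1 / 2 by lra.
have q2 : 0 <= r2 / 2 by lra.
apply: lerXn2r; rewrite ?nnegrE ?mulr_ge0 ?exprn_ge0 ?normc_ge0//.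
by apply: ler_pM; rewrite ?exprn_ge0//; apply: lerXn2r; rewrite ?nnegrE ?normc_ge0.
Qed.

(** Eigenfunctions of an isometry for eigenvalues [al] and [be] with [al * be^* != 1]
    are orthogonal. *)
Lemma rot_orth (D : set T4) (tau : T4 -> T4) (u v : T4 -> R[i]) (al be : R[i]) :
  measurable D -> measure_preserving leb4 tau -> tau @^-1` D = D ->
  sqint leb4 D u -> sqint leb4 D v -> (forall p, u (tau p) = al * u p) ->
  (forall p, v (tau p) = be * v p) -> al * conjc be != 1 -> ip leb4 D u v = 0.
Proof.
move=> mD pt tD su sv ut vt n1.
have i := ip_integrable mD su sv.
have [_ E] := cint_preserving pt mD tD i.
have : (al * conjc be - 1) * ip leb4 D u v = 0.
  rewrite mulrBl mul1r; apply/eqP; rewrite subr_eq0; apply/eqP.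
  rewrite -[RHS]E -cintZ//; apply: eq_cint => p _ /=.
  by rewrite ut vt rmorphM; ring.
by move=> /eqP; rewrite mulf_eq0 subr_eq0 (negPf n1) => /eqP.
Qed.

Lemma exp_conj_neq1 (w : R[i]) m n : normc w = 1 -> m != n ->
  w ^+ (m - n + (n - m)) != 1 -> w ^+ m * conjc (w ^+ n) != 1.
Proof.
move=> w1; have wc : w * conjc w = 1 by rewrite mul_conjc w1 expr1n.
have cM (x y : R[i]) : conjc (x * y) = conjc x * conjc y by rewrite rmorphM.
have H a b : (a < b)%N -> w ^+ (b - a) != 1 -> w ^+ b * conjc (w ^+ a) != 1.
  move=> ab; rewrite -{2}(subnK (ltnW ab)) exprD rmorphXn -mulrA -exprMn wc.
  by rewrite expr1n mulr1.
rewrite neq_ltn => /orP[mn|nm].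
  rewrite (eqP (ltnW mn)) add0n => /(H _ _ mn); apply: contra_neq => E.
  have := congr1 (@conjc R) E; rewrite cM conjcK mulrC => ->; exact: conjc1.
by rewrite [(n - m)%N](eqP (ltnW nm)) addn0 => /(H _ _ nm).
Qed.

Lemma separating_rotation (m n : nat) : m != n ->
  exists2 w : R[i], good_unit w & w ^+ m * conjc (w ^+ n) != 1.
Proof.
move=> mn; have ab0 : (0 < m - n + (n - m))%N.
  by rewrite lt0n addn_eq0 !subn_eq0 -eqn_leq.
have [w gw w1] := good_unit_exists R ab0; exists w => //.
by apply: exp_conj_neq1 => //; exact: gw.1.
Qed.

Lemma rot4_norm (w1 w2 : R[i]) p : good_unit w1 -> good_unit w2 ->
  normc (toC2 (rot4 w1 w2 p)).1 = normc (toC2 p).1 /\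
  normc (toC2 (rot4 w1 w2 p)).2 = normc (toC2 p).2.
Proof.
by move=> g1 g2; rewrite toC2_rot !normc_mul g1.1 g2.1 !mul1r.
Qed.

Lemma monomial_orth r1 r2 jk jk' : jk != jk' ->
  ip leb4 (PD r1 r2) (monomial jk) (monomial jk') = 0.
Proof.
case: jk => j k; case: jk' => j' k' ne.
have g1 := good_unit1 R.
have inv w1 w2 : good_unit w1 -> good_unit w2 -> rot4 w1 w2 @^-1` PD r1 r2 = PD r1 r2.
  move=> gw1 gw2; have E p : polydisc r1 r2 (toC2 (rot4 w1 w2 p)) = polydisc r1 r2 (toC2 p).
    by have [e1 e2] := rot4_norm p gw1 gw2; rewrite /polydisc /mkset e1 e2.
  by apply/seteqP; split => p; rewrite /preimage /mkset E.
have mon w1 w2 jk p : monomial jk (rot4 w1 w2 p) = w1 ^+ jk.1 * w2 ^+ jk.2 * monomial jk p.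
  by rewrite /monomial toC2_rot /= !exprMn; ring.
have key (w1 w2 : R[i]) : good_unit w1 -> good_unit w2 ->
    (w1 ^+ j * w2 ^+ k) * conjc (w1 ^+ j' * w2 ^+ k') != 1 ->
    ip leb4 (PD r1 r2) (monomial (j, k)) (monomial (j', k')) = 0.
  move=> gw1 gw2 ne1; apply: (@rot_orth _ (rot4 w1 w2) _ _ (w1 ^+ j * w2 ^+ k) (w1 ^+ j' * w2 ^+ k')).
  - exact: measurable_polydisc.
  - exact: rot4_preserving.
  - exact: inv.
  - exact: sqint_monomial.
  - exact: sqint_monomial.
  - exact: mon.
  - exact: mon.
  - exact: ne1.
have [jj|jj] := eqVneq j j'.
  have kk : k != k' by apply: contra_neq ne => ->; rewrite jj.
  have [w gw wP] := separating_rotation kk.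
  by apply: (key 1 w) => //; rewrite !expr1n !mul1r.
have [w gw wP] := separating_rotation jj.
by apply: (key w 1) => //; rewrite !expr1n !mulr1.
Qed.

End Volume.

(** * Bergman functions are power series in the product of the coordinates *)

Section Expansion.
Variable R : realType.
Local Notation C := (R[i])^o.
Local Notation RR := (measurableTypeR R).
Local Notation T4 := ((RR * RR) * (RR * RR))%type.
Local Notation leb4 := (@lebesgue4 R).
Local Notation e := (expR 1 : R).
Local Notation Om := (@Omega0 R).
Local Notation PD r1 r2 := (@toC2 R @^-1` polydisc r1 r2).
Local Notation DO := (@toC2 R @^-1` Om).

Definition grid N : seq (nat * nat) := [seq (j, k) | j <- iota 0 N, k <- iota 0 N].

Lemma grid_uniq N : uniq (grid N).
Proof. by apply: allpairs_uniq; rewrite ?iota_uniq// => -[a b] [c d]. Qed.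

Lemma mem_grid N jk : (jk \in grid N) = (jk.1 < N)%N && (jk.2 < N)%N.
Proof.
apply/allpairsP/idP => [[[j k] /= []]|].
  by rewrite !mem_iota !add0n /= => h1 h2 ->; rewrite h1.
by move=> /andP[h1 h2]; exists jk; rewrite !mem_iota !add0n /= h1 h2; split => //; case: jk {h1 h2}.
Qed.

Lemma sum_grid N (F : nat * nat -> R[i]) :
  \sum_(jk <- grid N) F jk = \sum_(j < N) \sum_(k < N) F (j : nat, k : nat).
Proof.
rewrite /grid big_allpairs -[in X in iota X N]/(0%N) -{1}(subn0 N) -/(index_iota 0 N) big_mkord.
by apply: eq_bigr => j _; rewrite -{1}(subn0 N) -/(index_iota 0 N) big_mkord.
Qed.

Variable g : C2 R -> C.
Hypothesis sg : sqint leb4 DO (fun p => g (toC2 p)).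
Hypothesis dg : forall z, (Om)° z -> differentiable g z.

Let M := 2 * nrm2 leb4 DO (fun p => g (toC2 p)).

Let coef r1 r2 (jk : nat * nat) : R[i] := ccoef2 r1 r2 g jk.1 jk.2.

(** Radii of the polydisc of uniform convergence, of the circle of integration, and of
    the disc of holomorphy. *)
Definition nested (s r rho : R) := [/\ 0 < s, s < r & r < rho].

Lemma polydisc_expansion s1 r1 rho1 s2 r2 rho2 : nested s1 r1 rho1 -> nested s2 r2 rho2 ->
  admissible rho1 rho2 -> forall eps, 0 < eps -> exists N0, forall N, (N0 <= N)%N ->
  forall z : C2 R, normc z.1 <= s1 -> normc z.2 <= s2 ->
    normc (g z - \sum_(jk <- grid N) coef r1 r2 jk * (z.1 ^+ jk.1 * z.2 ^+ jk.2)) <= eps.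
Proof.
move=> [s10 sr1 rr1] [s20 sr2 rr2] ad eps eps0.
have dg' (z : C2 R) : normc z.1 < rho1 -> normc z.2 < rho2 -> differentiable g z.
  by move=> h1 h2; apply: dg; apply: (admissible_interior ad).
have [N0 NP] := power_series2 (lt_trans s10 sr1) (lt_trans s20 sr2) rr1 rr2 dg'
  (ltW s10) sr1 (ltW s20) sr2 eps0.
exists N0 => N NN z z1 z2; rewrite sum_grid.
rewrite (eq_bigr (fun j : 'I_N => \sum_(k < N) ccoef2 r1 r2 g j k * z.1 ^+ j * z.2 ^+ k)).
  exact: NP.
by move=> j _; apply: eq_bigr => k _; rewrite mulrA.
Qed.

Let expansion_PD s1 r1 rho1 s2 r2 rho2 : nested s1 r1 rho1 -> nested s2 r2 rho2 ->
  admissible rho1 rho2 -> forall eps, 0 < eps -> exists N0, forall N, (N0 <= N)%N ->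
  forall p, PD s1 s2 p ->
    normc (g (toC2 p) - \sum_(jk <- grid N) coef r1 r2 jk * monomial jk p) <= eps.
Proof.
move=> n1 n2 ad eps eps0; have [N0 NP] := polydisc_expansion n1 n2 ad eps0.
by exists N0 => N NN p [h1 h2]; apply: NP => //; exact: ltW.
Qed.

Let subgrid jk : exists N0, forall N, (N0 <= N)%N -> {subset [:: jk] <= grid N}.
Proof.
exists (maxn jk.1 jk.2).+1 => N; rewrite gtn_max => /andP[h1 h2] i.
by rewrite inE => /eqP ->; rewrite mem_grid h1.
Qed.

Let PD_sub s1 r1 rho1 s2 r2 rho2 : nested s1 r1 rho1 -> nested s2 r2 rho2 ->
  admissible rho1 rho2 -> PD s1 s2 `<=` DO.
Proof.
move=> [s10 sr1 rr1] [s20 sr2 rr2] ad p [h1 h2]; apply: ad; split.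
  by apply: (lt_trans h1); exact: lt_trans rr1.
by apply: (lt_trans h2); exact: lt_trans rr2.
Qed.

Let coef_bound s1 r1 rho1 s2 r2 rho2 jk : nested s1 r1 rho1 -> nested s2 r2 rho2 ->
  admissible rho1 rho2 ->
  normc (coef r1 r2 jk) ^+ 2 * nrm2 leb4 (PD s1 s2) (monomial jk) <= M.
Proof.
move=> n1 n2 ad; have sub := PD_sub n1 n2 ad.
have mP := measurable_polydisc s1 s2; have mO := @measurable_Om R.
apply: (@le_trans _ _ (2 * nrm2 leb4 (PD s1 s2) (fun p => g (toC2 p)))); last first.
  by rewrite ler_pM2l//; exact: (nrm2S mP mO sub sg).
have := @bessel2 _ _ _ leb4 (PD s1 s2) _ (@monomial R) mP (@sqint_monomial R s1 s2)
  (@monomial_orth R s1 s2) (fun p => g (toC2 p)) (coef r1 r2) grid [:: jk]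
  (finite_polydisc s1 s2) (sqintS mP mO sub sg) grid_uniq isT (subgrid jk)
  (expansion_PD n1 n2 ad).
by rewrite big_seq1.
Qed.

Let nrm2_monomial_gt0 s1 s2 jk : 0 < s1 -> 0 < s2 -> 0 < nrm2 leb4 (PD s1 s2) (monomial jk).
Proof.
case: jk => j k s10 s20; apply: lt_le_trans (nrm2_monomial_ge j k s10 s20).
by rewrite !mulr_gt0// ?exprn_gt0// ?mulr_gt0// ?exprn_gt0// divr_gt0.
Qed.

(** Two expansions valid on a common polydisc: Bessel's inequality for the zero function
    with the differences of coefficients. *)
Let coef_indep s1 r1 rho1 s2 r2 rho2 s1' r1' rho1' s2' r2' rho2' jk :
  nested s1 r1 rho1 -> nested s2 r2 rho2 -> admissible rho1 rho2 ->
  nested s1' r1' rho1' -> nested s2' r2' rho2' -> admissible rho1' rho2' ->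
  coef r1 r2 jk = coef r1' r2' jk.
Proof.
move=> n1 n2 ad n1' n2' ad'.
have [s10 _ _] := n1; have [s20 _ _] := n2; have [s10' _ _] := n1'; have [s20' _ _] := n2'.
pose t1 := Num.min s1 s1'; pose t2 := Num.min s2 s2'.
have t10 : 0 < t1 by rewrite lt_min s10.
have t20 : 0 < t2 by rewrite lt_min s20.
have mP := measurable_polydisc t1 t2.
have s0 : sqint leb4 (PD t1 t2) (fun=> 0).
  apply: (@sqint_bounded _ _ _ leb4 (PD t1 t2) (fun=> 0) 0 mP (finite_polydisc _ _)).
    exact: mfunC_cst.
  by move=> p _; rewrite ComplexField.Normc.normc0.
pose a jk := coef r1 r2 jk - coef r1' r2' jk.
have exp0 eps : 0 < eps -> exists N0, forall N, (N0 <= N)%N -> forall p, PD t1 t2 p ->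
    normc (0 - \sum_(jk <- grid N) a jk * monomial jk p) <= eps.
  move=> eps0; have eps2 : 0 < eps / 2 by rewrite divr_gt0.
  have [N0 NP] := expansion_PD n1 n2 ad eps2.
  have [N0' NP'] := expansion_PD n1' n2' ad' eps2.
  exists (maxn N0 N0') => N; rewrite geq_max => /andP[h h'] p [].
  rewrite !lt_min => /andP[k1 k1'] /andP[k2 k2'].
  have H1 := NP N h p (conj k1 k2); have H2 := NP' N h' p (conj k1' k2').
  rewrite (_ : 0 - _ = (g (toC2 p) - \sum_(jk <- grid N) coef r1 r2 jk * monomial jk p) -
    (g (toC2 p) - \sum_(jk <- grid N) coef r1' r2' jk * monomial jk p)).
    rewrite (splitr eps); apply: (le_trans (normcB _ _)); exact (lerD H1 H2).
  rewrite (eq_bigr (fun jk => coef r1 r2 jk * monomial jk p - coef r1' r2' jk * monomial jk p)); last first.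
    by move=> i _; rewrite /a mulrBl.
  by rewrite sumrB sub0r !opprB [RHS]addrC [RHS]addrA subrK.
have := @bessel2 _ _ _ leb4 (PD t1 t2) _ (@monomial R) mP (@sqint_monomial R t1 t2)
  (@monomial_orth R t1 t2) (fun=> 0) a grid [:: jk]
  (finite_polydisc t1 t2) s0 grid_uniq isT (subgrid jk) exp0.
rewrite big_seq1 (_ : nrm2 leb4 (PD t1 t2) (fun=> 0) = 0); last first.
  rewrite /nrm2 (@eq_Rintegral _ _ _ leb4 _ (fun=> 0)) ?Rintegral_cst ?mul0r//.
  by move=> p _; rewrite ComplexField.Normc.normc0 expr0n.
rewrite mulr0 pmulr_lle0; last exact: nrm2_monomial_gt0.
move=> h; have /eqP : normc (a jk) ^+ 2 = 0.
  by apply/eqP; rewrite eq_le h sqr_ge0.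
by rewrite sqrf_eq0 normc_eq0 subr_eq0 => /eqP.
Qed.

Let ne (rho : R) : 0 < rho -> nested (rho / 2) (3 * rho / 4) rho.
Proof. by move=> r0; split; lra. Qed.

Let base_n : nested (1 / 2) 1 e.
Proof. by split; [lra|lra|exact: e_gt1]. Qed.

(** Coefficients of the expansion on the bidisc of radius [e]; [coef_indep] makes them
    those of any other one. *)
Let a0 jk := coef 1 1 jk.

(** [coef_bound] on the polydisc of half radii, with the norm of the monomial bounded
    below on a corner box. *)
Let a0_bound rho1 rho2 j k : 0 < rho1 -> 0 < rho2 -> admissible rho1 rho2 ->
  normc (a0 (j, k)) ^+ 2 * ((4^-1 ^+ (j + k) / 64) ^+ 2) *
    (rho1 ^+ j.+1 * rho2 ^+ k.+1) ^+ 2 <= M.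
Proof.
move=> r10 r20 ad.
have E := @coef_indep _ _ _ _ _ _ _ _ _ _ _ _ (j, k) base_n base_n (@admissible_bidisc R)
   (ne r10) (ne r20) ad.
rewrite /a0 E; apply: le_trans (coef_bound (j, k) (ne r10) (ne r20) ad).
rewrite -mulrA; apply: ler_wpM2l; first exact: sqr_ge0.
have h1 : 0 < rho1 / 2 by lra.
have h2 : 0 < rho2 / 2 by lra.
apply: le_trans (nrm2_monomial_ge j k h1 h2).
rewrite le_eqVlt; apply/orP; left; apply/eqP.
have -> : rho1 / 2 / 2 = 4^-1 * rho1 by field.
have -> : rho2 / 2 / 2 = 4^-1 * rho2 by field.
rewrite !exprMn !exprS exprD; field; exact: isT.
Qed.

(** The exponential series gives [expR x / x ^+ m >= x / m.+1`!], so the left side is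
    unbounded unless [A = 0]. *)
Let decay (A c K : R) (m : nat) : 0 <= A -> 0 < c ->
  (forall x, 1 < x -> A * c * (expR x / x ^+ m) ^+ 2 <= K) -> A = 0.
Proof.
move=> A0 c0 H; apply/eqP; rewrite eq_le A0 andbT leNgt; apply/negP => Agt.
pose B := A * c / (m.+1`!%:R) ^+ 2.
have f0 : 0 < m.+1`!%:R :> R by rewrite ltr0n fact_gt0.
have B0 : 0 < B by rewrite divr_gt0 ?mulr_gt0 ?exprn_gt0.
have HB x : 1 < x -> B * x ^+ 2 <= K.
  move=> x1; apply: le_trans (H x x1).
  have x0 : 0 < x by lra.
  have -> : B * x ^+ 2 = A * c * (x / m.+1`!%:R) ^+ 2 by rewrite /B exprMn exprVn; ring.
  apply: ler_wpM2l; first by rewrite mulr_ge0 ?ltW.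
  apply: lerXn2r; rewrite ?nnegrE.
  - by rewrite divr_ge0// ltW.
  - by rewrite divr_ge0 ?exprn_ge0 ?ltW// expR_gt0.
  rewrite ler_pdivlMr ?exprn_gt0// mulrAC -exprS.
  by have := @expR_ge1Dxn _ x m (ltW x0); lra.
have K0 : 0 <= K by apply: le_trans (HB 2 _); [rewrite mulr_ge0 ?sqr_ge0 ?ltW|lra].
have d0 : 0 <= K / B by apply: divr_ge0 => //; exact: ltW.
have l1 : 1 < K / B + 2 by move: (K / B) d0 => y d0; lra.
have := HB _ l1; rewrite leNgt => /negP; apply.
apply: (@lt_le_trans _ _ (B * (K / B + 2))).
  by rewrite mulrDr mulrCA divff ?gt_eqF// mulr1 ltrDl mulr_gt0.
rewrite ler_pM2l// expr2; move: (K / B + 2) l1 => y l1.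
by apply: ler_peMr; lra.
Qed.

(** On the polydisc of radii [expR x] and [1 / (expR x * x)], in the order given by the larger
    exponent, [a0_bound] has the shape required by [decay]. *)
Let offdiag j k : j != k -> a0 (j, k) = 0.
Proof.
have c0 n : 0 < (4^-1 ^+ n / 64 : R) ^+ 2 by rewrite exprn_gt0// divr_gt0// exprn_gt0// invr_gt0.
have side m n x : (m < n)%N -> 1 < x ->
    expR x / x ^+ m.+1 <= expR x ^+ n.+1 * (1 / (expR x * x)) ^+ m.+1 :> R.
  move=> mn x1; have x0 : 0 < x by lra.
  have ex0 : 0 < expR x by exact: expR_gt0.
  rewrite div1r exprVn exprMn invfM mulrA -(subnK mn) -addSn exprD mulrK; last first.
    by rewrite unitfE gt_eqF// exprn_gt0.
  rewrite ler_pM2r ?invr_gt0 ?exprn_gt0// exprS.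
  apply: ler_peMr; first exact: ltW.
  by apply: exprn_ege1; apply: ltW; rewrite expR_gt1.
have norm0 jk : normc (a0 jk) ^+ 2 = 0 -> a0 jk = 0.
  by move=> /eqP; rewrite sqrf_eq0 normc_eq0 => /eqP.
have vanish jk m n N : (m < n)%N -> (forall x, 1 < x ->
    normc (a0 jk) ^+ 2 * (4^-1 ^+ N / 64) ^+ 2 *
      (expR x ^+ n.+1 * (1 / (expR x * x)) ^+ m.+1) ^+ 2 <= M) -> a0 jk = 0.
  move=> mn H; apply: norm0; apply: (@decay _ _ M m.+1 (sqr_ge0 _) (c0 N)) => x x1.
  have x0 : 0 < x by lra.
  apply: le_trans (H x x1); apply: ler_wpM2l; first by rewrite mulr_ge0 ?sqr_ge0.
  apply: lerXn2r (side m n x mn x1); rewrite nnegrE.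
  - by rewrite divr_ge0 ?exprn_ge0 ?ltW// expR_gt0.
  - by rewrite mulr_ge0 ?exprn_ge0 ?divr_ge0 ?mulr_ge0 ?ltW// expR_gt0.
have ad x : 1 < x -> 0 < 1 / (expR x * x) :> R /\ admissible (expR x) (1 / (expR x * x)).
  move=> x1; split; first by rewrite divr_gt0 ?mulr_gt0 ?expR_gt0//; lra.
  by have := @admissible_X1 R (expR x); rewrite ltr_expR expRK; apply.
rewrite neq_ltn => /orP[jk|kj].
- apply: (vanish _ _ _ (j + k)%N jk) => x x1; have [r0 adx] := ad x x1.
  rewrite [_ * _ ^+ j.+1]mulrC.
  exact: (a0_bound j k r0 (expR_gt0 x) (admissible_swap adx)).
- apply: (vanish _ _ _ (j + k)%N kj) => x x1; have [r0 adx] := ad x x1.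
  exact: (a0_bound j k (expR_gt0 x) r0 adx).
Qed.

Let in_between (x y : R) : 0 <= x -> x < y -> exists s r, nested s r y /\ x <= s.
Proof.
move=> x0 xy; exists ((x + y + y) / 3), ((x + 4 * y + y) / 6).
by split; [split|]; lra.
Qed.

Let diag_csums (z : C2 R) rho1 rho2 : admissible rho1 rho2 -> polydisc rho1 rho2 z ->
  csums (fun n => a0 (n, n) * (z.1 * z.2) ^+ n) (g z).
Proof.
move=> ad [h1 h2] eps eps0.
have [s1 [r1 [n1 k1]]] := in_between (normc_ge0 _) h1.
have [s2 [r2 [n2 k2]]] := in_between (normc_ge0 _) h2.
have [N0 NP] := polydisc_expansion n1 n2 ad eps0.
exists N0 => N NN; have := NP N NN z k1 k2.
congr (normc (_ - _) <= _); rewrite sum_grid; apply: eq_bigr => j _.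
rewrite (bigD1 j) //= big1 ?addr0.
  by rewrite exprMn (coef_indep _ n1 n2 ad base_n base_n (@admissible_bidisc R)).
move=> k kj; rewrite (coef_indep _ n1 n2 ad base_n base_n (@admissible_bidisc R)).
by rewrite -/(a0 _) offdiag ?mul0r// eq_sym.
Qed.

(** The diagonal coefficients satisfy the growth condition since the series converges at
    the points [(q, q)] with [q < e]. *)
Lemma A2_expansion : exists a, power_bounded (e ^+ 2) a /\
  forall z, OmI z -> csums (fun n => a n * (z.1 * z.2) ^+ n) (g z).
Proof.
exists (fun n => a0 (n, n)); split; last first.
  by move=> z /OmI_admissible[r1 [r2 [ad pz]]]; exact: diag_csums ad pz.
move=> s s0 se; pose q := Num.sqrt s.
have qs : q * q = s by rewrite -expr2 sqr_sqrtr// ltW.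
have q0 : 0 <= q by exact: sqrtr_ge0.
have qe : q < e.
  by rewrite -(ltr_pXn2r (n := 2)) ?nnegrE// ?(ltW (e_gt0 R))// sqr_sqrtr// ltW.
pose z : C2 R := (q%:C, q%:C).
have nq : normc q%:C = q by rewrite normc_real ger0_norm.
have pz : polydisc e e z by split; rewrite /z /fst /snd nq.
have z1q : normc z.1 = q by exact: nq.
have z2q : normc z.2 = q by exact: nq.
have nz : normc (z.1 * z.2) = s.
  rewrite -qs; apply: etrans (normc_mul _ _) _; exact: congr2 z1q z2q.
have cs := diag_csums (@admissible_bidisc R) pz.
have [N0 NP] := cs 1 ltr01.
pose t n := normc (a0 (n, n)) * s ^+ n.
have tE n : t n = normc (a0 (n, n) * (z.1 * z.2) ^+ n).
  by rewrite /t normc_mul normc_exp nz.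
have big n : (N0 <= n)%N -> t n <= 2.
  move=> Nn; rewrite tE.
  have H1 := NP n Nn; have H2 := NP n.+1 (leqW Nn).
  move: H1 H2; rewrite big_ord_recr /=; set S := \sum_(i < n) _; set u := a0 _ * _ => H1 H2.
  rewrite (_ : u = (g z - S) - (g z - (S + u))); last by ring.
  by apply: (le_trans (normcB _ _)); exact: (lerD H1 H2).
exists (2 + \sum_(i < N0) t i) => n.
have t0 i : 0 <= t i by rewrite tE normc_ge0.
have [nN|Nn] := ltnP n N0.
  rewrite -/(t n) (bigD1 (Ordinal nN)) //= addrCA lerDl addr_ge0//.
  by apply: sumr_ge0.
apply: (le_trans (big n Nn)); rewrite lerDl; exact: sumr_ge0.
Qed.

End Expansion.

(** * Null sets and limits *)

Section AlmostEverywhere.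
Context d (T : measurableType d) (R : realType).
Variable mu : {measure set T -> \bar R}.
Implicit Types (D E : set T) (u v : T -> R[i]).

Lemma mfunC_lim D (u : nat -> T -> R[i]) v : (forall n, mfunC D (u n)) ->
  (forall x, D x -> forall e : R, 0 < e -> exists N0, forall N, (N0 <= N)%N ->
    normc (v x - u N x) <= e) -> mfunC D v.
Proof.
move=> mu_ uv; split.
- apply: (@measurable_fun_cvg _ _ _ D (fun n x => complex.Re (u n x))).
    by move=> n; exact: (mu_ n).1.
  move=> x Dx; apply/cvgrPdist_le => e e0; have [N0 NP] := uv x Dx e e0.
  exists N0 => // N /NP; apply: le_trans.
  by rewrite -cReN -cReD; exact: normc_Re.
- apply: (@measurable_fun_cvg _ _ _ D (fun n x => complex.Im (u n x))).
    by move=> n; exact: (mu_ n).2.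
  move=> x Dx; apply/cvgrPdist_le => e e0; have [N0 NP] := uv x Dx e e0.
  exists N0 => // N /NP; apply: le_trans.
  by rewrite -cImN -cImD; exact: normc_Im.
Qed.

Lemma nrm2_eq0 D u : measurable D -> sqint mu D u ->
  nrm2 mu D u = 0 <-> ae_eq mu D u (fun=> 0).
Proof.
move=> mD su.
have mf : measurable_fun D (fun x => (normc (u x) ^+ 2)%:E).
  by apply/measurable_EFinP; apply: mfunC_normc2; exact: su.1.
have E0 x : (normc (u x) ^+ 2)%:E = 0%E -> u x = 0.
  by move=> [/eqP]; rewrite sqrf_eq0 normc_eq0 => /eqP.
have := ae_eq_integral_abs mu mD mf.
under eq_integral => x _ do rewrite /= ger0_norm ?sqr_ge0//.
rewrite -(nrm2E mD su) => H; split.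
  move=> n0; have := H.1 (congr1 EFin n0); apply: filterS => x Hx Dx.
  exact: E0 (Hx Dx).
move=> u0; suff [] : (nrm2 mu D u)%:E = 0%E by [].
apply: H.2; move: u0; apply: filterS => x Hx Dx.
by rewrite Hx// ComplexField.Normc.normc0 expr0n.
Qed.

Variables (D E : set T).
Hypotheses (mD : measurable D) (mE : measurable E) (ED : E `<=` D).
Hypothesis DE0 : mu (D `\` E) = 0%E.

Let DDE : D `\` (D `\` E) = E.
Proof. by rewrite setDD; exact: setIidr. Qed.

Let mDE : measurable (D `\` E). Proof. exact: measurableD. Qed.

Lemma sqint_null u : mfunC D u -> sqint mu E u -> sqint mu D u.
Proof.
move=> mu_ [_ fi]; split => //.
rewrite (@ge0_negligible_integral _ _ _ mu D (D `\` E)) ?DDE//.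
- by apply/measurable_EFinP; exact: mfunC_normc2.
- by move=> x _; rewrite lee_fin sqr_ge0.
Qed.

Lemma nrm2_null u : sqint mu D u -> nrm2 mu D u = nrm2 mu E u.
Proof.
move=> su; rewrite /nrm2 /Rintegral.
rewrite (@negligible_integral _ _ _ mu D (D `\` E)) ?DDE//.
exact: sqint_integrable.
Qed.

Lemma ip_null u v : sqint mu D u -> sqint mu D v -> ip mu D u v = ip mu E u v.
Proof.
move=> su sv; have [i1 i2] := ip_integrable mD su sv.
rewrite /ip /cint /Rintegral.
rewrite (@negligible_integral _ _ _ mu D (D `\` E) _ mDE mD i1 DE0).
by rewrite (@negligible_integral _ _ _ mu D (D `\` E) _ mDE mD i2 DE0) DDE.
Qed.

End AlmostEverywhere.

Lemma differentiable_fst (K : numFieldType) (V W : normedModType K) (z : V * W) :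
  differentiable (@fst V W) z.
Proof. by apply: linear_differentiable => p; exact: cvg_fst. Qed.

Lemma differentiable_snd (K : numFieldType) (V W : normedModType K) (z : V * W) :
  differentiable (@snd V W) z.
Proof. by apply: linear_differentiable => p; exact: cvg_snd. Qed.

(** * The Bergman space and the Hankel operator *)

Section BergmanProjection.
Variable R : realType.
Local Notation C := (R[i])^o.
Local Notation RR := (measurableTypeR R).
Local Notation T4 := ((RR * RR) * (RR * RR))%type.
Local Notation leb4 := (@lebesgue4 R).
Local Notation e := (expR 1 : R).
Local Notation B := (e ^+ 2).
Local Notation Om := (@Omega0 R).
Local Notation DO := (@toC2 R @^-1` Om).
Local Notation D := (@toC2 R @^-1` @OmI R).
Implicit Types (g h p : C2 R -> C).

Definition prodf (z : C2 R) : C := z.1 * z.2.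
Let F (x : T4) : R[i] := prodf (toC2 x).

Let mDO : measurable DO := @measurable_Om R.
Let mD : measurable D := @measurable_OmI R.
Let DDO : D `<=` DO.
Proof. by move=> x; exact: OmI_sub. Qed.
Let DDO0 : leb4 (DO `\` D) = 0%E := @boundary_null R.
Let fDO : (leb4 DO < +oo)%E := @Omega0_finite R.

Let fD : (leb4 D < +oo)%E.
Proof.
by apply: le_lt_trans fDO; apply: le_measure; rewrite ?inE; [exact: mD|exact: mDO|exact: DDO].
Qed.

Let mF E : mfunC E F.
Proof. by apply: mfunCM; [exact: mfunC_z1|exact: mfunC_z2]. Qed.

Let B_gt0 : 0 < B.
Proof. by apply: exprn_gt0; exact: e_gt0. Qed.

Let F_lt x : D x -> normc (F x) < B.
Proof. by move=> Dx; exact: OmI_f_lt. Qed.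

Lemma rot4_OmI (w1 w2 : R[i]) x : good_unit w1 -> good_unit w2 ->
  @OmI R (toC2 (rot4 w1 w2 x)) = @OmI R (toC2 x).
Proof.
move=> g1 g2; have [e1 e2] := rot4_norm x g1 g2.
by rewrite /OmI /X1 /X2 /polydisc /setU /mkset e1 e2.
Qed.

Let mDs s : measurable (D `&` [set x | normc (F x) < s]).
Proof.
apply: measurableI => //; apply: measurable_lt_set; last exact: measurable_cst.
exact: mfunC_normc.
Qed.

Let sF E n : measurable E -> E `<=` DO -> sqint leb4 E (fun x => F x ^+ n).
Proof.
move=> mE EO; apply: (sqintS mE mDO EO).
apply: (@sqint_bounded _ _ _ leb4 DO _ (B ^+ n) mDO fDO); first exact: mfunC_exp.
move=> x Dx; rewrite normc_exp; apply: lerXn2r; rewrite ?nnegrE ?normc_ge0 ?(ltW B_gt0)//.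
exact: Omega0_f_le.
Qed.

Let orth s m n : m != n ->
  ip leb4 (D `&` [set x | normc (F x) < s]) (fun x => F x ^+ m) (fun x => F x ^+ n) = 0.
Proof.
move=> mn; have [w gw wmn] := separating_rotation R mn.
have g1 := good_unit1 R.
have Fw x : F (rot4 1 w x) = w * F x.
  by rewrite /F /prodf toC2_rot /= mul1r mulrCA.
have sub : D `&` [set x | normc (F x) < s] `<=` DO by move=> x [/DDO].
have H k := sF k (mDs s) sub.
apply: (@rot_orth R _ (rot4 1 w) _ _ (w ^+ m) (w ^+ n) (mDs s) _ _ (H m) (H n)).
- exact: rot4_preserving.
- apply/seteqP; split => x; rewrite /preimage /setI /mkset rot4_OmI// Fw normc_mul.
    by rewrite gw.1 mul1r.
  by rewrite gw.1 mul1r.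
- by move=> x; rewrite Fw exprMn.
- by move=> x; rewrite Fw exprMn.
- exact: wmn.
Qed.

Let sFD n : sqint leb4 D (fun x => F x ^+ n) := sF n mD DDO.

Let c_gt0 n : 0 < nrm2 leb4 D (fun x => F x ^+ n).
Proof.
have PD1 : @toC2 R @^-1` polydisc 1 1 `<=` D.
  by move=> x [h1 h2]; right; split; apply: lt_trans (e_gt1 R).
have mP := measurable_polydisc (1 : R) 1.
apply: lt_le_trans (nrm2S mP mD PD1 (sFD n)).
rewrite (@eq_nrm2 _ _ _ leb4 _ _ (monomial (n, n))); last first.
  by move=> x _; rewrite /monomial -exprMn.
apply: lt_le_trans (nrm2_monomial_ge n n ltr01 ltr01).
by rewrite !mulr_gt0// ?exprn_gt0// ?mulr_gt0// ?exprn_gt0// divr_gt0.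
Qed.

Local Notation rad g := (radial leb4 D F B (fun x => g (toC2 x))).

Lemma L2_sqint h : L2 Om h <-> sqint leb4 DO (fun x => h (toC2 x)).
Proof. by split=> [[h1 h2 h3]|[[h1 h2] h3]]; split. Qed.

Let A2_sqint g : A2 Om g -> sqint leb4 DO (fun x => g (toC2 x)).
Proof. by move=> [/L2_sqint]. Qed.

Let sqintD' h : sqint leb4 DO (fun x => h (toC2 x)) -> sqint leb4 D (fun x => h (toC2 x)).
Proof. exact: sqintS. Qed.

Lemma L2innerE g h : L2 Om g -> L2 Om h ->
  L2inner Om g h = ip leb4 D (fun x => g (toC2 x)) (fun x => h (toC2 x)).
Proof. by move=> /L2_sqint sg /L2_sqint sh; rewrite -(ip_null mDO mD DDO DDO0 sg sh). Qed.

Lemma L2normE g : L2 Om g -> L2norm Om g = Num.sqrt (nrm2 leb4 D (fun x => g (toC2 x))).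
Proof. by move=> /L2_sqint sg; rewrite -(nrm2_null mDO mD DDO DDO0 sg). Qed.

Lemma A2_radial g : A2 Om g -> rad g.
Proof.
move=> Ag; have [_ dg] := Ag; have [a [pb aG]] := A2_expansion (A2_sqint Ag) dg.
exists a; split => //; first exact: sqintD' (A2_sqint Ag).
by move=> x Dx; exact: aG.
Qed.

Lemma A2_lin (a : C) g h : A2 Om g -> A2 Om h -> A2 Om (fun z => a * g z + h z).
Proof.
move=> Ag Ah; split.
  by apply/L2_sqint; apply: sqintD => //; [apply: sqintZ => //|]; exact: A2_sqint.
move=> z Oz; apply: differentiableD; last exact: Ah.2.
by apply: differentiableM; [exact: differentiable_cst|exact: Ag.2].
Qed.

Lemma differentiable_prodf z : differentiable prodf z.
Proof. by apply: differentiableM; [exact: differentiable_fst|exact: differentiable_snd]. Qed.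

Lemma A2_pow n : A2 Om (fun z => prodf z ^+ n).
Proof.
split; first by apply/L2_sqint; exact: (sF n mDO).
by move=> z _; apply: differentiable_expC; exact: differentiable_prodf.
Qed.

Lemma A2_sum N (a : nat -> C) : A2 Om (fun z => \sum_(n <- iota 0 N) a n * prodf z ^+ n).
Proof.
elim: (iota 0 N) => [|n s IH].
  have -> : (fun z => \sum_(n <- [::]) a n * prodf z ^+ n) =
      (fun z => (-1) * prodf z ^+ 0 + prodf z ^+ 0).
    by apply/funext => z; rewrite big_nil mulN1r addNr.
  by apply: A2_lin; exact: A2_pow.
under eq_fun do rewrite big_cons.
by apply: A2_lin => //; exact: A2_pow.
Qed.

Lemma L2_conj_mul h : L2 Om h -> L2 Om (conj_mul prodf h).
Proof.
move=> /L2_sqint sh; apply/L2_sqint.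
apply: (@le_sqint _ _ _ leb4 DO _ (fun x => B ^+ 2 * normc (h (toC2 x)) ^+ 2)) => //.
- by apply: mfunCM; [apply: mfunCJ; exact: mF|exact: sh.1].
- by apply: integrableZR => //; exact: sqint_integrable.
- move=> x Dx; rewrite normc_mul normc_conj exprMn; apply: ler_wpM2r; first exact: sqr_ge0.
  apply: lerXn2r; rewrite ?nnegrE ?normc_ge0 ?(ltW B_gt0)//.
  exact: Omega0_f_le.
Qed.

(** The sum is cut off to 0 where the modulus of the product reaches [B].  This happens at
    no interior point [interior_f_lt], and makes the function a limit of measurable
    functions on the whole domain. *)
Lemma power_series_A2 b : power_bounded B b -> exists p,
  [/\ mfunC DO (fun x => p (toC2 x)), forall z, Om° z -> differentiable p z &
    forall z, OmI z -> csums (fun n => b n * prodf z ^+ n) (p z)].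
Proof.
move=> pb; have [phi phiP] := power_series_exists pb.
pose psi (t : C) : C := if normc t < B then phi t else 0.
have psiP t : normc t < B -> csums (fun n => b n * t ^+ n) (psi t).
  by move=> tB; rewrite /psi tB; exact: phiP.
exists (psi \o prodf); split.
- pose A := [set x : T4 | normc (F x) < B].
  have mA : measurable A.
    by apply: measurable_lt_set; [exact: mfunC_normc|exact: measurable_cst].
  apply: (@mfunC_lim _ _ _ DO (fun N x => (\1_A x)%:C * \sum_(n <- iota 0 N) b n * F x ^+ n)).
    move=> N; apply: mfunCM.
      by split; [exact: measurable_indic|exact: measurable_cst].
    apply: mfunC_sum => n; apply: mfunCM; first exact: mfunC_cst.
    exact: mfunC_exp.
  move=> x Dx eps eps0; have -> : (psi \o prodf) (toC2 x) = psi (F x) by [].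
  rewrite /psi; have [xB|xB] := ltP (normc (F x)) B.
    have [N0 NP] := phiP _ xB eps eps0; exists N0 => N /NP.
    rewrite indicE mem_set// mul1r.
    by rewrite -[N in iota 0 N]subn0 -/(index_iota 0 N) big_mkord.
  exists 0%N => N _; rewrite indicE memNset ?mul0r ?subr0.
    by rewrite ComplexField.Normc.normc0 ltW.
  by rewrite /A /=; apply/negP; rewrite -leNgt.
- move=> z Oz; apply: differentiable_comp; first exact: differentiable_prodf.
  by apply: (power_series_differentiable pb psiP); exact: interior_f_lt.
- by move=> z Oz; apply: psiP; exact: OmI_f_lt.
Qed.

Lemma projection_exists g : A2 Om g -> exists p, A2 Om p /\
  forall g1, A2 Om g1 -> L2inner Om (conj_mul prodf g \- p) g1 = 0.
Proof.
move=> Ag; have [a aG] := A2_radial Ag; have [pb _ _] := aG.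
have pbb := shifted_coef_bounded mD fD (mF D) F_lt c_gt0 B_gt0 pb.
have [p [mp dp cp]] := power_series_A2 pbb.
have [[b [_ sP _]] oP] := shifted_projection mD fD (mF D) F_lt orth c_gt0 B_gt0 aG
  (mfunCS mDO DDO mp) (fun x Dx => cp _ Dx).
have sPO : sqint leb4 DO (fun x => p (toC2 x)) by exact: (sqint_null mDO mD DDO DDO0 mp sP).
have Ap : A2 Om p by split; [exact/L2_sqint|].
have sh : L2 Om (conj_mul prodf g) := L2_conj_mul Ag.1.
have shp : L2 Om (conj_mul prodf g \- p).
  by apply/L2_sqint; exact: (sqintB mDO ((L2_sqint _).1 sh) sPO).
exists p; split => // g1 Ag1; rewrite (L2innerE shp Ag1.1).
exact: (oP (fun x => g1 (toC2 x)) (A2_radial Ag1)).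
Qed.

Local Notation proj g := (bergman_proj Om (conj_mul prodf g)).

Lemma projP g : A2 Om g -> A2 Om (proj g) /\
  forall g1, A2 Om g1 -> L2inner Om (hankel Om prodf g) g1 = 0.
Proof.
move=> Ag; have [p H] := projection_exists Ag.
exact: (@xgetPex _ (cst 0) [set p | A2 Om p /\
  forall g1, A2 Om g1 -> L2inner Om (conj_mul prodf g \- p) g1 = 0] (ex_intro _ p H)).
Qed.

Lemma hankel_L2 g : A2 Om g -> L2 Om (hankel Om prodf g).
Proof.
move=> Ag; have [Ap _] := projP Ag.
have /L2_sqint sh := L2_conj_mul Ag.1.
by apply/L2_sqint; exact: (sqintB mDO sh (A2_sqint Ap)).
Qed.

Let hankel_orth g n : A2 Om g ->
  ip leb4 D (fun x => hankel Om prodf g (toC2 x)) (fun x => F x ^+ n) = 0.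
Proof.
move=> Ag; have [_ oP] := projP Ag; rewrite -(oP _ (A2_pow n)).
by rewrite (L2innerE (hankel_L2 Ag) (A2_pow n).1).
Qed.

Let hankel_sqint g : A2 Om g -> sqint leb4 D (fun x => hankel Om prodf g (toC2 x)).
Proof. by move=> Ag; apply: sqintD'; apply/L2_sqint; exact: hankel_L2. Qed.

Let hankel_orth_radial g : A2 Om g -> forall G, radial leb4 D F B G ->
  ip leb4 D (fun x => hankel Om prodf g (toC2 x)) G = 0.
Proof.
move=> Ag; apply: (radial_ip_powers mD fD (mF D) F_lt orth (hankel_sqint Ag)).
by move=> n; exact: hankel_orth.
Qed.

(** The projection approximates at least as well as 0 does. *)
Lemma hankel_bounded g : A2 Om g ->
  L2norm Om (hankel Om prodf g) <= B * L2norm Om g.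
Proof.
move=> Ag; have [Ap _] := projP Ag.
rewrite (L2normE (hankel_L2 Ag)) (L2normE Ag.1).
have sg := sqintD' (A2_sqint Ag).
have [sh hle] := sqint_conj_mul mD (mF D) F_lt B_gt0 sg.
have rp := A2_radial Ap; have sp := sqintD' (A2_sqint Ap).
have z0 := @zero_expansion _ _ _ leb4 D F B mD fD.
have s0 : sqint leb4 D (fun=> 0) by have [] := z0.
have r0 : radial leb4 D F B (fun=> 0) by exists (fun=> 0).
have best := best_approximation mD sh sp s0 (hankel_orth_radial Ag rp) (hankel_orth_radial Ag r0).
have le1 : nrm2 leb4 D (fun x => hankel Om prodf g (toC2 x)) <=
    B ^+ 2 * nrm2 leb4 D (fun x => g (toC2 x)).
  apply: le_trans hle; apply: (le_trans best).
  by rewrite (@eq_nrm2 _ _ _ leb4 D _ (fun x => conjc (F x) * g (toC2 x)))// => x _; rewrite subr0.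
apply: (le_trans (ler_wsqrtr le1)).
by rewrite sqrtrM ?sqr_ge0// sqrtr_sqr ger0_norm// ltW.
Qed.

(** The difference of the two sides is a difference of projections, so it belongs to the
    Bergman space; it is also orthogonal to it, hence to itself. *)
Lemma hankel_linear (a : C) g h : A2 Om g -> A2 Om h ->
  eqL2 Om (hankel Om prodf (fun z => a * g z + h z))
    (fun z => a * hankel Om prodf g z + hankel Om prodf h z).
Proof.
move=> Ag Ah; have Agh := A2_lin a Ag Ah.
have [Ap _] := projP Ag; have [Aq _] := projP Ah; have [Ar _] := projP Agh.
pose gh z := a * g z + h z.
pose w z : C := (-1) * (a * proj g z + proj h z) + proj gh z.
have Aw : A2 Om w by apply: A2_lin => //; exact: A2_lin.
have wE z : w z = (a * hankel Om prodf g z + hankel Om prodf h z) - hankel Om prodf gh z.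
  rewrite /w /hankel /conj_mul /gh /=; ring.
have sw := A2_sqint Aw.
have w0 : nrm2 leb4 DO (fun x => w (toC2 x)) = 0.
  rewrite (nrm2_null mDO mD DDO DDO0 sw).
  have o : ip leb4 D (fun x => w (toC2 x)) (fun x => w (toC2 x)) = 0.
    apply: (radial_ip_powers mD fD (mF D) F_lt orth (sqintD' sw)) (A2_radial Aw) => n.
    under [X in ip _ _ X]eq_fun do rewrite wE.
    have s1 := hankel_sqint Ag; have s2 := hankel_sqint Ah; have s3 := hankel_sqint Agh.
    have sa := sqintZ a mD s1.
    rewrite (ipBl mD (sqintD mD sa s2) s3 (sFD n)) (ipDl mD sa s2 (sFD n)).
    by rewrite (ipZl a mD s1 (sFD n)) !hankel_orth// mulr0 addr0 subr0.
  by have := ip_self mD (sqintD' sw); rewrite o => -[].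
have := (nrm2_eq0 mDO sw).1 w0; apply: filterS => x Hx Dx.
by have := Hx Dx; rewrite wE => /eqP; rewrite subr_eq0 eq_sym => /eqP.
Qed.

Local Notation c := (fun n => nrm2 leb4 D (fun x => F x ^+ n)).

Definition unit_pow n (z : C2 R) : C := ((Num.sqrt (c n))^-1)%:C * prodf z ^+ n.

Lemma A2_unit_pow n : A2 Om (unit_pow n).
Proof.
have -> : unit_pow n = (fun z => (((Num.sqrt (c n))^-1)%:C - 1) * prodf z ^+ n + prodf z ^+ n).
  by apply/funext => z; rewrite mulrBl mul1r subrK.
by apply: A2_lin; exact: A2_pow.
Qed.

Let unit_pow_sqr n : (Num.sqrt (c n))^-1 ^+ 2 * c n = 1.
Proof. by rewrite exprVn sqr_sqrtr ?mulVf ?gt_eqF ?nrm2_ge0. Qed.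

Lemma unit_pow_orthonormal j k : L2inner Om (unit_pow j) (unit_pow k) = (j == k)%:R.
Proof.
rewrite (L2innerE (A2_unit_pow j).1 (A2_unit_pow k).1).
have -> : ip leb4 D (fun x => unit_pow j (toC2 x)) (fun x => unit_pow k (toC2 x)) =
  ((Num.sqrt (c j))^-1)%:C * (conjc ((Num.sqrt (c k))^-1)%:C * ip leb4 D (fun x => F x ^+ j) (fun x => F x ^+ k)).
  by rewrite -(ipZr _ mD (sFD k) (sFD j)) -(ipZl _ mD (sFD j) (sqintZ _ mD (sFD k))).
have [<-|jk] := eqVneq j k.
  rewrite (ip_self mD (sFD j)) mulrA mul_conjc normc_real real_normK ?num_real//.
  by rewrite -rmorphM /= unit_pow_sqr.
rewrite (_ : ip _ _ _ _ = 0) ?mulr0//.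
have := orth B jk; suff -> : D `&` [set x | normc (F x) < B] = D by [].
by apply/seteqP; split => [x []//|x Dx]; split => //=; exact: F_lt.
Qed.

Lemma unit_pow_dense : dense_in_A2 Om [set h | exists (s : seq nat) (b : nat -> C),
  h = fun z => \sum_(j <- s) b j * unit_pow j z].
Proof.
move=> g Ag eps eps0; have [a aG] := A2_radial Ag.
have e2 : 0 < (eps / 2) ^+ 2 by apply: exprn_gt0; rewrite divr_gt0.
have [N /(_ N (leqnn N)) NP] := radial_converges_mean mD fD (mF D) F_lt orth aG e2.
pose h z : C := \sum_(n <- iota 0 N) a n * prodf z ^+ n.
have Ah : A2 Om h := A2_sum N a.
exists h.
  split => //; exists (iota 0 N), (fun n => a n * (Num.sqrt (c n))%:C).
  apply/funext => z; apply: eq_bigr => n _; rewrite /unit_pow mulrA -[_ * _ * _%:C]mulrA -rmorphM /=.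
  by rewrite divff ?mulr1// gt_eqF// sqrtr_gt0.
have sgh : sqint leb4 DO (fun x => (g \- h) (toC2 x)).
  exact: (sqintB mDO (A2_sqint Ag) (A2_sqint Ah)).
rewrite (L2normE ((L2_sqint (g \- h)).2 sgh)).
apply: (@le_lt_trans _ _ (eps / 2)); last by rewrite ltr_pdivrMr// ltr_pMr// ltr1n.
rewrite -[leRHS]ger0_norm; last by rewrite divr_ge0// ltW.
rewrite -sqrtr_sqr; apply: ler_wsqrtr; apply: le_trans NP.
rewrite (@eq_nrm2 _ _ _ leb4 D _ (fun x => g (toC2 x) - \sum_(n < N) a n * F x ^+ n))//.
move=> x _; congr (_ - _).
by rewrite /h -[N in iota 0 N]subn0 -/(index_iota 0 N) big_mkord.
Qed.

Lemma hankel_unit_pow_sum :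
  (\esum_(j in [set: nat]) ((L2norm Om (hankel Om prodf (unit_pow j)) ^+ 2)%:E) < +oo)%E.
Proof.
have tele n : L2norm Om (hankel Om prodf (unit_pow n)) ^+ 2 <=
    moment_ratio leb4 D F n.+1 - moment_ratio leb4 D F n.
  have Au := A2_unit_pow n; have [Ap _] := projP Au.
  rewrite (L2normE (hankel_L2 Au)) sqr_sqrtr ?nrm2_ge0//.
  exact: (projection_defect_le mD fD (mF D) F_lt c_gt0 B_gt0 (unit_pow_sqr n)
    (sqintD' (A2_sqint Ap)) (hankel_orth_radial Au) (A2_radial Ap)).
rewrite -nneseries_esumT; last by move=> n; rewrite lee_fin sqr_ge0.
apply: (@le_lt_trans _ _ (B ^+ 2)%:E); last exact: ltry.
apply: lime_le.
  by apply: is_cvg_nneseries => n _ _; rewrite lee_fin sqr_ge0.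
apply: nearW => N; rewrite sumEFin lee_fin big_mkord.
apply: le_trans (moment_ratio_telescope mD fD (mF D) F_lt c_gt0 B_gt0 N).
by apply: ler_sum => i _; exact: tele.
Qed.

Lemma hankel_nonzero : nonzero_operator Om (hankel_dom Om prodf) (hankel Om prodf).
Proof.
have A1 := A2_pow 0; have [Ap _] := projP A1.
exists (fun z => prodf z ^+ 0); first by split => //; exact: L2_conj_mul A1.1.
move=> H0; have := (nrm2_eq0 mDO ((L2_sqint _).1 (hankel_L2 A1))).2 H0.
rewrite (nrm2_null mDO mD DDO DDO0 ((L2_sqint _).1 (hankel_L2 A1))).
have := conj_not_radial mD fD (mF D) F_lt orth c_gt0 B_gt0 (A2_radial Ap).
rewrite (@eq_nrm2 _ _ _ leb4 D _ (fun x => hankel Om prodf (fun z => prodf z ^+ 0) (toC2 x))).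
  by move=> /[swap] ->; rewrite ltxx.
by move=> x _; rewrite /hankel /conj_mul /= mulr1.
Qed.

Lemma hankel_dom_dense : dense_in_A2 Om (hankel_dom Om prodf).
Proof.
move=> g Ag eps eps0; exists g; first by split => //; split => //; exact: L2_conj_mul Ag.1.
rewrite /L2norm (@eq_Rintegral _ _ _ leb4 _ (fun=> 0)); last first.
  by move=> x _; rewrite /= subrr ComplexField.Normc.normc0 expr0n.
by rewrite Rintegral_cst// mul0r sqrtr0.
Qed.

End BergmanProjection.

Theorem mainTheorem2 (R : realType) :
  let f := fun z : C2 R => z.1 * z.2 in
  [/\ A2 (@Omega0 R) f,
      nonzero_operator (@Omega0 R) (hankel_dom (@Omega0 R) f)
        (hankel (@Omega0 R) f) &
      densely_defined_hilbert_schmidt (@Omega0 R) (hankel_dom (@Omega0 R) f)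
        (hankel (@Omega0 R) f)].
Proof.
move=> f; split; first exact: (@A2_pow R 1).
  exact: hankel_nonzero.
split; first exact: hankel_dom_dense.
exists (hankel (@Omega0 R) f); split.
- split.
  + by move=> g; exact: hankel_L2.
  + by move=> a g h; exact: hankel_linear.
  + by exists (expR 1 ^+ 2) => g; exact: hankel_bounded.
- by move=> g _; apply: aeW.
- exists nat, (@unit_pow R); split; last exact: hankel_unit_pow_sum.
  split; [exact: A2_unit_pow|exact: unit_pow_orthonormal|exact: unit_pow_dense].
Qed.
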